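(* Let $k\ge0$ be an integer, $\varepsilon>0$, $0<T<\infty$, and suppose the micro-macro system has a smooth exact solution $(\rho,g)$ on $[0,T]$; write $\rho^n=\rho(\cdot,n\Delta t)$, $g^n=g(\cdot,\cdot,n\Delta t)$. Let $(\rho_h^n,g_h^n)$ be the DG-IMEX1 numerical solution with mesh size $h$, time step $\Delta t$ and initialization $\rho_h^0=\pi_h\rho^0$, $g_h^0=\pi_h g^0$. Let $\sigma\in(0,1)$ be any constant and assume $\Delta t\le\sigma\Delta t_{stab}$ and $\Delta t<\frac12$. Then there is a constant $C_*>0$, independent of $h$, $\Delta t$ and $n$, and depending on $k$, $T$, $\|v\|_\infty$ and an upper bound over $t\in[0,T]$ of $$\|\partial_{tt}\rho\|,\ \|\partial_{xt}\rho\|,\ \|\rho\|_{H^{k+1}(\Omega_x)},\ \|\partial_t\rho\|_{H^{k+1}(\Omega_x)},\ |||\partial_{tt}g|||,\ \langle\|g\|^2_{H^{k+1}(\Omega_x)}\rangle,\ \langle\|\partial_t g\|^2_{H^{k+1}(\Omega_x)}\rangle$$ (in particular, depending on $\varepsilon$ only through these norms), such that for all integers $n\ge1$ with $n\Delta t\le T$: (1) if either alternating flux pair is used, $$\|\rho^n-\rho_h^n\|^2+\varepsilon^2|||g^{n-1}-g_h^{n-1}|||^2\le C_*\Big((1+\varepsilon^2)h^{2k+2}+\Delta t^2+\frac1{1-\sigma}\big((1+\varepsilon^4)\Delta t^2+h^{2k+2}+\varepsilon h^{2k+1}\big)\Big);$$ (2) if the central flux pair is used, $$\|\rho^n-\rho_h^n\|^2+\varepsilon^2|||g^{n-1}-g_h^{n-1}|||^2\le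 C_*\Big(\varepsilon^2h^{2k+2}+h^{2k}+\Delta t^2+\frac1{1-\sigma}\big((1+\varepsilon^4)\Delta t^2+h^{2k}+\varepsilon h^{2k+1}\big)\Big).$$
   Context: Model. Either (telegraph equation) $\Omega_v=\{-1,1\}$ and $\langle f\rangle=\int_{\Omega_v} f\,d\mu=\frac12(f(v=-1)+f(v=1))$, or (one-group transport equation in slab geometry) $\Omega_v=[-1,1]$ and $\langle f\rangle=\int_{\Omega_v} f\,d\mu=\frac12\int_{-1}^1 f(v)\,dv$. The kinetic equation is $\varepsilon f_t+v\partial_x f=\frac1\varepsilon(\langle f\rangle-f)$ for $f=f(x,v,t)$, $x\in\Omega_x=[x_{\min},x_{\max}]$ (a fixed interval), $v\in\Omega_v$, $t>0$, with periodic boundary conditions in $x$. Writing $f=\rho+\varepsilon g$ with $\rho=\langle f\rangle$, $\langle g\rangle=0$, and $\Pi f=\langle f\rangle$, it is equivalent to the micro-macro system $\partial_t\rho+\partial_x\langle vg\rangle=0$, $\partial_t g+\frac1\varepsilon(\mathbf I-\Pi)(v\partial_x g)+\frac1{\varepsilon^2}v\partial_x\rho=-\frac1{\varepsilon^2}g$. Discrete space. $\Omega_x$ is divided into $N$ elements $I_i=[x_{i-1/2},x_{i+1/2}]$, $i=1,\dots,N$, of equal length $h$ (with $x_{1/2}$ and $x_{N+1/2}$ identified by periodicity). $U_h^k=\{u\in L^2(\Omega_x): u|_{I_i}\in P^k(I_i)\ \forall i\}$, $P^k$ = polynomials of degree at most $k$. For piecewise smooth $u$, $u^\pm_{i-1/2}$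 are the right/left limits at $x_{i-1/2}$, $[u]=u^+-u^-$, $\{u\}=\frac12(u^++u^-)$. All sums $\sum_i$ are over $i=1,\dots,N$. $(\cdot,\cdot)$ and $\|\cdot\|$ are the $L^2(\Omega_x)$ inner product and norm, and $|||\phi|||=\langle\|\phi\|^2\rangle^{1/2}$. $\pi_h$ is the $L^2(\Omega_x)$-orthogonal projection onto $U_h^k$ (applied for each $v$). Functions of $(x,v)$ ''in $U_h^k$'' belong to $U_h^k$ in $x$ for each $v$ (and are square integrable in $v$ with respect to $\mu$). Forms. $a_h(g,\phi)=-\sum_i\int_{I_i}\langle vg\rangle\partial_x\phi\,dx-\sum_i\widehat{\langle vg\rangle}_{i-1/2}[\phi]_{i-1/2}$; $d_h(\rho,\psi)=\sum_i\int_{I_i}\rho\,\partial_x\psi\,dx+\sum_i\widehat\rho_{i-1/2}[\psi]_{i-1/2}$; $\mathcal D_h(g;v)\in U_h^k$ is defined by $(\mathcal D_h(g;v),\psi)=-\sum_i\int_{I_i}vg\,\partial_x\psi\,dx-\sum_i\widetilde{(vg)}_{i-1/2}[\psi]_{i-1/2}$ for all $\psi\in U_h^k$, with the upwind flux $\widetilde{vg}=v\{g\}-\frac{|v|}2[g]$ (i.e. $vg^-$ if $v>0$, $vg^+$ if $v<0$); $b_{h,v}(g,\psi)=(\mathcal D_h(g;v)-\langle\mathcal D_h(g;v)\rangle,\psi)$. Flux pairs: left-right alternating $\widehat{\langle vg\rangle}=\langle vg\rangle^-,\ \widehat\rho=\rho^+$; right-left alternating $\widehat{\langle vg\rangle}=\langle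 vg\rangle^+,\ \widehat\rho=\rho^-$; central $\widehat{\langle vg\rangle}=\{\langle vg\rangle\},\ \widehat\rho=\{\rho\}$. DG-IMEX1 scheme. Given $\rho_h^n(\cdot),g_h^n(\cdot,v)\in U_h^k$, find $\rho_h^{n+1}(\cdot),g_h^{n+1}(\cdot,v)\in U_h^k$ such that for all $\phi,\psi\in U_h^k$ and all $v\in\Omega_v$, $\big(\frac{\rho_h^{n+1}-\rho_h^n}{\Delta t},\phi\big)+a_h(g_h^n,\phi)=0$, $\big(\frac{g_h^{n+1}-g_h^n}{\Delta t},\psi\big)+\frac1\varepsilon b_{h,v}(g_h^n,\psi)-\frac v{\varepsilon^2}d_h(\rho_h^{n+1},\psi)=-\frac1{\varepsilon^2}(g_h^{n+1},\psi)$. Constants. $C_{\rm inv},\hat C_{\rm inv}>0$ are constants (depending only on $k$) such that for all intervals $[a,b]$ and $w\in P^k([a,b])$: $|w(y)|^2(b-a)\le C_{\rm inv}\int_a^b w^2dx$ for $y=a$ or $b$, and $(b-a)^2\int_a^b|w_x|^2dx\le\hat C_{\rm inv}\int_a^b w^2dx$. With $\|v\|_\infty=\sup_{v\in\Omega_v}|v|$: $\alpha_1=(\|v\|_\infty^2+\langle v^2\rangle)\hat C_{\rm inv}$, $\alpha_2=2(\|v\|_\infty+\langle|v|\rangle)C_{\rm inv}$, $\alpha_3=2\|v\|_\infty C_{\rm inv}$. The time step bound is $\Delta t_{stab}=\frac{h}{\alpha_1+\alpha_2\alpha_3}\big(h+\min(\varepsilon,\frac{\alpha_2h}{\alpha_1})\alpha_3\big)$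 for $k\ge1$, and $\Delta t_{stab}=\frac{2h}{\alpha_2\alpha_3}(h+\alpha_3\varepsilon)$ for $k=0$. *)

(* Defs.v *)
From HB Require Import structures.
From mathcomp Require Export all_boot all_order all_algebra.
From mathcomp Require Export all_classical all_reals all_analysis.
Export Order.TTheory GRing.Theory Num.Theory.
Export numFieldNormedType.Exports.

Set Implicit Arguments.
Unset Strict Implicit.
Unset Printing Implicit Defensive.

#[export] Set Implicit Arguments.
#[export] Unset Strict Implicit.
#[export] Unset Printing Implicit Defensive.

Local Open Scope classical_set_scope.
Local Open Scope ring_scope.

Inductive model := Telegraph | Transport.

Section Velocity.
Variables (R : realType) (m : model).

Definition Omega_v : set R :=
  match m with
  | Telegraph => [set v | v = -1 \/ v = 1]
  | Transport => `[-1, 1]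
  end.

Definition avg (f : R -> R) : R :=
  match m with
  | Telegraph => (f (-1) + f 1) / 2
  | Transport => 2^-1 * \int[lebesgue_measure]_(v in `[-1, 1]) f v
  end.

Definition vsquare_integrable (f : R -> R) : Prop :=
  match m with
  | Telegraph => True
  | Transport =>
      measurable_fun (`[-1, 1] : set R) f /\
      lebesgue_measure.-integrable (`[-1, 1] : set R) (fun v => (f v ^+ 2)%:E)
  end.

Definition vsup : R := sup [set `|v| | v in Omega_v].

(* [vnorm (fun v => || phi(., v) ||)] is [|||phi|||]. *)
Definition vnorm (nrm : R -> R) : R := Num.sqrt (avg (fun v => nrm v ^+ 2)).

End Velocity.

Section ContinuousNorms.
Variables (R : realType) (xmin xmax : R).

Definition L2norm (u : R -> R) : R :=
  Num.sqrt (\int[lebesgue_measure]_(x in `[xmin, xmax]) (u x ^+ 2)).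

Definition Hnorm (l : nat) (u : R -> R) : R :=
  Num.sqrt (\sum_(j < l.+1) L2norm (derive1n j u) ^+ 2).

End ContinuousNorms.

Section ExactSolution.
Variables (R : realType) (m : model) (xmin xmax eps T : R).

(* The time derivative is taken inside [0, T]: it is one-sided at the two
   end points. *)
Definition time_filter (t : R) : set_system R := within `[0, T] t^'.

Definition time_quotient (u : R -> R) (t s : R) : R := (u s - u t) / (s - t).

Definition dx (u : R -> R -> R) : R -> R -> R :=
  fun x t => derive1 (fun y => u y t) x.

Definition dt (u : R -> R -> R) : R -> R -> R :=
  fun x t => lim (time_quotient (u x) t @ time_filter t).

Inductive direction := DirX | DirT.

Definition pderiv (w : seq direction) (u : R -> R -> R) : R -> R -> R :=
  foldr (fun d => match d with DirX => dx | DirT => dt end) u w.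

(* Partial derivatives in [(x, t)] of every order, taken in every succession,
   exist and are jointly continuous in [(x, v, t)] on [R x Omega_v x [0, T]].
   No derivative in [v] is required. *)
Definition smooth (u : R -> R -> R -> R) : Prop :=
  forall w : seq direction,
  let D v := pderiv w (fun x t => u x v t) in
  [/\ forall x v t, Omega_v m v -> 0 <= t <= T ->
        derivable (fun y => D v y t) x 1,
      forall x v t, Omega_v m v -> 0 <= t <= T ->
        cvg (time_quotient (D v x) t @ time_filter t)
    & {within [set z : R * R * R | Omega_v m z.1.2 /\ 0 <= z.2 <= T],
        continuous (fun z : R * R * R => D z.1.2 z.1.1 z.2)} ].

(* Periodic boundary conditions: the functions are extended to all real [x]
   with period [xmax - xmin]. *)
Definition smooth_solution (rho : R -> R -> R) (g : R -> R -> R -> R) : Prop :=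
  smooth (fun x _ t => rho x t) /\ smooth g /\
  (forall x t, 0 <= t <= T -> rho (x + (xmax - xmin)) t = rho x t) /\
  (forall x v t, Omega_v m v -> 0 <= t <= T ->
     g (x + (xmax - xmin)) v t = g x v t) /\
  (forall x t, 0 <= t <= T -> avg m (fun v => g x v t) = 0) /\
  (forall x t, 0 <= t <= T ->
     dt rho x t + dx (fun y s => avg m (fun v => v * g y v s)) x t = 0) /\
  (forall x v t, Omega_v m v -> 0 <= t <= T ->
     let vdxg w := w * dx (fun y s => g y w s) x t in
     dt (fun y s => g y v s) x t + eps^-1 * (vdxg v - avg m vdxg)
       + (eps ^+ 2)^-1 * (v * dx rho x t) = - (eps ^+ 2)^-1 * g x v t).

Definition norms_bounded (k : nat) (M : R)
    (rho : R -> R -> R) (g : R -> R -> R -> R) : Prop :=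
  let nrm := L2norm xmin xmax in
  let hnrm := Hnorm xmin xmax k.+1 in
  let gv v := fun x t => g x v t in
  forall t, 0 <= t <= T ->
  [/\ nrm (fun x => dt (dt rho) x t) <= M,
      nrm (fun x => dx (dt rho) x t) <= M,
      hnrm (fun x => rho x t) <= M
    & hnrm (fun x => dt rho x t) <= M] /\
  [/\ vnorm m (fun v => nrm (fun x => dt (dt (gv v)) x t)) <= M,
      avg m (fun v => hnrm (fun x => g x v t) ^+ 2) <= M
    & avg m (fun v => hnrm (fun x => dt (gv v) x t) ^+ 2) <= M].

End ExactSolution.

(* [U_h^k]: an element is the family of its restrictions to the [N] cells. *)
Definition Uh (R : realType) (k N : nat) := {ffun 'I_N -> {poly_k.+1 R}}.

(* Broken functions: [u i] is the restriction to the [i]-th cell; only its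
   values on that closed cell matter, the values at the two end points being
   the one-sided limits. *)
Definition broken (R : realType) (N : nat) := 'I_N -> R -> R.

Inductive flux := LeftRight | RightLeft | Central.

Definition alternating (fl : flux) : Prop :=
  match fl with LeftRight | RightLeft => True | Central => False end.

Section Discrete.
Variables (R : realType) (m : model) (xmin xmax : R) (k N : nat).

Local Notation U := (Uh R k N).
Local Notation B := (broken R N).

Definition poly_at (u : U) (i : 'I_N) : {poly R} := u i.

Definition to_broken (u : U) : B := fun i x => (poly_at u i).[x].

Definition mesh_size : R := (xmax - xmin) / N%:R.

(* Indices are shifted to start at 0: [node i] is the left end point of the
   cell [i : 'I_N] and [node i.+1] its right end point. *)
Definition node (i : nat) : R := xmin + i%:R * mesh_size.

Definition cell (i : 'I_N) : set R := `[node i, node i.+1].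

Definition ip (u w : B) : R :=
  \sum_(i < N) \int[lebesgue_measure]_(x in cell i) (u i x * w i x).

Definition bnorm (u : B) : R := Num.sqrt (ip u u).

(* Traces at [node i]; [ord_pred] is cyclic, so at [node 0] the left trace is
   the value at [xmax]. *)
Definition trace_r (u : B) (i : 'I_N) : R := u i (node i).
Definition trace_l (u : B) (i : 'I_N) : R :=
  u (ord_pred i) (node (ord_pred i).+1).
Definition jump (u : B) (i : 'I_N) : R := trace_r u i - trace_l u i.
Definition mean (u : B) (i : 'I_N) : R := (trace_r u i + trace_l u i) / 2.

Definition flux_vg (fl : flux) : B -> 'I_N -> R :=
  match fl with
  | LeftRight => trace_l | RightLeft => trace_r | Central => mean
  end.

Definition flux_rho (fl : flux) : B -> 'I_N -> R :=
  match fl with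
  | LeftRight => trace_r | RightLeft => trace_l | Central => mean
  end.

Definition upwind (v : R) (u : B) (i : 'I_N) : R :=
  v * mean u i - `|v| / 2 * jump u i.

(* [sum_i int_{I_i} u psi_x dx + sum_i uhat_{i-1/2} [psi]_{i-1/2}] *)
Definition weak_form (u : B) (uhat : 'I_N -> R) (psi : U) : R :=
  \sum_(i < N) \int[lebesgue_measure]_(x in cell i)
     (u i x * (deriv (poly_at psi i)).[x])
  + \sum_(i < N) uhat i * jump (to_broken psi) i.

Definition avg_broken (u : R -> B) : B := fun i x => avg m (fun v => u v i x).

Definition a_h (fl : flux) (g : R -> U) (phi : U) : R :=
  let vg := avg_broken (fun v i x => v * to_broken (g v) i x) in
  - weak_form vg (flux_vg fl vg) phi.

Definition d_h (fl : flux) (rho psi : U) : R :=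
  weak_form (to_broken rho) (flux_rho fl (to_broken rho)) psi.

(* The element of [U_h^k] that represents the linear form [l] for the [L^2]
   inner product (it exists and is unique when [xmin < xmax] and [0 < N]). *)
Definition riesz (l : U -> R) : U :=
  xget 0 [set w : U | forall psi : U, ip (to_broken w) (to_broken psi) = l psi].

Definition pi_h (u : R -> R) : U :=
  riesz (fun psi => ip (fun _ => u) (to_broken psi)).

Definition D_h (g : U) (v : R) : U :=
  riesz (fun psi => - weak_form (fun i x => v * to_broken g i x)
                        (upwind v (to_broken g)) psi).

Definition b_h (v : R) (g : R -> U) (psi : U) : R :=
  let Dg w := to_broken (D_h (g w) w) in
  ip (fun i x => Dg v i x - avg_broken Dg i x) (to_broken psi).

Definition in_velocity_space (g : R -> U) : Prop :=
  forall (i : 'I_N) (x : R), vsquare_integrable m (fun v => to_broken (g v) i x).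

Definition dg_imex1 (fl : flux) (eps tau : R)
    (rhoh : nat -> U) (gh : nat -> R -> U) : Prop :=
  forall n : nat,
  [/\ in_velocity_space (gh n),
      forall phi : U,
        ip (to_broken (tau^-1 *: (rhoh n.+1 - rhoh n))) (to_broken phi)
          + a_h fl (gh n) phi = 0
    & forall (v : R) (psi : U), Omega_v m v ->
        ip (to_broken (tau^-1 *: (gh n.+1 v - gh n v))) (to_broken psi)
          + eps^-1 * b_h v (gh n) psi
          - v / eps ^+ 2 * d_h fl (rhoh n.+1) psi
        = - (eps ^+ 2)^-1 * ip (to_broken (gh n.+1 v)) (to_broken psi)].

End Discrete.

Section TimeStep.
Variables (R : realType) (m : model) (k : nat) (Cinv Chinv : R).

Definition inverse_inequalities : Prop :=
  forall (a b : R) (w : {poly_k.+1 R}), a < b ->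
  let p : {poly R} := w in
  let sq := \int[lebesgue_measure]_(x in `[a, b]) (p.[x] ^+ 2) in
  [/\ p.[a] ^+ 2 * (b - a) <= Cinv * sq,
      p.[b] ^+ 2 * (b - a) <= Cinv * sq
    & (b - a) ^+ 2 *
        \int[lebesgue_measure]_(x in `[a, b]) ((deriv p).[x] ^+ 2)
      <= Chinv * sq].

Definition alpha1 : R := (vsup R m ^+ 2 + avg m (fun v => v ^+ 2)) * Chinv.
Definition alpha2 : R := 2 * (vsup R m + avg m (fun v => `|v|)) * Cinv.
Definition alpha3 : R := 2 * vsup R m * Cinv.

Definition dt_stab (eps h : R) : R :=
  if k == 0%N then 2 * h / (alpha2 * alpha3) * (h + alpha3 * eps)
  else h / (alpha1 + alpha2 * alpha3)
         * (h + Num.min eps (alpha2 * h / alpha1) * alpha3).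

End TimeStep.

(* Main.v *)
Require Import Defs.
From mathcomp Require Import measurable_realfun ring lra.
Local Open Scope classical_set_scope.
Local Open Scope ring_scope.

(** Project the exact solution on the discrete space: by the [L^2] projection
    for central fluxes, by the Gauss--Radau projection that matches the side of
    the flux for alternating ones. The difference with the numerical solution
    is governed by the energy
    [|e_rho^(n+1)|^2 + eps^2 |||e_g^n|||^2]. Testing the equation of [g] with
    [e_g^(n+1)] and the following equation of [rho] with [e_rho^(n+2)], the
    coupling terms combine with the squared increments, and the time step
    condition leaves the dissipation
    [(1 - sigma) (|||e_g|||^2 + eps/2 <|v| sum [e_g]^2>)]. The residuals of the
    projected exact solution are absorbed in it by Young's inequality, which
    produces the factor [1/(1 - sigma)], and Gronwall's lemma concludes. Only
    integrated norms of the exact solution may enter: time increments are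
    therefore estimated after pairing with the test function, by a mean value
    inequality for scalar functions of time. *)

(** * Integrals and velocity averages *)

(** Two obstacles shape the development. First, in [v] the numerical solution is only square
    integrable and the exact one only continuous, while the estimates average over [v]. Discrete
    functions are therefore read through finitely many coordinates, so that averages pass through
    linear forms, and the exact solution enters through uniform continuity on boxes, which survives
    averaging, integration in [x] and pairing. Second, the initial data are $L^2$ projections, while
    for alternating fluxes the error is measured against Gauss--Radau projections, and the staggered
    energy starts with $\rho$ at the first time level. The first step is estimated separately; it
    costs $(\Delta t/h)^2$, which is bounded by a multiple of $1+\varepsilon^2$ because the time
    step is at most of order $h(h+\varepsilon)$. In Young's inequality the weights are tuned so that
    the residuals of the $g$ equation spend no more than the fraction $1-\sigma$ of the dissipation.
    The projection error of $\partial_t g$ carries a factor $\varepsilon^2$ and is charged to the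
    energy instead, so it escapes the factor $1/(1-\sigma)$. *)

Section SegmentIntegral.
Variable R : realType.
Implicit Types (a b c : R) (f g : R -> R).
Local Notation mu := (@lebesgue_measure R).
Local Notation I a b f := (\int[mu]_(x in `[a, b]) f x).

Lemma cont_cst (c : R) : continuous ((fun=> c) : R -> R).
Proof. by move=> x; exact: cst_continuous. Qed.

Lemma contD f g : continuous f -> continuous g -> continuous (fun x => f x + g x).
Proof. by move=> cf cg x; apply: continuousD; [exact: cf|exact: cg]. Qed.

Lemma contM f g : continuous f -> continuous g -> continuous (fun x => f x * g x).
Proof. by move=> cf cg x; apply: continuousM; [exact: cf|exact: cg]. Qed.

Lemma contZ c f : continuous f -> continuous (fun x => c * f x).
Proof. by apply: contM; exact: cont_cst. Qed.

Lemma contB f g : continuous f -> continuous g -> continuous (fun x => f x - g x).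
Proof. by move=> cf cg x; apply: continuousB; [exact: cf|exact: cg]. Qed.

Lemma contX2 f : continuous f -> continuous (fun x => f x ^+ 2).
Proof. by move=> cf; exact: (contM cf cf). Qed.

Lemma cont_integrable a b f : continuous f ->
  mu.-integrable `[a, b] (EFin \o f).
Proof.
move=> cf; apply: continuous_compact_integrable; first exact: segment_compact.
exact: continuous_subspaceT.
Qed.

Lemma eq_I a b f g : (forall x, a <= x <= b -> f x = g x) -> I a b f = I a b g.
Proof.
move=> fg; apply: eq_Rintegral => x; rewrite inE/= in_itv/= => xab.
exact: fg.
Qed.

Lemma I_linear a b c f g : continuous f -> continuous g ->
  I a b (fun x => c * f x + g x) = c * I a b f + I a b g.
Proof.
move=> cf cg; rewrite RintegralD//.
- by rewrite RintegralZl//; exact: cont_integrable.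
- by apply: (@cont_integrable a b (fun x => c * f x)); exact: contZ.
- exact: cont_integrable.
Qed.

Lemma I_le a b f g : continuous f -> continuous g ->
  (forall x, a <= x <= b -> f x <= g x) -> I a b f <= I a b g.
Proof.
move=> cf cg fg; apply: le_Rintegral => //; first exact: cont_integrable.
exact: cont_integrable.
Qed.

Lemma I_ge0 a b f : (forall x, a <= x <= b -> 0 <= f x) -> 0 <= I a b f.
Proof. by move=> f0; apply: Rintegral_ge0 => x /=; rewrite in_itv/= => /f0. Qed.

Lemma I_cst a b c : a <= b -> I a b (fun=> c) = c * (b - a).
Proof.
move=> ab; rewrite (@Rintegral_cst _ _ _ lebesgue_measure `[a, b]%classic)//.
congr (_ * _); rewrite [X in fine X](lebesgue_measure_itv `[a, b])/= lte_fin.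
by case: ltgtP ab => //= ->; rewrite subrr.
Qed.

Lemma I_split a b c f : continuous f -> a <= c <= b ->
  I a b f = I a c f + I c b f.
Proof.
move=> cf /andP[ac cb].
have := @Rintegral_itvB R f (BLeft a) (BRight b) c (cont_integrable a b cf).
rewrite !bnd_simp => /(_ ac cb).
rewrite Rintegral_itv_obnd_cbnd; last first.
  by apply: integrableS (cont_integrable c b cf) => //;
     apply: subset_itv_oc_cc.
by move/eqP; rewrite subr_eq addrC => /eqP.
Qed.

Lemma continuous_horner_fun (p : {poly R}) : continuous (fun x => p.[x]).
Proof. exact: continuous_horner. Qed.

Lemma I_FTC a b (F f : R -> R) : a <= b -> continuous f ->
  (forall x, is_derive x (1 : R) F (f x)) -> I a b f = F b - F a.
Proof.
move=> ab cf dF; case: ltgtP ab => // [ab _|-> _]; last first.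
  by rewrite set_itv1 Rintegral_set1 subrr.
have cF : continuous F.
  by move=> x; apply: differentiable_continuous; apply/derivable1_diffP;
     exact: ex_derive.
rewrite /Rintegral (@continuous_FTC2 _ f F)//.
- exact: continuous_subspaceT.
- split.
  + by move=> x _; exact: ex_derive.
  + by apply: cvg_at_right_filter; exact: cF.
  + by apply: cvg_at_left_filter; exact: cF.
- by move=> x _; rewrite derive1E derive_val.
Qed.

Lemma is_derive_horner_fun (p : {poly R}) (x : R) :
  is_derive x (1 : R) (fun y => p.[y]) (deriv p).[x].
Proof.
elim/poly_ind: p => [|p c IH].
  rewrite (_ : (fun y => _) = cst 0); last by apply/funext => y; rewrite horner0.
  by rewrite linear0 horner0; exact: is_derive_cst.
rewrite (_ : (fun y => _) = (fun y => p.[y]) * id + cst c); last first.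
  by apply/funext => y; rewrite !hornerE.
rewrite derivD derivM derivX derivC !hornerE.
apply: is_derive_eq; rewrite /GRing.scale/=; ring.
Qed.

Lemma I_D a b f g : continuous f -> continuous g ->
  I a b (fun x => f x + g x) = I a b f + I a b g.
Proof.
move=> cf cg; rewrite -[X in _ = X + _]mul1r -I_linear//.
by apply: eq_I => x _; rewrite mul1r.
Qed.

Lemma I_Z a b c f : continuous f -> I a b (fun x => c * f x) = c * I a b f.
Proof.
move=> cf; rewrite -[RHS]addr0 -[X in _ = _ + X](_ : I a b (fun=> 0) = 0).
  rewrite -I_linear//; last by move=> x; exact: cst_continuous.
  by apply: eq_I => x _; rewrite addr0.
by rewrite Rintegral_cst// mul0r.
Qed.

Lemma I_abs a b f g : continuous f -> continuous g ->
  (forall x, a <= x <= b -> `|f x| <= g x) -> `|I a b f| <= I a b g.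
Proof.
move=> cf cg fg; rewrite ler_norml -mulN1r -I_Z// !I_le//.
- by move=> x /fg; rewrite ler_norml => /andP[].
- exact: contZ.
- by move=> x /fg; rewrite ler_norml mulN1r => /andP[].
Qed.

Lemma I_bound a b c f : a <= b -> continuous f ->
  (forall x, a <= x <= b -> `|f x| <= c) -> `|I a b f| <= c * (b - a).
Proof.
move=> ab cf fc; rewrite -I_cst//; apply: I_abs => //; exact: cont_cst.
Qed.

(* The function is only assumed to vary at rate at most [K] near each point,
   inside the segment: no derivative is needed at the end points. *)
Lemma lipschitz_of_local_rate (f : R -> R) a b (K : R) : a <= b ->
  (forall t, a <= t <= b -> forall e : R, 0 < e -> exists2 d : R, 0 < d &
     forall s, a <= s <= b -> `|s - t| < d ->
       `|f s - f t| <= (K + e) * `|s - t|) ->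
  `|f b - f a| <= K * (b - a).
Proof.
move=> ab fK.
suff H (e : R) : 0 < e -> `|f b - f a| <= (K + e) * (b - a).
  move: ab; rewrite le_eqVlt => /predU1P[->|ab].
    by rewrite !subrr normr0 mulr0.
  apply/ler_addgt0Pr => e e0.
  have := H (e / (b - a)); rewrite divr_gt0 ?subr_gt0// => /(_ isT).
  by rewrite mulrDl divfK// subr_eq0 gt_eqF.
move=> e0.
(* Continuous induction on the points where the bound with slope [K + e] holds: their supremum [c]
   is one of them, and the local rate at [c] excludes [c < b]. *)
pose A := [set t | a <= t <= b /\ `|f t - f a| <= (K + e) * (t - a)].
have Aa : A a by split; rewrite ?lexx ?ab// !subrr normr0 mulr0.
have hA : has_sup A by split; [exists a|exists b => t [/andP[]]].
pose c := sup A.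
have ac : a <= c by apply: sup_upper_bound.
have cb : c <= b by apply: ge_sup => //; [exists a|move=> t [/andP[]]].
have cab : a <= c <= b by rewrite ac cb.
have [d d0 Hd] := fK c cab e e0.
have Ac : A c.
  split=> //; have [t At ct] := sup_adherent d0 hA.
  have tc : t <= c by apply: sup_upper_bound.
  case: At => tab Ht.
  have tc' : `|t - c| = c - t by rewrite distrC ger0_norm ?subr_ge0.
  have := Hd t tab; rewrite tc' distrC => Hd'.
  have H1 : `|f c - f t| <= (K + e) * (c - t) by apply: Hd'; move: ct; rewrite -/c; lra.
  rewrite (_ : f c - f a = (f c - f t) + (f t - f a)); last by ring.
  rewrite (_ : c - a = (c - t) + (t - a)); last by ring.
  by rewrite mulrDr; apply: le_trans (ler_normD _ _) _; apply: lerD.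
suff -> : b = c by case: Ac.
apply/eqP; rewrite eq_le cb andbT leNgt; apply/negP => cltb.
pose s := Num.min b (c + d / 2).
have sb : s <= b by rewrite /s ge_min lexx.
have cs : c < s by rewrite /s lt_min cltb ltrDl divr_gt0.
have sd : s <= c + d / 2 by rewrite /s ge_min lexx orbT.
have As : A s.
  have sab : a <= s <= b by rewrite sb andbT (le_trans ac)// ltW.
  split=> //.
  have sc : `|s - c| = s - c by rewrite ger0_norm// subr_ge0 ltW.
  have H1 : `|f s - f c| <= (K + e) * (s - c).
    by rewrite -sc; apply: Hd => //; rewrite sc; move: d0 sd; lra.
  case: Ac => _ H2.
  rewrite (_ : f s - f a = (f s - f c) + (f c - f a)); last by ring.
  rewrite (_ : s - a = (s - c) + (c - a)); last by ring.
  by rewrite mulrDr; apply: le_trans (ler_normD _ _) _; apply: lerD.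
by have := sup_upper_bound hA As; rewrite -/c leNgt cs.
Qed.

(** Expand the integral of $(b-a)(f-S/(b-a))^2\ge 0$, where $S/(b-a)$ is the mean value of [f]. *)
Lemma I_CS a b f : a <= b -> continuous f ->
  (I a b f) ^+ 2 <= (b - a) * I a b (fun x => f x ^+ 2).
Proof.
rewrite le_eqVlt => /predU1P[->|ab] cf.
  by rewrite subrr mul0r set_itv1 Rintegral_set1 expr2 mul0r.
have cf2 := contX2 cf; set S := I a b f.
have ba : 0 < b - a by rewrite subr_gt0.
have : 0 <= I a b (fun x => (b - a) * f x ^+ 2 + ((- (2 * S)) * f x + S ^+ 2 / (b - a))).
  apply: I_ge0 => x _.
  have -> : (b - a) * f x ^+ 2 + (- (2 * S) * f x + S ^+ 2 / (b - a)) = (b - a) * (f x - S / (b - a)) ^+ 2.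
    by field; rewrite gt_eqF.
  by rewrite mulr_ge0 ?sqr_ge0// ltW.
have cc : continuous ((fun=> S ^+ 2 / (b - a)) : R -> R) by exact: cont_cst.
rewrite I_linear//; last first.
  by apply: contD => //; exact: contZ.
rewrite (I_linear _ _ _ cf cc) (I_cst _ (ltW ab)) -/S divfK; last by rewrite gt_eqF.
by nra.
Qed.

End SegmentIntegral.

Notation I a b f := (\int[lebesgue_measure]_(x in `[a, b]) f x).

Section VelocityAverage.
Variables (R : realType) (m : model).
Implicit Types (f g : R -> R) (c : R).
Local Notation Om := (@Omega_v R m).
Local Notation avg := (avg m).
Local Notation mu := (@lebesgue_measure R).

Definition vint (f : R -> R) : Prop :=
  match m with
  | Telegraph => True
  | Transport => mu.-integrable (`[-1, 1] : set R) (EFin \o f)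
  end.

Definition vL2 (f : R -> R) : Prop := vsquare_integrable m f.

Lemma Omega_abs (v : R) : Om v -> `|v| <= 1.
Proof.
rewrite /Omega_v; case: m => /=.
  by move=> [->|->]; rewrite ?normrN normr1.
by rewrite in_itv/= ler_norml.
Qed.

Lemma avg_ext f g : (forall v, Om v -> f v = g v) -> avg f = avg g.
Proof.
rewrite /avg /Omega_v; case: m => /= fg.
  by rewrite !fg //; [right|left].
by congr (_ * _); apply: eq_I => v vab; apply: fg; rewrite in_itv.
Qed.

Lemma vint_ext f g : (forall v, Om v -> f v = g v) -> vint f -> vint g.
Proof.
rewrite /vint /Omega_v; case: m => //= fg.
by apply: eq_integrable => // v; rewrite inE => vab /=; rewrite fg.
Qed.

Lemma vint_lin c f g : vint f -> vint g -> vint (fun v => c * f v + g v).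
Proof.
rewrite /vint; case: m => // fi gi.
have := integrableD _ (integrableZl _ c fi) gi.
by move=> /(_ _ _)/= H; apply: H.
Qed.

Lemma avg_lin c f g : vint f -> vint g ->
  avg (fun v => c * f v + g v) = c * avg f + avg g.
Proof.
rewrite /vint /avg; case: m => [_ _|fi gi]; first by field.
rewrite RintegralD//.
  by rewrite RintegralZl//; ring.
have := integrableZl _ c fi.
by move=> /(_ _)/= H; apply: H.
Qed.

Lemma avg_le f g : vint f -> vint g -> (forall v, Om v -> f v <= g v) ->
  avg f <= avg g.
Proof.
rewrite /vint /avg /Omega_v; case: m => [_ _|fi gi] /= fg.
  by rewrite ler_pM2r ?invr_gt0//; apply: lerD; apply: fg; [left|right].
by rewrite ler_pM2l ?invr_gt0//; apply: le_Rintegral.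
Qed.

Lemma avg_ge0 f : (forall v, Om v -> 0 <= f v) -> 0 <= avg f.
Proof.
rewrite /avg /Omega_v; case: m => /= f0.
  by rewrite divr_ge0// addr_ge0// f0//; [left|right].
by rewrite mulr_ge0// Rintegral_ge0.
Qed.

Lemma avg_cst c : avg (fun=> c) = c.
Proof.
rewrite /avg; case: m; first by field.
rewrite (@I_cst R (-1) 1 c); first by field.
lra.
Qed.

Lemma vint_cst c : vint (fun=> c).
Proof.
rewrite /vint; case: m => //; apply: (@cont_integrable R (-1) 1 (fun=> c)).
exact: cont_cst.
Qed.

Lemma vintZ c f : vint f -> vint (fun v => c * f v).
Proof.
move=> fi; apply: (vint_ext _ (vint_lin c fi (vint_cst 0))) => v _.
by rewrite addr0.
Qed.

Lemma vintD f g : vint f -> vint g -> vint (fun v => f v + g v).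
Proof.
move=> fi gi; apply: (vint_ext _ (vint_lin 1 fi gi)) => v _.
by rewrite mul1r.
Qed.

Lemma vintB f g : vint f -> vint g -> vint (fun v => f v - g v).
Proof.
move=> fi gi; apply: (vint_ext _ (vint_lin (-1) gi fi)) => v _.
by rewrite mulN1r addrC.
Qed.

Lemma avgZ c f : vint f -> avg (fun v => c * f v) = c * avg f.
Proof.
move=> fi; have := avg_lin c fi (vint_cst 0); rewrite avg_cst addr0 => <-.
by apply: avg_ext => v _; rewrite addr0.
Qed.

Lemma avgD f g : vint f -> vint g -> avg (fun v => f v + g v) = avg f + avg g.
Proof.
move=> fi gi; have := avg_lin 1 fi gi; rewrite mul1r => <-.
by apply: avg_ext => v _; rewrite mul1r.
Qed.

Lemma avgB f g : vint f -> vint g -> avg (fun v => f v - g v) = avg f - avg g.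
Proof.
move=> fi gi; have := avg_lin (-1) gi fi; rewrite mulN1r addrC => <-.
by apply: avg_ext => v _; rewrite mulN1r addrC.
Qed.

Lemma vint_sum (J : Type) (s : seq J) (F : J -> R -> R) :
  (forall j, vint (F j)) -> vint (fun v => \sum_(j <- s) F j v).
Proof.
move=> Fi; elim: s => [|j s IH].
  by apply: (vint_ext _ (vint_cst 0)) => v _; rewrite big_nil.
by apply: (vint_ext _ (vintD (Fi j) IH)) => v _; rewrite big_cons.
Qed.

Lemma avg_sum (J : Type) (s : seq J) (F : J -> R -> R) :
  (forall j, vint (F j)) ->
  avg (fun v => \sum_(j <- s) F j v) = \sum_(j <- s) avg (F j).
Proof.
move=> Fi; elim: s => [|j s IH].
  by rewrite big_nil -[RHS](avg_cst 0); apply: avg_ext => v _; rewrite big_nil.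
rewrite big_cons -IH -avgD//; last exact: vint_sum.
by apply: avg_ext => v _; rewrite big_cons.
Qed.

Lemma vL2_ext f g : (forall v, Om v -> f v = g v) -> vL2 f -> vL2 g.
Proof.
rewrite /vL2 /vsquare_integrable /Omega_v; case: m => //= fg [mf if2]; split.
  apply: eq_measurable_fun mf => v; rewrite inE => vab; exact: fg.
by apply: eq_integrable if2 => // v; rewrite inE => vab /=; rewrite fg.
Qed.

Lemma vintM f g : vL2 f -> vL2 g -> vint (fun v => f v * g v).
Proof.
rewrite /vL2 /vint /vsquare_integrable; case: m => // -[mf fi] [mg gi].
apply: (le_integrable _ _ _ (integrableD _ fi gi)) => //.
  by apply/measurable_EFinP; apply: measurable_funM.
move=> v _; rewrite /= lee_fin normrM [leRHS]ger0_norm ?addr_ge0 ?sqr_ge0//.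
rewrite -[f v ^+ 2]real_normK ?num_real// -[g v ^+ 2]real_normK ?num_real//.
by have := sqr_ge0 (`|f v| - `|g v|); have := normr_ge0 (f v); have := normr_ge0 (g v); nra.
Qed.

Lemma vL2_bounded_mul (q f : R -> R) : continuous q ->
  (forall v, Om v -> `|q v| <= 1) -> vL2 f -> vL2 (fun v => q v * f v).
Proof.
rewrite /vL2 /vsquare_integrable /Omega_v; case: m => //= cq q1 [mf fi].
have mqf : measurable_fun (`[-1, 1] : set R) (fun v => q v * f v).
  apply: measurable_funM => //; apply: subspace_continuous_measurable_fun => //.
  exact: continuous_subspaceT.
split=> //; apply: (le_integrable _ _ _ fi) => //.
  by apply/measurable_EFinP; apply: measurable_funM.
move=> v vab; rewrite /= lee_fin exprMn normrM ger0_norm ?sqr_ge0//.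
rewrite -[leRHS]mul1r ler_wpM2r ?sqr_ge0//.
by rewrite -[q v ^+ 2]real_normK ?num_real// expr_le1// q1.
Qed.

Lemma vL2_D f g : vL2 f -> vL2 g -> vL2 (fun v => f v + g v).
Proof.
rewrite /vL2 /vsquare_integrable; case: m => // -[mf fi] [mg gi].
have mfg : measurable_fun (`[-1, 1] : set R) (fun v => f v + g v) by apply: measurable_funD.
split=> //.
apply: (le_integrable _ _ _ (integrableD _ (integrableZl _ 2 fi) (integrableZl _ 2 gi))) => //.
  by apply/measurable_EFinP; apply: measurable_funM.
move=> v _; rewrite /= lee_fin ger0_norm ?sqr_ge0// ger0_norm; last first.
  by have := sqr_ge0 (f v); have := sqr_ge0 (g v); lra.
by have := sqr_ge0 (f v - g v); nra.
Qed.

Lemma vL2_Z c f : vL2 f -> vL2 (fun v => c * f v).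
Proof.
rewrite /vL2 /vsquare_integrable; case: m => // -[mf fi]; split.
  by apply: measurable_funM.
have := integrableZl _ (c ^+ 2) fi => /(_ _)/= H.
by apply: eq_integrable (H _) => // v _; rewrite exprMn EFinM.
Qed.

Lemma vL2_sum (J : Type) (s : seq J) (F : J -> R -> R) :
  (forall j, vL2 (F j)) -> vL2 (fun v => 0) -> vL2 (fun v => \sum_(j <- s) F j v).
Proof.
move=> Fi F0; elim: s => [|j s IH].
  by apply: (vL2_ext _ F0) => v _; rewrite big_nil.
by apply: (vL2_ext _ (vL2_D (Fi j) IH)) => v _; rewrite big_cons.
Qed.

(** Uniform continuity on [Omega_v], phrased with explicit radii so that it makes sense for two
    velocities as well as for an interval, passes through bounded linear functionals, and yields
    measurability in the transport model. *)
Definition vunif (f : R -> R) : Prop := forall e : R, 0 < e ->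
  exists2 d : R, 0 < d &
    forall v w, Om v -> Om w -> `|v - w| < d -> `|f v - f w| < e.

Lemma vL2_unif f : vunif f -> vL2 f.
Proof.
rewrite /vL2 /vunif /vsquare_integrable /Omega_v; case: m => //= uf.
have cf : {within `[-1, 1], continuous f}.
  apply/subspace_continuousP => v vab.
  apply/cvgrPdist_lt => e e0; have [d d0 H] := uf e e0.
  rewrite near_withinE; near=> w => wab.
  apply: H => //; near: w; exact: nbhsx_ballx.
split; first exact: subspace_continuous_measurable_fun.
apply: (continuous_compact_integrable (@segment_compact R (-1) 1)) => v.
exact: (continuousM (cf v) (cf v)).
Unshelve. all: by end_near. Qed.

Lemma vL2_cst c : vL2 (fun=> c).
Proof. by apply: vL2_unif => e e0; exists 1 => // v w _ _ _; rewrite subrr normr0. Qed.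

Lemma vint_vL2 f : vL2 f -> vint f.
Proof.
move=> f2; apply: (vint_ext _ (vintM (vL2_cst 1) f2)) => v _; rewrite mul1r//.
Qed.

Lemma vL2_idM f : vL2 f -> vL2 (fun v => v * f v).
Proof. by apply: (@vL2_bounded_mul id) => [x|v /Omega_abs//]; exact: cvg_id. Qed.

Lemma vL2_absM f : vL2 f -> vL2 (fun v => `|v| * f v).
Proof.
apply: (@vL2_bounded_mul (fun v => `|v|)) => [|v /Omega_abs]; last by rewrite normr_id.
exact: norm_continuous.
Qed.

Lemma vsup1 : vsup R m = 1.
Proof.
rewrite /vsup.
have A1 : [set `|v| | v in Om] 1.
  exists 1; last by rewrite normr1.
  rewrite /Omega_v; case: m => /=; first by right.
  by rewrite in_itv/= lexx; lra.
have ub : ubound [set `|v| | v in Om] 1 by move=> _ [v /Omega_abs v1 <-].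
apply/eqP; rewrite eq_le; apply/andP; split.
  by apply: ge_sup => //; exists 1.
by apply: sup_upper_bound => //; split; exists 1.
Qed.

Definition vabs : R := avg (fun v => `|v|).
Definition vsqr : R := avg (fun v => v ^+ 2).

Lemma vL2_id : vL2 (fun v => v).
Proof. by apply: (vL2_ext _ (vL2_idM (vL2_cst 1))) => v _; rewrite mulr1. Qed.

Lemma vL2_abs : vL2 (fun v => `|v|).
Proof. by apply: (vL2_ext _ (vL2_absM (vL2_cst 1))) => v _; rewrite mulr1. Qed.

Lemma sqr_le_abs (v : R) : Om v -> v ^+ 2 <= `|v|.
Proof.
move=> /Omega_abs v1; rewrite -[v ^+ 2]real_normK ?num_real//.
by have := normr_ge0 v; nra.
Qed.

(** The value is 1 for the telegraph equation and 1/3 for transport. Positivity matters because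
    $\langle v^2\rangle$ serves as a weight in Young's inequality. *)
Lemma vsqr_gt0 : 0 < vsqr.
Proof.
rewrite /vsqr /avg; case: m; first by lra.
rewrite mulr_gt0 ?invr_gt0//.
have -> : I (-1) 1 (fun v : R => v ^+ 2) = 3^-1 * 1 ^+ 3 - 3^-1 * (-1) ^+ 3.
  have D (v : R) : is_derive v (1 : R) (fun v : R => 3^-1 * v ^+ 3) (v ^+ 2).
    apply: is_derive_eq.
    by rewrite /GRing.scale/=; field.
  apply: (I_FTC _ _ D); first by lra.
  by apply: contX2 => v; exact: cvg_id.
by lra.
Qed.

Lemma vabs_gt0 : 0 < vabs.
Proof.
apply: lt_le_trans vsqr_gt0 _; apply: avg_le.
- exact: vintM vL2_id vL2_id.
- exact: vint_vL2 vL2_abs.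
- exact: sqr_le_abs.
Qed.

End VelocityAverage.

(** * The discontinuous Galerkin space and its forms *)

Section LinearForms.
Variable R : realType.

Definition lin (V : lmodType R) (l : V -> R) : Prop :=
  forall a u w, l (a *: u + w) = a * l u + l w.

Section LinTheory.
Variables (V : lmodType R) (l : V -> R).
Hypothesis ll : lin l.

Lemma lin0 : l 0 = 0.
Proof. by have := ll 1 0 0; rewrite scale1r addr0 mul1r => /eqP; rewrite addrC -subr_eq subrr => /eqP. Qed.

Lemma linZ a u : l (a *: u) = a * l u.
Proof. by have := ll a u 0; rewrite addr0 lin0 addr0. Qed.

Lemma linD u w : l (u + w) = l u + l w.
Proof. by have := ll 1 u w; rewrite scale1r mul1r. Qed.

Lemma linB u w : l (u - w) = l u - l w.
Proof. by rewrite -scaleN1r linD linZ mulN1r. Qed.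

Lemma lin_sum (J : Type) (s : seq J) (F : J -> V) :
  l (\sum_(j <- s) F j) = \sum_(j <- s) l (F j).
Proof.
by elim: s => [|j s IH]; rewrite ?big_nil ?lin0// !big_cons linD IH.
Qed.

End LinTheory.

(** A trivial left kernel makes the Gram matrix [M] invertible, and the representative is obtained
    by solving with it. The form may be nonsymmetric: besides the $L^2$ product, the lemma serves
    the conditions that define the Gauss--Radau projections. *)
Lemma nondegenerate_represents (V : vectType R) (B : V -> V -> R) :
  (forall q, lin (B^~ q)) -> (forall p, lin (B p)) ->
  (forall p, (forall q, B p q = 0) -> p = 0) ->
  forall l : V -> R, lin l -> exists p, forall q, B p q = l q.
Proof.
move=> Bl Br nd l ll.
pose n := \dim (fullv : {vspace V}); pose e := vbasis (fullv : {vspace V}).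
have eb : basis_of fullv e := vbasisP _.
pose M := \matrix_(i < n, j < n) B e`_i e`_j.
have dec q : q = \sum_(j < n) coord e j q *: e`_j by apply: coord_basis (memvf _).
have Be (v : 'rV[R]_n) j : (v *m M) 0 j = B (\sum_i v 0 i *: e`_i) e`_j.
  rewrite mxE (lin_sum (Bl _)); apply: eq_bigr => i _.
  by rewrite mxE (linZ (Bl _)).
have Mfree : row_free M.
  apply: inj_row_free => v vM.
  have v0 : \sum_i v 0 i *: e`_i = 0.
    apply: nd => q; rewrite [q]dec (lin_sum (Br _)) big1// => j _.
    by rewrite (linZ (Br _)) -Be vM mxE mulr0.
  apply/rowP => i; rewrite mxE.
  by have /freeP := basis_free eb; apply.
have Mu : M \in unitmx by rewrite -row_free_unit.
pose L := \row_(j < n) l e`_j.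
exists (\sum_i (L *m invmx M) 0 i *: e`_i) => q.
rewrite [q]dec (lin_sum (Br _)) (lin_sum ll); apply: eq_bigr => j _.
by rewrite (linZ (Br _)) (linZ ll) -Be mulmxKV// mxE.
Qed.

End LinearForms.

(** * Sup-norm bounds for polynomials on an interval *)

Section InverseInequality.
Variables (R : realType) (k : nat) (Cinv Chinv : R).
Hypotheses (Cinv0 : 0 < Cinv) (Chinv0 : 0 < Chinv)
  (inv : inverse_inequalities k Cinv Chinv).

Lemma cont_poly (p : {poly R}) : continuous (fun x => p.[x]).
Proof. exact: continuous_horner_fun. Qed.

(* The end point inequality is applied on the longer of [[a, x]], [[x, b]]. *)
Lemma poly_sup (a b : R) (p : {poly R}) (x : R) : (size p <= k.+1)%N -> a < b ->
  a <= x <= b -> p.[x] ^+ 2 * (b - a) <= 2 * Cinv * I a b (fun x => p.[x] ^+ 2).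
Proof.
move=> sp ab xab; have /andP[ax xb] := xab.
have Ep : p = (NPoly (sp : p \is a poly_of_size k.+1) : {poly_k.+1 R}) by [].
have cp := contX2 (@cont_poly p).
have p0 y : 0 <= p.[y] ^+ 2 by exact: sqr_ge0.
rewrite (I_split cp xab).
have I1 : 0 <= I a x (fun x => p.[x] ^+ 2) by apply: I_ge0.
have I2 : 0 <= I x b (fun x => p.[x] ^+ 2) by apply: I_ge0.
have := p0 x; set P := p.[x] ^+ 2 => P0.
have [c|c] := leP ((b - a) / 2) (x - a).
  have ax' : a < x by lra.
  have [_ H _] := inv (NPoly (sp : p \is a poly_of_size k.+1)) ax'.
  rewrite /= -/P in H.
  have : P * (b - a) <= 2 * (P * (x - a)) by nra.
  by have := mulr_ge0 (ltW Cinv0) I2; lra.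
have xb' : x < b by lra.
have [H _ _] := inv (NPoly (sp : p \is a poly_of_size k.+1)) xb'.
rewrite /= -/P in H.
have : P * (b - a) <= 2 * (P * (b - x)) by nra.
by have := mulr_ge0 (ltW Cinv0) I1; lra.
Qed.

Lemma npoly_eq0 (a b : R) (p : {poly_k.+1 R}) : a < b ->
  (forall x, a <= x <= b -> (p : {poly R}).[x] = 0) -> p = 0.
Proof.
move=> ab p0; apply/val_inj => /=.
(* These are [k + 2] equidistant points of the interval, more than a nonzero polynomial of degree at
   most [k] can have as roots. *)
pose s := [seq a + (b - a) * (j%:R / k.+1%:R) | j <- iota 0 k.+2].
apply: (@roots_geq_poly_eq0 _ _ s).
- apply/allP => y /mapP[j]; rewrite mem_iota add0n => /andP[_ jk] ->.
  apply/eqP; apply: p0.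
  have h0 : 0 <= j%:R / k.+1%:R :> R by rewrite divr_ge0 ?ler0n.
  have h1 : j%:R / k.+1%:R <= 1 :> R by rewrite ler_pdivrMr ?ltr0n// mul1r ler_nat -ltnS.
  by move: (_ / _) h0 h1 => z h0 h1; apply/andP; split; nra.
- rewrite map_inj_uniq ?iota_uniq// => i j /addrI.
  move=> /(mulfI _); rewrite subr_eq0 gt_eqF// => /(_ isT) /divIf.
  by rewrite pnatr_eq0 => /(_ isT) /eqP; rewrite eqr_nat => /eqP.
- by rewrite size_map size_iota; exact: leq_trans (size_npoly p) _.
Qed.

Lemma npoly_eq0_I (a b : R) (p : {poly_k.+1 R}) : a < b ->
  I a b (fun x => (p : {poly R}).[x] ^+ 2) = 0 -> p = 0.
Proof.
move=> ab p0; apply: (npoly_eq0 ab) => x xab.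
have := poly_sup (size_npoly p) ab xab; rewrite p0 mulr0 pmulr_lle0 ?subr_gt0//.
by move=> H; apply/eqP; rewrite -sqrf_eq0 eq_le H sqr_ge0.
Qed.

End InverseInequality.

Section Mesh.
Variables (R : realType) (xmin xmax : R) (k N : nat).
Hypotheses (xab : xmin < xmax) (N0 : (0 < N)%N).
Local Notation U := (Uh R k N).
Local Notation B := (broken R N).
Local Notation h := (mesh_size xmin xmax N).
Local Notation node := (node xmin xmax N).
Local Notation ip := (@ip R xmin xmax N).
Local Notation tb := (@to_broken R k N).
Local Notation wform := (@weak_form R xmin xmax k N).
Local Notation trl := (@trace_l R xmin xmax N).
Local Notation trr := (@trace_r R xmin xmax N).
Local Notation jump := (@jump R xmin xmax N).

Lemma h_gt0 : 0 < h.
Proof. by rewrite divr_gt0 ?subr_gt0// ltr0n. Qed.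

Lemma nodeS i : node i.+1 - node i = h.
Proof. by rewrite /node -natr1 mulrDl mul1r; ring. Qed.

Lemma node0 : node 0 = xmin.
Proof. by rewrite /node mul0r addr0. Qed.

Lemma nodeN : node N = xmax.
Proof. by rewrite /node /mesh_size mulrC divfK; [ring|rewrite pnatr_eq0 -lt0n]. Qed.

Lemma node_lt i : node i < node i.+1.
Proof. by rewrite -subr_gt0 nodeS h_gt0. Qed.

Lemma node_le i j : (i <= j)%N -> node i <= node j.
Proof. by move=> ij; rewrite lerD2l ler_wpM2r ?ler_nat// ltW// h_gt0. Qed.

Lemma cell_sub (i : 'I_N) x : node i <= x <= node i.+1 -> xmin <= x <= xmax.
Proof.
move=> /andP[ix xi]; apply/andP; split.
  by have := node_le (leq0n i); rewrite node0 => /le_trans; apply.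
by apply: le_trans xi _; rewrite -[leRHS]nodeN; exact: node_le.
Qed.

Definition bcont (u : B) : Prop := forall i, continuous (u i).

Lemma bcont_tb (u : U) : bcont (tb u).
Proof. by move=> i; exact: continuous_horner_fun. Qed.

Lemma tb_lin a (u w : U) i x : tb (a *: u + w) i x = a * tb u i x + tb w i x.
Proof. by rewrite /to_broken /poly_at !ffunE/= !hornerE. Qed.

Lemma ip_lin a (u u' w : B) : bcont u -> bcont u' -> bcont w ->
  ip (fun i x => a * u i x + u' i x) w = a * ip u w + ip u' w.
Proof.
move=> cu cu' cw; rewrite /ip mulr_sumr -big_split; apply: eq_bigr => i _ /=.
rewrite -I_linear; [|exact: contM..].
by apply: eq_I => x _; rewrite mulrDl mulrA.
Qed.

Lemma ip_Z a (u w : B) : bcont u -> bcont w ->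
  ip (fun i x => a * u i x) w = a * ip u w.
Proof.
move=> cu cw; rewrite /ip mulr_sumr; apply: eq_bigr => i _.
rewrite -I_Z; last exact: contM.
by apply: eq_I => x _; rewrite mulrA.
Qed.

Lemma ip_sym u w : ip u w = ip w u.
Proof.
by rewrite /ip; apply: eq_bigr => i _; apply: eq_I => x _; rewrite mulrC.
Qed.

Lemma eq_ip (u u' w w' : B) :
  (forall (i : 'I_N) x, node i <= x <= node i.+1 -> u i x = u' i x) ->
  (forall (i : 'I_N) x, node i <= x <= node i.+1 -> w i x = w' i x) -> ip u w = ip u' w'.
Proof.
move=> uu ww; apply: eq_bigr => i _; apply: eq_I => x xi.
by rewrite uu// ww.
Qed.

Lemma ip_ge0 u : 0 <= ip u u.
Proof.
by apply: sumr_ge0 => i _; apply: I_ge0 => x _; rewrite -expr2 sqr_ge0.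
Qed.

Definition bder (u : U) : B := fun i x => (deriv (poly_at u i)).[x].

Lemma bcont_bder u : bcont (bder u).
Proof. by move=> i; exact: continuous_horner_fun. Qed.

Lemma bder_lin a (u w : U) i x : bder (a *: u + w) i x = a * bder u i x + bder w i x.
Proof. by rewrite /bder /poly_at !ffunE/= derivD derivZ !hornerE. Qed.

Lemma weak_formE u uhat psi :
  wform u uhat psi = ip u (bder psi) + \sum_(i < N) uhat i * jump (tb psi) i.
Proof. by []. Qed.

Lemma trr_lin a (u w : B) i :
  trr (fun i x => a * u i x + w i x) i = a * trr u i + trr w i.
Proof. by []. Qed.

Lemma trl_lin a (u w : B) i :
  trl (fun i x => a * u i x + w i x) i = a * trl u i + trl w i.
Proof. by []. Qed.

Lemma jump_lin a (u w : B) i :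
  jump (fun i x => a * u i x + w i x) i = a * jump u i + jump w i.
Proof. by rewrite /Defs.jump trr_lin trl_lin; ring. Qed.

Lemma tb_linE a (u w : U) : tb (a *: u + w) = (fun i x => a * tb u i x + tb w i x).
Proof. by apply/funext => i; apply/funext => x; rewrite tb_lin. Qed.

Lemma bder_linE a (u w : U) : bder (a *: u + w) = (fun i x => a * bder u i x + bder w i x).
Proof. by apply/funext => i; apply/funext => x; rewrite bder_lin. Qed.

Lemma wform_linl a u w uhat what psi : bcont u -> bcont w ->
  wform (fun i x => a * u i x + w i x) (fun i => a * uhat i + what i) psi =
  a * wform u uhat psi + wform w what psi.
Proof.
move=> cu cw; rewrite !weak_formE ip_lin//; last exact: bcont_bder.
rewrite mulrDr addrACA; congr (_ + _).
by rewrite mulr_sumr -big_split/=; apply: eq_bigr => i _; ring.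
Qed.

Lemma lin_wform u uhat : bcont u -> lin (wform u uhat).
Proof.
move=> cu a p q; rewrite !weak_formE bder_linE tb_linE ip_sym ip_lin//;
  [|exact: bcont_bder..].
rewrite !(ip_sym _ u) mulrDr addrACA; congr (_ + _).
by rewrite mulr_sumr -big_split/=; apply: eq_bigr => i _; rewrite jump_lin; ring.
Qed.

Lemma lin_ip u : bcont u -> lin (fun w : U => ip u (tb w)).
Proof.
move=> cu a p q; rewrite tb_linE ip_sym ip_lin ?(ip_sym u)//; exact: bcont_tb.
Qed.

Lemma lin_jump i : lin (fun u : U => jump (tb u) i).
Proof. by move=> a u w; rewrite tb_linE jump_lin. Qed.

Definition swap (fl : flux) : flux :=
  match fl with LeftRight => RightLeft | RightLeft => LeftRight | Central => Central end.

Local Notation fvg := (@flux_vg R xmin xmax N).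

Lemma flux_rho_swap fl : @flux_rho R xmin xmax N fl = fvg (swap fl).
Proof. by case: fl. Qed.

Lemma swapK : involutive swap.
Proof. by case. Qed.

Lemma fvg_lin fl a (u w : B) i :
  fvg fl (fun i x => a * u i x + w i x) i = a * fvg fl u i + fvg fl w i.
Proof. by case: fl => //=; rewrite /mean trr_lin trl_lin; field. Qed.

(** The common form behind [a_h] and [d_h]: the flux of $\rho$ in a pair is the flux of $\langle
    vg\rangle$ in the swapped pair, so one family indexed by [fl] covers both. *)
Definition wfl (fl : flux) (u : B) (psi : U) : R := wform u (fvg fl u) psi.

Lemma wfl_linl fl a u w psi : bcont u -> bcont w ->
  wfl fl (fun i x => a * u i x + w i x) psi = a * wfl fl u psi + wfl fl w psi.
Proof.
move=> cu cw; rewrite /wfl -wform_linl//; congr (weak_form _ _ _ _).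
by apply/funext => i; rewrite fvg_lin.
Qed.

Lemma lin_wfl fl psi : lin (fun u : U => wfl fl (tb u) psi).
Proof. by move=> a u w; rewrite tb_linE wfl_linl//; exact: bcont_tb. Qed.

Lemma sum_ord_pred (F : 'I_N -> R) : \sum_i F (ord_pred i) = \sum_i F i.
Proof. by rewrite [RHS](reindex_inj (@ord_pred_inj N)). Qed.

(** Integration by parts on each cell. Reindexing by the cyclic predecessor turns values at right
    end points into left traces at nodes; the periodic boundary condition enters here and nowhere
    else. *)
Lemma ip_bder (u w : U) :
  ip (tb u) (bder w) + ip (tb w) (bder u) =
  \sum_i (trl (tb u) i * trl (tb w) i - trr (tb u) i * trr (tb w) i).
Proof.
rewrite sumrB (sum_ord_pred (fun i => tb u i (node i.+1) * tb w i (node i.+1))).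
rewrite -sumrB -big_split/=; apply: eq_bigr => i _.
rewrite -I_D; [|by apply: contM; [exact: bcont_tb|exact: bcont_bder]..].
have D x : is_derive x (1 : R) (fun y => (poly_at u i * poly_at w i).[y])
    ((tb u i x * bder w i x) + (tb w i x * bder u i x)).
  have := is_derive_horner_fun (poly_at u i * poly_at w i) x.
  by rewrite derivM !hornerE /tb /bder => H; apply: is_derive_eq H _; ring.
rewrite (I_FTC _ _ D); last 2 first.
- exact/ltW/node_lt.
- by apply: contD; apply: contM; [exact: bcont_tb|exact: bcont_bder|exact: bcont_tb|exact: bcont_bder].
by rewrite !hornerM.
Qed.

(** At each interface $\hat u[w]+\hat w[u]=[uw]$ if the two fluxes take opposite sides or are both
    central. This discrete adjointness is the purpose of the flux pairs: it makes the two coupling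
    terms of the scheme dual to each other. *)
Lemma wfl_skew fl (u w : U) : wfl fl (tb u) w + wfl (swap fl) (tb w) u = 0.
Proof.
rewrite /wfl !weak_formE addrACA ip_bder -!big_split/= big1// => i _.
by case: fl; rewrite /= /mean /Defs.jump; field.
Qed.

(** The linear form that [D_h] represents; the estimates use it directly and avoid the Riesz
    element. *)
Definition adv (v : R) (g psi : U) : R :=
  - wform (fun i x => v * tb g i x) (upwind xmin xmax v (tb g)) psi.

Definition jump_sq (g : U) : R := \sum_i jump (tb g) i ^+ 2.

End Mesh.

Section Young.
Variable R : realType.

Lemma young (th a b : R) : 0 < th -> a * b <= th / 2 * a ^+ 2 + (2 * th)^-1 * b ^+ 2.
Proof.
move=> th0; rewrite -subr_ge0.
have -> : th / 2 * a ^+ 2 + (2 * th)^-1 * b ^+ 2 - a * b = (2 * th)^-1 * (th * a - b) ^+ 2.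
  by field; rewrite gt_eqF.
by rewrite mulr_ge0 ?sqr_ge0// invr_ge0 mulr_ge0 ?ler0n// ltW.
Qed.

Lemma sum_young (J : finType) (th : R) (a b : J -> R) : 0 < th ->
  \sum_j a j * b j <= th / 2 * (\sum_j a j ^+ 2) + (2 * th)^-1 * (\sum_j b j ^+ 2).
Proof.
by move=> th0; rewrite !mulr_sumr -big_split/=; apply: ler_sum => j _; apply: young.
Qed.

End Young.

Section Bounds.
Variables (R : realType) (xmin xmax : R) (k N : nat) (Cinv Chinv : R).
Hypotheses (xab : xmin < xmax) (N0 : (0 < N)%N)
  (Cinv0 : 0 < Cinv) (Chinv0 : 0 < Chinv)
  (inv : inverse_inequalities k Cinv Chinv).
Local Notation U := (Uh R k N).
Local Notation B := (broken R N).
Local Notation h := (mesh_size xmin xmax N).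
Local Notation node := (node xmin xmax N).
Local Notation ip := (@ip R xmin xmax N).
Local Notation tb := (@to_broken R k N).
Local Notation trl := (@trace_l R xmin xmax N).
Local Notation trr := (@trace_r R xmin xmax N).
Local Notation jump := (@jump R xmin xmax N).
Local Notation fvg := (@flux_vg R xmin xmax N).
Local Notation adv := (@adv R xmin xmax k N).
Local Notation jump_sq := (@jump_sq R xmin xmax k N).

Let h0 : 0 < h := h_gt0 xab N0.

Lemma ip_young (th : R) (u w : B) : 0 < th -> bcont u -> bcont w ->
  ip u w <= th / 2 * ip u u + (2 * th)^-1 * ip w w.
Proof.
move=> th0 cu cw; rewrite /Defs.ip !mulr_sumr -big_split/=; apply: ler_sum => i _; rewrite /cell.
have cuu := contM (cu i) (cu i); have cww := contM (cw i) (cw i).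
rewrite -!I_Z// -I_D; [|exact: contZ..].
apply: I_le; [exact: contM|by apply: contD; exact: contZ|].
by move=> x _; rewrite -!expr2; apply: young.
Qed.

Lemma ip_eq0 (u : U) : ip (tb u) (tb u) = 0 -> u = 0.
Proof.
move=> /eqP; rewrite psumr_eq0; last first.
  by move=> i _; apply: I_ge0 => x _; rewrite -expr2 sqr_ge0.
move=> /allP H; apply/ffunP => i; rewrite ffunE.
apply: (npoly_eq0_I Cinv0 inv (node_lt xab N0 i)).
by have := H i (mem_index_enum i) => /eqP.
Qed.

Lemma ip_inj (u w : U) : (forall psi : U, ip (tb u) (tb psi) = ip (tb w) (tb psi)) -> u = w.
Proof.
move=> H; apply/eqP; rewrite -subr_eq0; apply/eqP; apply: ip_eq0.
pose d : U := u - w.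
have E : ip (tb u) (tb d) = ip (tb w) (tb d) := H d.
have l : lin (fun w : U => ip (tb d) (tb w)) by apply: lin_ip; exact: bcont_tb.
rewrite -/d; have := linB l u w; rewrite -/d => ->.
by rewrite !(ip_sym _ _ (tb d)) E subrr.
Qed.

Lemma trl_bound (u : U) : h * \sum_i trl (tb u) i ^+ 2 <= Cinv * ip (tb u) (tb u).
Proof.
rewrite (sum_ord_pred (fun i => tb u i (node i.+1) ^+ 2)) /Defs.ip !mulr_sumr.
apply: ler_sum => i _; have [_ H _] := inv (u i) (node_lt xab N0 i).
by move: H; rewrite nodeS mulrC.
Qed.

Lemma trr_bound (u : U) : h * \sum_i trr (tb u) i ^+ 2 <= Cinv * ip (tb u) (tb u).
Proof.
rewrite /Defs.ip !mulr_sumr.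
apply: ler_sum => i _; have [H _ _] := inv (u i) (node_lt xab N0 i).
by move: H; rewrite nodeS mulrC.
Qed.

Lemma bder_bound (u : U) :
  h ^+ 2 * ip (bder u) (bder u) <= Chinv * ip (tb u) (tb u).
Proof.
rewrite /Defs.ip !mulr_sumr.
apply: ler_sum => i _; have [_ _ H] := inv (u i) (node_lt xab N0 i).
by move: H; rewrite nodeS.
Qed.

Lemma fvg_bound fl (u : U) : h * \sum_i fvg fl (tb u) i ^+ 2 <= Cinv * ip (tb u) (tb u).
Proof.
case: fl; [exact: trl_bound|exact: trr_bound|] => /=.
have -> : Cinv * ip (tb u) (tb u) = 2^-1 * (Cinv * ip (tb u) (tb u)) + 2^-1 * (Cinv * ip (tb u) (tb u)) by field.
apply: le_trans (lerD (ler_wpM2l _ (trl_bound u)) (ler_wpM2l _ (trr_bound u))); [|by rewrite invr_ge0 ler0n..].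
rewrite !mulr_sumr -big_split/=; apply: ler_sum => i _; rewrite /mean.
have := sqr_ge0 (trr (tb u) i - trl (tb u) i); have := h0; nra.
Qed.

Lemma jump_bound (u : U) : h * jump_sq u <= 4 * Cinv * ip (tb u) (tb u).
Proof.
have -> : 4 * Cinv * ip (tb u) (tb u) = 2 * (Cinv * ip (tb u) (tb u)) + 2 * (Cinv * ip (tb u) (tb u)) by ring.
apply: le_trans (lerD (ler_wpM2l _ (trl_bound u)) (ler_wpM2l _ (trr_bound u))); [|by rewrite ler0n..].
rewrite !mulr_sumr -big_split/=; apply: ler_sum => i _; rewrite /Defs.jump.
have := sqr_ge0 (trr (tb u) i + trl (tb u) i); have := h0; nra.
Qed.

Lemma jump_sq_ge0 (u : U) : 0 <= jump_sq u.
Proof. by apply: sumr_ge0 => i _; exact: sqr_ge0. Qed.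

Lemma upwindE v (u : B) i :
  upwind xmin xmax v u i = if 0 <= v then v * trl u i else v * trr u i.
Proof.
rewrite /upwind /mean /Defs.jump; case: ifPn => [v0|]; first by rewrite ger0_norm//; field.
by rewrite -ltNge => v0; rewrite ltr0_norm//; field.
Qed.

Lemma upwind_bound v (u : U) :
  h * \sum_i upwind xmin xmax v (tb u) i ^+ 2 <= v ^+ 2 * (Cinv * ip (tb u) (tb u)).
Proof.
under eq_bigr do rewrite upwindE.
case: (0 <= v).
  under eq_bigr do rewrite exprMn.
  by rewrite -mulr_sumr mulrCA ler_wpM2l ?sqr_ge0// trl_bound.
under eq_bigr do rewrite exprMn.
by rewrite -mulr_sumr mulrCA ler_wpM2l ?sqr_ge0// trr_bound.
Qed.

(** The volume term integrates to interface terms, and the upwind flux completes them to squared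
    jumps. This is the numerical dissipation of the transport term. *)
Lemma adv_diag v (g : U) : adv v g g = `|v| / 2 * jump_sq g.
Proof.
have E := ip_bder xab N0 g g; rewrite /adv weak_formE.
have -> : ip (fun i x => v * tb g i x) (bder g) = v * ip (tb g) (bder g).
  by apply: ip_Z; [exact: bcont_tb|exact: bcont_bder].
have -> : ip (tb g) (bder g) = 2^-1 * \sum_i (trl (tb g) i * trl (tb g) i - trr (tb g) i * trr (tb g) i) by rewrite -E; field.
rewrite /jump_sq !mulr_sumr -big_split/= -sumrN; apply: eq_bigr => i _.
by rewrite /upwind /mean /Defs.jump; field.
Qed.

Lemma lin_adv v (g : U) : lin (adv v g).
Proof.
move=> a p q; rewrite /adv lin_wform; first by ring.
by move=> i; apply: contZ; exact: bcont_tb.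
Qed.

Lemma upwind_lin v a (u w : B) i : upwind xmin xmax v (fun i x => a * u i x + w i x) i =
  a * upwind xmin xmax v u i + upwind xmin xmax v w i.
Proof.
by rewrite /upwind /mean /Defs.jump trr_lin trl_lin; field.
Qed.

Lemma lin_adv_l v (psi : U) : lin (fun g : U => adv v g psi).
Proof.
move=> a u w; rewrite /adv.
have -> : (fun i x => v * tb (a *: u + w) i x) =
  (fun (i : 'I_N) x => a * (v * tb u i x) + v * tb w i x).
  by apply/funext => i; apply/funext => x; rewrite tb_lin; ring.
have -> : upwind xmin xmax v (tb (a *: u + w)) =
  (fun i => a * upwind xmin xmax v (tb u) i + upwind xmin xmax v (tb w) i).
  by apply/funext => i; rewrite tb_linE upwind_lin.
rewrite wform_linl; first by ring.
  by move=> i; apply: contZ; exact: bcont_tb.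
by move=> i; apply: contZ; exact: bcont_tb.
Qed.

Lemma bder_k0 (u : U) : k = 0%N -> bder u = (fun _ _ => 0).
Proof.
move=> k0; apply/funext => i; apply/funext => x; rewrite /bder /poly_at.
have /size1_polyC -> : (size (u i : {poly R}) <= 1)%N by rewrite -[1%N]/(0.+1) -[in 0.+1]k0 size_npoly.
by rewrite derivC horner0.
Qed.

Lemma ip_bder_k0 (w : B) (u : U) : k = 0%N -> ip w (bder u) = 0.
Proof.
move=> k0; rewrite bder_k0// /Defs.ip big1// => i _.
rewrite (@eq_I _ _ _ _ (fun=> 0)); first by rewrite Rintegral_cst// mul0r.
by move=> x _; rewrite mulr0.
Qed.

End Bounds.

(** * Velocity dependence of discrete functions through coordinates *)

Section Coordinates.
Variables (R : realType) (m : model) (k N : nat).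
Local Notation U := (Uh R k N).
Local Notation avg := (avg m).
Local Notation J := ('I_N * 'I_k.+1)%type.

Let smp (j : nat) : R := j%:R.
Let smp_inj : injective smp.
Proof. by move=> i j /eqP; rewrite eqr_nat => /eqP. Qed.

(** The coordinates are the values at the integers 0 to [k], whatever the cell: the pieces are
    polynomials on the whole line, so [k + 1] distinct points determine them, and square
    integrability in [v] of point values is what [in_velocity_space] provides. *)
Definition coordU (j : J) (u : U) : R := (poly_at u j.1).[j.2%:R].

Definition basisU (j : J) : U :=
  [ffun i => if i == j.1 then tnth (qpoly.lagrange k.+1 smp) j.2 else 0].

Lemma basisU_expansion (u : U) : u = \sum_j coordU j u *: basisU j.
Proof.
apply/ffunP => i; rewrite sum_ffunE.
rewrite -(pair_bigA _ (fun a b => (coordU (a, b) u *: basisU (a, b)) i))/=.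
rewrite (bigD1 i)//= [X in _ + X]big1 ?addr0; last first.
  move=> a ai; apply: big1 => b _; rewrite !ffunE/=.
  by rewrite eq_sym (negbTE ai) scaler0.
rewrite [LHS](coord_basis (@qpoly.lagrange_full _ k.+1 smp isT smp_inj) (memvf _)).
apply: eq_bigr => b _; rewrite !ffunE/= eqxx qpoly.lagrange_coords//.
by rewrite -tnth_nth.
Qed.

Lemma lin_coordU j : lin (coordU j).
Proof. by move=> a u w; rewrite /coordU /poly_at !ffunE/= !hornerE. Qed.

Lemma lin_expansion (l : U -> R) : lin l ->
  forall u, l u = \sum_j coordU j u * l (basisU j).
Proof.
move=> ll u; rewrite {1}[u]basisU_expansion (lin_sum ll).
by apply: eq_bigr => j _; rewrite (linZ ll).
Qed.

Definition UL2 (u : R -> U) : Prop := forall j, vL2 m (fun v => coordU j (u v)).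

Lemma UL2_velocity_space (u : R -> U) : in_velocity_space m u -> UL2 u.
Proof. by move=> H j; apply: H. Qed.

Lemma UL2_form (l : U -> R) (u : R -> U) : lin l -> UL2 u ->
  vL2 m (fun v => l (u v)).
Proof.
move=> ll u2; apply: (@vL2_ext _ _ (fun v => \sum_j coordU j (u v) * l (basisU j))).
  by move=> v _; rewrite -lin_expansion.
apply: vL2_sum; last exact: vL2_cst.
move=> j; apply: (@vL2_ext _ _ (fun v => l (basisU j) * coordU j (u v))).
  by move=> v _; rewrite mulrC.
exact: vL2_Z.
Qed.

Lemma UL2_bilin (b : U -> U -> R) (u w : R -> U) :
  (forall q, lin (b^~ q)) -> (forall p, lin (b p)) -> UL2 u -> UL2 w ->
  vint m (fun v => b (u v) (w v)).
Proof.
move=> bl br u2 w2.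
apply: (@vint_ext _ _ (fun v => \sum_j coordU j (u v) * b (basisU j) (w v))).
  by move=> v _; rewrite -(lin_expansion (bl (w v))).
apply: vint_sum => j; apply: vintM => //; exact: UL2_form.
Qed.

Lemma UL2_lin a (u w : R -> U) : UL2 u -> UL2 w -> UL2 (fun v => a *: u v + w v).
Proof.
move=> u2 w2 j; apply: (@vL2_ext _ _ (fun v => a * coordU j (u v) + coordU j (w v))).
  by move=> v _; rewrite lin_coordU.
by apply: vL2_D => //; apply: vL2_Z.
Qed.

Lemma UL2_B (u w : R -> U) : UL2 u -> UL2 w -> UL2 (fun v => u v - w v).
Proof.
move=> u2 w2 j.
apply: (@vL2_ext _ _ (fun v => coordU j (-1 *: w v + u v))).
  by move=> v _; rewrite scaleN1r addrC.
exact: UL2_lin.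
Qed.

Lemma UL2_cst (u : U) : UL2 (fun=> u).
Proof. by move=> j; exact: vL2_cst. Qed.

Definition vmean (q : R -> R) (u : R -> U) : U :=
  \sum_j avg (fun v => q v * coordU j (u v)) *: basisU j.

(** In finite dimension an average passes through any linear form by expansion in the basis. For
    discrete functions this replaces Fubini's theorem. *)
Lemma avg_vmean (l : U -> R) (q : R -> R) (u : R -> U) :
  lin l -> vL2 m q -> UL2 u -> avg (fun v => q v * l (u v)) = l (vmean q u).
Proof.
move=> ll q2 u2; rewrite /vmean (lin_sum ll).
transitivity (avg (fun v => \sum_j l (basisU j) * (q v * coordU j (u v)))).
  apply: avg_ext => v _; rewrite (lin_expansion ll) mulr_sumr.
  by apply: eq_bigr => j _; ring.
rewrite avg_sum; last by move=> j; apply: vintZ; apply: vintM.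
apply: eq_bigr => j _; rewrite (linZ ll) avgZ; first exact: mulrC.
exact: vintM.
Qed.

End Coordinates.

Section Scheme.
Variables (R : realType) (m : model) (xmin xmax : R) (k N : nat) (Cinv Chinv : R).
Hypotheses (xab : xmin < xmax) (N0 : (0 < N)%N)
  (Cinv0 : 0 < Cinv) (Chinv0 : 0 < Chinv)
  (inv : inverse_inequalities k Cinv Chinv).
Local Notation U := (Uh R k N).
Local Notation B := (broken R N).
Local Notation ip := (@ip R xmin xmax N).
Local Notation tb := (@to_broken R k N).
Local Notation wfl := (@wfl R xmin xmax k N).
Local Notation adv := (@adv R xmin xmax k N).
Local Notation avg := (avg m).

Lemma lin_ipl (w : B) : bcont w -> lin (fun u : U => ip (tb u) w).
Proof.
move=> cw a u u'; rewrite tb_linE ip_lin//; exact: bcont_tb.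
Qed.

Lemma lin_ipr (w : B) : bcont w -> lin (fun u : U => ip w (tb u)).
Proof. by move=> cw; exact: lin_ip. Qed.

Lemma lin_ipUl (w : U) : lin (fun u : U => ip (tb u) (tb w)).
Proof. by apply: lin_ipl; exact: bcont_tb. Qed.

Lemma lin_ipUr (w : U) : lin (fun u : U => ip (tb w) (tb u)).
Proof. by apply: lin_ipr; exact: bcont_tb. Qed.

Lemma rieszP (l : U -> R) : lin l ->
  forall psi, ip (tb (riesz xmin xmax l)) (tb psi) = l psi.
Proof.
move=> ll; rewrite /riesz; case: xgetP => [w -> //|H]; exfalso.
have [p Hp] := @nondegenerate_represents R U (fun p q => ip (tb p) (tb q))
  lin_ipUl lin_ipUr (fun p H => ip_eq0 xab N0 Cinv0 inv (H p)) l ll.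
exact: (H p).
Qed.

Lemma tb_vmean q (u : R -> U) : vL2 m q -> UL2 m u ->
  avg_broken m (fun v i x => q v * tb (u v) i x) = tb (vmean m q u).
Proof.
move=> q2 u2; apply/funext => i; apply/funext => x; rewrite /avg_broken.
rewrite (@avg_vmean _ _ _ _ (fun u => tb u i x))// => a w w'.
by rewrite tb_lin.
Qed.

Lemma a_hE fl (g : R -> U) phi : UL2 m g ->
  a_h m xmin xmax fl g phi = - wfl fl (tb (vmean m id g)) phi.
Proof. by move=> g2; rewrite /a_h tb_vmean//; exact: vL2_id. Qed.

Lemma d_hE fl (rho psi : U) : d_h xmin xmax fl rho psi = wfl (swap fl) (tb rho) psi.
Proof. by rewrite /d_h flux_rho_swap. Qed.

(** By [wfl_skew], the coupling term of the $g$ equation, tested and averaged, is the form of the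
    $\rho$ equation. This is what allows the two coupling terms to be combined. *)
Lemma avg_vd_h fl (r : U) (g : R -> U) : UL2 m g ->
  avg (fun v => v * d_h xmin xmax fl r (g v)) = a_h m xmin xmax fl g r.
Proof.
move=> g2; rewrite a_hE// (@avg_vmean _ _ _ _ (d_h xmin xmax fl r) id)//; last 2 first.
- by move=> a p q; rewrite !d_hE /wfl lin_wform//; exact: bcont_tb.
- exact: vL2_id.
rewrite d_hE; apply/eqP; rewrite -addr_eq0.
by have := wfl_skew xab N0 (swap fl) r (vmean m id g); rewrite swapK addrC => ->.
Qed.

Lemma D_hP g v psi : ip (tb (D_h xmin xmax g v)) (tb psi) = adv v g psi.
Proof. by rewrite rieszP//; exact: lin_adv. Qed.

(** The upwind side depends on the sign of [v], so the form is not linear in [v]. It is split into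
    [v] times the central form and [|v|] times a jump form; both multipliers are continuous and
    bounded by 1 on [Omega_v]. *)
Lemma UL2_adv (g : R -> U) psi : UL2 m g -> vL2 m (fun v => adv v (g v) psi).
Proof.
move=> g2.
pose l1 (u : U) := wfl Central (tb u) psi.
pose l2 (u : U) := 2^-1 * \sum_i jump xmin xmax (tb u) i * jump xmin xmax (tb psi) i.
have E v : adv v (g v) psi = (-1) * (v * l1 (g v)) + `|v| * l2 (g v).
  rewrite /adv /l1 /l2 /wfl !weak_formE ip_Z; last 2 first.
    exact: bcont_tb.
    exact: bcont_bder.
  set p := ip _ _.
  have -> : \sum_i upwind xmin xmax v (tb (g v)) i * jump xmin xmax (tb psi) i =
    v * (\sum_i flux_vg xmin xmax Central (tb (g v)) i * jump xmin xmax (tb psi) i) -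
    `|v| / 2 * (\sum_i jump xmin xmax (tb (g v)) i * jump xmin xmax (tb psi) i).
    rewrite !mulr_sumr -sumrB; apply: eq_bigr => i _.
    by rewrite /upwind /=; ring.
  by field.
have l1l : lin l1 by exact: lin_wfl.
have l2l : lin l2.
  move=> a u w; rewrite /l2 [a * _]mulrCA -mulrDr; congr (_ * _).
  by rewrite mulr_sumr -big_split/=; apply: eq_bigr => i _; rewrite tb_linE jump_lin; ring.
apply: (vL2_ext (fun v _ => esym (E v))).
apply: vL2_D; first by apply/vL2_Z/vL2_idM/UL2_form.
by apply/vL2_absM/UL2_form.
Qed.

Lemma b_hE v (g : R -> U) psi : UL2 m g ->
  b_h m xmin xmax v g psi = adv v (g v) psi - avg (fun w => adv w (g w) psi).
Proof.
move=> g2; rewrite /b_h.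
pose D w := D_h xmin xmax (g w) w.
(* [D_h] is obtained by choice, separately for each velocity. Expanding it on the representatives of
   the coordinate forms exhibits its coefficients as values of [adv], hence square integrable in
   [v]. *)
pose r j := riesz xmin xmax (fun psi : U => coordU j psi).
have DE w : D w = \sum_j adv w (g w) (basisU R j) *: r j.
  apply: (ip_inj xab N0 Cinv0 inv) => q; rewrite D_hP (lin_sum (lin_ipUl q)).
  rewrite (lin_expansion (lin_adv _ _ _ _)); apply: eq_bigr => j _.
  rewrite (linZ (lin_ipUl q)) /r (rieszP (lin_coordU j)); ring.
have D2 : UL2 m D.
  move=> j; apply: (@vL2_ext _ _ (fun w => \sum_i coordU j (r i) * adv w (g w) (basisU R i))).
    move=> w _; rewrite DE (lin_sum (lin_coordU j)).
    by apply: eq_bigr => i _; rewrite (linZ (lin_coordU j)) mulrC.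
  by apply: vL2_sum; [move=> i; apply/vL2_Z/UL2_adv|exact: vL2_cst].
have -> : avg_broken m (fun w => tb (D w)) = tb (vmean m (fun=> 1) D).
  rewrite -tb_vmean//; last exact: vL2_cst.
  apply/funext => i; apply/funext => x; apply: avg_ext => w _.
  by rewrite mul1r.
have := ip_lin xmin xmax (-1) (@bcont_tb R k N (vmean m (fun=> 1) D)) (@bcont_tb R k N (D v)) (@bcont_tb R k N psi).
rewrite D_hP -(@avg_vmean _ _ _ _ (fun u => ip (tb u) (tb psi)))//; last 2 first.
- exact: lin_ipUl.
- exact: vL2_cst.
under [in RHS]eq_fun do rewrite mul1r D_hP.
rewrite mulN1r addrC => <-.
by apply: eq_ip => // i x _; rewrite mulN1r addrC.
Qed.

Lemma vint_adv (g xi : R -> U) : UL2 m g -> UL2 m xi ->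
  vint m (fun v => adv v (g v) (xi v)).
Proof.
move=> g2 x2.
apply: (@vint_ext _ _ (fun v => \sum_j coordU j (xi v) * adv v (g v) (basisU R j))).
  by move=> v _; rewrite -(lin_expansion (lin_adv _ _ _ _)).
by apply: vint_sum => j; apply: vintM => //; exact: UL2_adv.
Qed.

Lemma avg_b_h (g xi : R -> U) : UL2 m g -> UL2 m xi -> vmean m (fun=> 1) xi = 0 ->
  avg (fun v => b_h m xmin xmax v g (xi v)) = avg (fun v => adv v (g v) (xi v)).
Proof.
move=> g2 x2 x0; under eq_fun do rewrite b_hE//.
pose l (psi : U) := avg (fun w => adv w (g w) psi).
have ll : lin l.
  move=> a u w; rewrite /l -avg_lin; last 2 first.
    exact/vint_vL2/UL2_adv.
    exact/vint_vL2/UL2_adv.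
  by apply: avg_ext => v _; rewrite lin_adv.
rewrite avgB; last 2 first.
- exact: vint_adv.
- exact/vint_vL2/(UL2_form ll).
rewrite -[X in _ - X](_ : avg (fun v => 1 * l (xi v)) = _); last first.
  by apply: avg_ext => v _; rewrite mul1r.
by rewrite (avg_vmean ll)//; [rewrite x0 (lin0 ll) subr0|exact: vL2_cst].
Qed.

Lemma UL2_idZ (g : R -> U) : UL2 m g -> UL2 m (fun v => v *: g v).
Proof.
move=> g2 j; apply: (@vL2_ext _ _ (fun v => v * coordU j (g v))).
  by move=> v _; rewrite (linZ (lin_coordU j)).
exact: vL2_idM.
Qed.

Lemma UL2_absZ (g : R -> U) : UL2 m g -> UL2 m (fun v => `|v| *: g v).
Proof.
move=> g2 j; apply: (@vL2_ext _ _ (fun v => `|v| * coordU j (g v))).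
  by move=> v _; rewrite (linZ (lin_coordU j)).
exact: vL2_absM.
Qed.

Lemma vint_ip (g xi : R -> U) : UL2 m g -> UL2 m xi ->
  vint m (fun v => ip (tb (g v)) (tb (xi v))).
Proof.
by move=> g2 x2; apply: (@UL2_bilin _ _ _ _ (fun p q => ip (tb p) (tb q))) => //;
  [exact: lin_ipUl|exact: lin_ipUr].
Qed.

Lemma vint_jump_sq (g : R -> U) : UL2 m g -> vint m (fun v => `|v| * jump_sq xmin xmax (g v)).
Proof.
move=> g2.
apply: (@vint_ext _ _ (fun v => \sum_i jump xmin xmax (tb (`|v| *: g v)) i * jump xmin xmax (tb (g v)) i)).
  move=> v _; rewrite /jump_sq mulr_sumr; apply: eq_bigr => i _.
  by rewrite (linZ (lin_jump xmin xmax i)) mulrA.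
apply: vint_sum => i; apply: vintM.
  by apply: (UL2_form (lin_jump xmin xmax i)); exact: UL2_absZ.
exact: (UL2_form (lin_jump xmin xmax i)).
Qed.

End Scheme.

(** * Energy stability of one time step *)

Section Stability.
Variables (R : realType) (m : model) (xmin xmax : R) (k N : nat) (Cinv Chinv : R).
Hypotheses (xab : xmin < xmax) (N0 : (0 < N)%N)
  (Cinv0 : 0 < Cinv) (Chinv0 : 0 < Chinv)
  (inv : inverse_inequalities k Cinv Chinv).
Local Notation U := (Uh R k N).
Local Notation h := (mesh_size xmin xmax N).
Local Notation ip := (@ip R xmin xmax N).
Local Notation tb := (@to_broken R k N).
Local Notation wfl := (@wfl R xmin xmax k N).
Local Notation adv := (@adv R xmin xmax k N).
Local Notation jump_sq := (@jump_sq R xmin xmax k N).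
Local Notation avg := (avg m).
Local Notation vsqr := (vsqr R m).
Local Notation vabs := (vabs R m).

(* For [k = 0] the volume terms vanish and Young's inequality loses nothing:
   this is the factor 2 between the two time step bounds. *)
Definition cvol : R := if k == 0%N then 0 else Chinv.
Definition cjmp : R := if k == 0%N then Cinv / 2 else Cinv.

Definition Gen (g : R -> U) : R := avg (fun v => ip (tb (g v)) (tb (g v))).
Definition Jen (g : R -> U) : R := avg (fun v => `|v| * jump_sq (g v)).

Let h0 : 0 < h := h_gt0 xab N0.

Lemma cvol_ge0 : 0 <= cvol.
Proof. by rewrite /cvol; case: ifP => // _; exact: ltW. Qed.

Lemma cjmp_gt0 : 0 < cjmp.
Proof. by rewrite /cjmp; case: ifP => // _; rewrite divr_gt0. Qed.

Lemma Gen_ge0 g : 0 <= Gen g.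
Proof. by apply: avg_ge0 => v _; exact: ip_ge0. Qed.

Lemma Jen_ge0 g : 0 <= Jen g.
Proof. by apply: avg_ge0 => v _; rewrite mulr_ge0//; exact: jump_sq_ge0. Qed.

Lemma Jen_le g : UL2 m g -> h * Jen g <= 4 * Cinv * Gen g.
Proof.
move=> g2; rewrite /Jen /Gen -!avgZ; [|exact: vint_ip|exact: vint_jump_sq].
apply: avg_le; [exact/vintZ/vint_jump_sq|exact/vintZ/vint_ip|].
move=> v /Omega_abs v1; apply: le_trans (jump_bound xab N0 inv (g v)).
by rewrite mulrCA ler_piMl// mulr_ge0 ?jump_sq_ge0// ltW.
Qed.

(** For [k >= 1] the budget [E / (2 * s)] is shared equally by the volume term and the flux term.
    For [k = 0] the flux term receives all of it, which is why [cjmp] is then half as large. The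
    sign [b] in the proof gives the two sides of the absolute value. *)
Lemma flux_young (s : R) (u : broken R N) (uhat : 'I_N -> R) (X : U) (E : R) :
  0 < s -> bcont u ->
  ip u u <= E -> h * (\sum_i uhat i ^+ 2) <= Cinv * E ->
  `| weak_form xmin xmax u uhat X | <=
     E / (2 * s) + s * (cvol / h ^+ 2 * ip (tb X) (tb X) + cjmp / h * jump_sq X).
Proof.
move=> s0 cu uE uhE; rewrite weak_formE.
have cb := @bcont_bder R k N X.
have E0 : 0 <= E by apply: le_trans (ip_ge0 _ _ _) uE.
pose kap : R := if k == 0%N then 1 else 2^-1.
have kap0 : 0 < kap by rewrite /kap; case: ifP => // _; rewrite invr_gt0.
have cjE : cjmp = Cinv / (2 * kap).
  by rewrite /cjmp /kap; case: ifP => _; field.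
have key (b : R) (c : 'I_N -> R) : (b = 1 \/ b = - 1) ->
   b * (\sum_i uhat i * c i) <= kap * (E / (2 * s)) +
     s * (cjmp / h * (\sum_i c i ^+ 2)).
  move=> b1; rewrite mulr_sumr.
  (* With this weight the hypothesis on the sum of [uhat i ^+ 2] costs exactly the share [kap] of
     [E / (2 * s)]. *)
  pose th : R := kap * h / (s * Cinv).
  have th0 : 0 < th.
    by apply: divr_gt0; apply: mulr_gt0.
  have := sum_young uhat (fun i => b * c i) th0.
  have -> : \sum_i (b * c i) ^+ 2 = \sum_i c i ^+ 2.
    by apply: eq_bigr => i _; rewrite exprMn; case: b1 => ->; rewrite ?sqrrN expr1n mul1r.
  under eq_bigr do rewrite mulrCA.
  move=> /le_trans; apply; apply: lerD.
    have -> : th / 2 * (\sum_j uhat j ^+ 2) = kap / (2 * s * Cinv) * (h * (\sum_j uhat j ^+ 2)).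
      by rewrite /th; field; rewrite !gt_eqF.
    have -> : kap * (E / (2 * s)) = kap / (2 * s * Cinv) * (Cinv * E).
      by field; rewrite !gt_eqF.
    apply: ler_wpM2l => //.
    apply: divr_ge0; [exact: ltW|apply: mulr_ge0; [apply: mulr_ge0 => //|]; exact: ltW].
  rewrite mulrA ler_wpM2r//; first by apply: sumr_ge0 => i _; exact: sqr_ge0.
  rewrite le_eqVlt; apply/orP; left; apply/eqP; rewrite cjE /th.
  by field; rewrite !gt_eqF.
have volk (b : R) : (b = 1 \/ b = - 1) ->
   b * ip u (bder X) <= (if k == 0%N then 0 else 2^-1) * (E / (2 * s)) + s * (cvol / h ^+ 2 * ip (tb X) (tb X)).
  move=> b1; rewrite /cvol; case: (eqVneq k 0%N) => [k0|kn0].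
    by rewrite ip_bder_k0// !mul0r !mulr0 addr0.
  have th0 : 0 < (2 * s)^-1 by rewrite invr_gt0 mulr_gt0.
  have cbb : bcont (fun i x => b * bder X i x) by move=> i; exact: contZ.
  have := ip_young xmin xmax th0 cu cbb.
  rewrite (ip_sym _ _ u) ip_Z// (ip_sym _ _ _ u) => H; apply: le_trans H _.
  rewrite ip_Z// (ip_sym _ _ _ (fun i x => b * _)) ip_Z//.
  have -> : b * (b * ip (bder X) (bder X)) = ip (bder X) (bder X).
    by rewrite mulrA; case: b1 => ->; ring.
  apply: lerD.
    rewrite -[X in X <= _](_ : 2^-1 * (ip u u / (2 * s)) = _); last by field; rewrite gt_eqF.
    by rewrite ler_wpM2l ?invr_ge0// ler_wpM2r// invr_ge0 mulr_ge0// ltW.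
  have -> : (2 * (2 * s)^-1)^-1 * ip (bder X) (bder X) = s / h ^+ 2 * (h ^+ 2 * ip (bder X) (bder X)).
    by field; rewrite !gt_eqF.
  have -> : s * (Chinv / h ^+ 2 * ip (tb X) (tb X)) = s / h ^+ 2 * (Chinv * ip (tb X) (tb X)).
    by field; rewrite !gt_eqF.
  apply: ler_wpM2l; last exact: (bder_bound xab N0 inv).
  by apply: divr_ge0; [exact: ltW|exact: sqr_ge0].
have half : (if k == 0%N then 0 else 2^-1) + kap = 1 :> R.
  by rewrite /kap; case: ifP => _; [rewrite add0r|field].
have comb (b : R) : (b = 1 \/ b = - 1) ->
    b * (ip u (bder X) + \sum_i uhat i * jump xmin xmax (tb X) i) <=
    E / (2 * s) + s * (cvol / h ^+ 2 * ip (tb X) (tb X) + cjmp / h * jump_sq X).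
  move=> b1; rewrite mulrDr; apply: le_trans (lerD (volk b b1) (key b _ b1)) _.
  rewrite addrACA -mulrDl half mul1r mulrDr//.
rewrite ler_norml; apply/andP; split.
  by have := comb (-1) (or_intror erefl); rewrite mulN1r lerNl.
by have := comb 1 (or_introl erefl); rewrite mul1r.
Qed.

(** The transport is explicit, so [adv v g0 g1] is the dissipative value at [g1] minus
    [adv v (g1 - g0) g1]. The latter is split by [flux_young] with the weight [tau * v ^+ 2 / eps],
    for which the increment costs exactly $\varepsilon^2/(2\tau)$ times its square; what remains is
    of size $\tau v^2$, and $v^2\le|v|\le 1$. *)
Lemma adv_lower (v eps tau : R) (g0 g1 : U) : Omega_v m v -> 0 < eps -> 0 < tau ->
  eps * `|v| / 2 * jump_sq g1 - eps ^+ 2 / (2 * tau) * ip (tb (g1 - g0)) (tb (g1 - g0))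
   - tau * (cvol / h ^+ 2 * ip (tb g1) (tb g1) + cjmp / h * (`|v| * jump_sq g1))
  <= eps * adv v g0 g1.
Proof.
move=> Ov e0 t0.
have -> : adv v g0 g1 = adv v g1 g1 - adv v (g1 - g0) g1.
  by rewrite (linB (lin_adv_l _ _ v g1)); ring.
set d := g1 - g0.
rewrite adv_diag// mulrBr.
suff : eps * adv v d g1 <= eps ^+ 2 / (2 * tau) * ip (tb d) (tb d) +
   tau * (cvol / h ^+ 2 * ip (tb g1) (tb g1) + cjmp / h * (`|v| * jump_sq g1)) by lra.
have D0 : 0 <= ip (tb d) (tb d) by exact: ip_ge0.
have G0 : 0 <= cvol / h ^+ 2 * ip (tb g1) (tb g1).
  by rewrite mulr_ge0 ?ip_ge0// divr_ge0 ?cvol_ge0// sqr_ge0.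
have J0 : 0 <= cjmp / h * jump_sq g1.
  by rewrite mulr_ge0 ?jump_sq_ge0// divr_ge0 ?(ltW cjmp_gt0)// ltW.
have J1 : cjmp / h * (`|v| * jump_sq g1) = `|v| * (cjmp / h * jump_sq g1) by ring.
have v1 := Omega_abs Ov; have v2 := sqr_le_abs Ov; have va := normr_ge0 v.
(* The weight of Young's inequality degenerates at velocity 0, where the form itself vanishes. *)
have [v0|v0] := eqVneq v 0.
  have -> : adv v d g1 = 0.
    rewrite /adv weak_formE ip_Z; [|exact: bcont_tb|exact: bcont_bder].
    rewrite v0 mul0r add0r big1 ?oppr0// => i _.
    by rewrite /upwind normr0 !mul0r subrr mul0r.
  rewrite mulr0 J1 addr_ge0//; first by rewrite mulr_ge0// divr_ge0 ?sqr_ge0// mulr_ge0// ltW.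
  by apply: mulr_ge0; [exact: ltW|apply: addr_ge0 => //; exact: mulr_ge0].
have v20 : 0 < v ^+ 2 by rewrite lt_neqAle sqr_ge0 eq_sym expf_neq0.
have s0 : 0 < tau * v ^+ 2 / eps by apply: divr_gt0 => //; exact: mulr_gt0.
have cv : bcont (fun (i : 'I_N) x => v * tb d i x) by move=> i; apply: contZ; exact: bcont_tb.
have vE : ip (fun i x => v * tb d i x) (fun i x => v * tb d i x) = v ^+ 2 * ip (tb d) (tb d).
  by rewrite ip_Z ?(ip_sym _ _ (tb d)) ?ip_Z//; [ring|exact: bcont_tb..].
have uE : h * (\sum_i upwind xmin xmax v (tb d) i ^+ 2) <= Cinv * (v ^+ 2 * ip (tb d) (tb d)).
  by rewrite [leRHS]mulrCA; exact: (upwind_bound xab N0 inv v d).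
have vE' : ip (fun i x => v * tb d i x) (fun i x => v * tb d i x) <= v ^+ 2 * ip (tb d) (tb d) by rewrite vE.
have := flux_young g1 s0 cv vE' uE.
rewrite ler_norml => /andP[H _].
have H2 : adv v d g1 <= v ^+ 2 * ip (tb d) (tb d) / (2 * (tau * v ^+ 2 / eps)) +
    tau * v ^+ 2 / eps * (cvol / h ^+ 2 * ip (tb g1) (tb g1) + cjmp / h * jump_sq g1).
  by rewrite /adv lerNl.
have := ler_wpM2l (ltW e0) H2; set a := adv _ _ _ => /le_trans; apply.
rewrite J1; move: G0 J0; set G := cvol / _ * _; set J := cjmp / h * _ => G0 J0.
rewrite mulrDr; apply: lerD.
  rewrite le_eqVlt; apply/orP; left; apply/eqP; field.
  by rewrite v0 !gt_eqF.
rewrite -[leLHS](_ : tau * (v ^+ 2 * G + v ^+ 2 * J) = _); last by field; rewrite gt_eqF.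
rewrite ler_wpM2l ?(ltW t0)//; apply: lerD; last exact: ler_wpM2r.
by rewrite -[leRHS]mul1r; apply: ler_wpM2r => //; exact: le_trans v2 v1.
Qed.

(** Cauchy--Schwarz in [v], obtained by pairing $\langle vg\rangle$ with itself: Young's inequality
    with weight $\langle v^2\rangle$ returns half of the left-hand side, which is absorbed. *)
Lemma ip_vmean (g : R -> U) : UL2 m g ->
  ip (tb (vmean m id g)) (tb (vmean m id g)) <= vsqr * Gen g.
Proof.
move=> g2; set X := vmean m id g; set K := ip (tb X) (tb X).
have q0 := vsqr_gt0 R m.
have E : K = avg (fun v => v * ip (tb (g v)) (tb X)).
  by rewrite (avg_vmean (lin_ipUl xmin xmax X) (vL2_id R m) g2).
have : K <= avg (fun v => vsqr / 2 * ip (tb (g v)) (tb (g v)) + (2 * vsqr)^-1 * K * (v ^+ 2)).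
  rewrite {1}E; apply: avg_le.
  - by apply: vintM; [exact: vL2_id|apply: (UL2_form (lin_ipUl xmin xmax X))].
  - apply: vintD; apply: vintZ; first exact: vint_ip.
    by apply: vintM; exact: vL2_id.
  move=> v _.
  have cX : bcont (fun (i : 'I_N) x => v * tb X i x) by move=> i; apply: contZ; exact: bcont_tb.
  have := ip_young xmin xmax q0 (@bcont_tb R k N (g v)) cX.
  rewrite (ip_sym _ _ (tb (g v))) !ip_Z//; [|exact: bcont_tb..].
  rewrite (ip_sym _ _ (tb X) (fun i x => v * _)) ip_Z; [|exact: bcont_tb..].
  rewrite (ip_sym _ _ (tb X) (tb (g v))) => /le_trans; apply.
  by rewrite le_eqVlt; apply/orP; left; apply/eqP; rewrite -/K; ring.
rewrite avgD; last 2 first.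
- by apply/vintZ/vint_ip.
- by apply/vintZ/vintM; exact: vL2_id.
rewrite !avgZ; [|by apply: vintM; exact: vL2_id|exact: vint_ip].
rewrite -/(Gen g) -/vsqr.
have -> : (2 * vsqr)^-1 * K * vsqr = K / 2 by field; rewrite gt_eqF.
lra.
Qed.

Lemma quadratic_CS (A b c : R) : 0 < A ->
  (forall s : R, 2 * s * c <= s ^+ 2 * A + b) -> c ^+ 2 <= A * b.
Proof.
move=> A0 /(_ (c / A)).
have -> : 2 * (c / A) * c = 2 * (c ^+ 2 / A) by field; rewrite gt_eqF.
have -> : (c / A) ^+ 2 * A = c ^+ 2 / A by field; rewrite gt_eqF.
by move=> H; rewrite mulrC -ler_pdivrMr//; lra.
Qed.

(** Cauchy--Schwarz at each interface for the measure $|v|\,d\mu$. The weight $|v|$ is the one that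
    the upwind dissipation controls. *)
Lemma jump_vmean (g : R -> U) : UL2 m g -> jump_sq (vmean m id g) <= vabs * Jen g.
Proof.
move=> g2.
have g2j i : vL2 m (fun v => jump xmin xmax (tb (g v)) i).
  exact: (UL2_form (lin_jump xmin xmax i)).
have vj i : vint m (fun v => `|v| * jump xmin xmax (tb (g v)) i ^+ 2).
  apply: (@vint_ext _ _ (fun v => (`|v| * jump xmin xmax (tb (g v)) i) * jump xmin xmax (tb (g v)) i)).
    by move=> v _; rewrite expr2 mulrA.
  by apply: vintM => //; exact: vL2_absM.
have -> : Jen g = \sum_i avg (fun v => `|v| * jump xmin xmax (tb (g v)) i ^+ 2).
  rewrite -avg_sum//; apply: avg_ext => v _.
  by rewrite /jump_sq mulr_sumr.
rewrite mulr_sumr; apply: ler_sum => i _.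
apply: quadratic_CS; first exact: vabs_gt0.
move=> s; rewrite -(@avg_vmean _ _ _ _ (fun u => jump xmin xmax (tb u) i))//; last 2 first.
- exact: lin_jump.
- exact: vL2_id.
rewrite -!avgZ; last 2 first.
- exact/vint_vL2/vL2_abs.
- by apply: vintM => //; exact: vL2_id.
rewrite -avgD//; last exact/vintZ/vint_vL2/vL2_abs.
apply: avg_le.
- by apply/vintZ/vintM => //; exact: vL2_id.
- by apply: vintD => //; exact/vintZ/vint_vL2/vL2_abs.
move=> v _; set j := jump _ _ _ _.
have -> : s ^+ 2 * `|v| + `|v| * j ^+ 2 = `|v| * (s ^+ 2 + j ^+ 2) by ring.
apply: le_trans (ler_norm _) _; rewrite !normrM ger0_norm ?ler0n//.
have -> : 2 * `|s| * (`|v| * `|j|) = `|v| * (2 * `|s| * `|j|) by ring.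
rewrite ler_wpM2l// -[s ^+ 2]real_normK ?num_real// -[j ^+ 2]real_normK ?num_real//.
by have := sqr_ge0 (`|s| - `|j|); lra.
Qed.

(** The form is first reversed by [wfl_skew], so that the derivative and the jumps fall on $\langle
    vg\rangle$ and [phi] enters only through its $L^2$ norm. In the energy estimate [phi] is an
    increment of $\rho$, whose square is available with factor 1/2. *)
Lemma a_h_young (tau : R) fl (g : R -> U) (phi : U) : 0 < tau -> UL2 m g ->
  `| a_h m xmin xmax fl g phi | <= ip (tb phi) (tb phi) / (2 * tau) +
    tau * (vsqr * cvol / h ^+ 2 * Gen g + vabs * cjmp / h * Jen g).
Proof.
move=> t0 g2; rewrite a_hE//.
have := wfl_skew xab N0 fl (vmean m id g) phi.
move=> /eqP; rewrite addrC addr_eq0 => /eqP <-.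
have := flux_young (vmean m id g) t0 (@bcont_tb R k N phi) (lexx _)
  (fvg_bound xab N0 inv (swap fl) phi).
move=> /le_trans; apply; rewrite lerD2l; apply: ler_wpM2l; first exact: ltW.
apply: lerD.
  have -> : vsqr * cvol / h ^+ 2 * Gen g = cvol / h ^+ 2 * (vsqr * Gen g) by ring.
  by rewrite ler_wpM2l ?ip_vmean// divr_ge0 ?sqr_ge0// cvol_ge0.
have -> : vabs * cjmp / h * Jen g = cjmp / h * (vabs * Jen g) by ring.
by rewrite ler_wpM2l ?jump_vmean// divr_ge0 ?(ltW h0)// ltW// cjmp_gt0.
Qed.

(** It suffices that [dt_stab] times the bracket is at most [G + eps / 2 * J]. For [k >= 1], lower
    [eps] to the minimum [x] in [dt_stab]: the gap then factors as
    $(\alpha_2h-x\alpha_1)(2\alpha_3G-hJ)$ over a positive number. The first factor is nonnegative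
    by the choice of [x], the second by the trace inequality for jumps. For [k = 0] the trace
    inequality alone is enough. *)
Lemma time_step_absorbs (eps tau sigma G J : R) : 0 < eps -> 0 < tau -> 0 < sigma < 1 ->
  tau <= sigma * dt_stab m k Cinv Chinv eps h ->
  0 <= G -> 0 <= J -> h * J <= 4 * Cinv * G ->
  tau * ((1 + vsqr) * cvol / h ^+ 2 * G + (1 + vabs) * cjmp / h * J)
   + (1 - sigma) * (G + eps / 2 * J) <= G + eps / 2 * J.
Proof.
move=> e0 t0 /andP[s0 s1] ts G0 J0 JG.
have q0 := vsqr_gt0 R m; have a0 := vabs_gt0 R m.
set Q := _ / h ^+ 2 * G + _.
have Q0 : 0 <= Q.
  rewrite /Q addr_ge0// mulr_ge0// divr_ge0 ?sqr_ge0 ?(ltW h0)// mulr_ge0 ?cvol_ge0 ?(ltW cjmp_gt0)//; lra.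
set td := dt_stab _ _ _ _ _ _ in ts.
suff H : td * Q <= G + eps / 2 * J.
  have := ler_wpM2r Q0 ts; have := ler_wpM2l (ltW s0) H; set E := G + _; rewrite mulrA; lra.
rewrite /td /dt_stab /Q /cvol /cjmp /alpha1 /alpha2 /alpha3 vsup1 expr1n -/vsqr -/vabs.
case: ifP => _.
  rewrite mulr0 !mul0r add0r.
  rewrite -[leLHS](_ : h * J / (4 * Cinv) + eps / 2 * J = _).
    by rewrite lerD2r ler_pdivrMr ?mulr_gt0// [leRHS]mulrC.
  by field; rewrite !gt_eqF//; lra.
set al1 := (1 + vsqr) * Chinv; set al2 := 2 * (1 + vabs) * Cinv.
set al3 := 2 * 1 * Cinv; set x := Num.min _ _.
have al10 : 0 < al1 by rewrite mulr_gt0//; lra.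
have al20 : 0 < al2 by rewrite mulr_gt0//; lra.
have al30 : 0 < al3 by rewrite !mulr_gt0.
have S0 : 0 < al1 + al2 * al3 by rewrite addr_gt0// mulr_gt0.
have xe : x <= eps by rewrite /x ge_min lexx.
have xa : x * al1 <= al2 * h.
  by rewrite -ler_pdivlMr// /x ge_min lexx orbT.
have -> : (1 + vabs) * Cinv / h * J = al2 / (2 * h) * J by rewrite /al2; field; rewrite gt_eqF.
rewrite -/al1.
have hJ : h * J <= 2 * al3 * G by rewrite /al3; lra.
clearbody al1 al2 al3 x.
have xeJ : x / 2 * J <= eps / 2 * J by rewrite ler_wpM2r// ler_wpM2r// invr_ge0.
apply: (@le_trans _ _ (G + x / 2 * J)); last by rewrite lerD2l.
rewrite -subr_ge0.
have -> : G + x / 2 * J - h / (al1 + al2 * al3) * (h + x * al3) * (al1 / h ^+ 2 * G + al2 / (2 * h) * J)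
  = (al2 * h - x * al1) / (2 * h * (al1 + al2 * al3)) * (2 * al3 * G - h * J).
  by field; rewrite !gt_eqF.
apply: mulr_ge0; last by rewrite subr_ge0.
apply: divr_ge0; first by rewrite subr_ge0.
by apply: mulr_ge0; [apply: mulr_ge0 => //|]; exact: ltW.
Qed.

(** Polarizing the two differences leaves $\frac12\|r_1-r_0\|^2$ and
    $\frac{\varepsilon^2}2|||g_1-g_0|||^2$ with the favourable sign. The coupling terms add up to
    [a_h] tested with [r1 - r0], which [a_h_young] pays with the first; [adv_lower] pays for the
    explicit transport with the second. Both increments are used up, and the remainders of order
    [tau] are those of [time_step_absorbs]. *)
Lemma energy_step (eps tau sigma : R) fl (r0 r1 : U) (g0 g1 : R -> U) (S F : R) :
  0 < eps -> 0 < tau -> 0 < sigma < 1 ->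
  tau <= sigma * dt_stab m k Cinv Chinv eps h ->
  UL2 m g0 -> UL2 m g1 ->
  ip (tb (r1 - r0)) (tb r1) + tau * a_h m xmin xmax fl g1 r1 = tau * S ->
  eps ^+ 2 * avg (fun v => ip (tb (g1 v - g0 v)) (tb (g1 v))) +
    tau * (eps * avg (fun v => adv v (g0 v) (g1 v)) - a_h m xmin xmax fl g1 r0 + Gen g1)
    = tau * F ->
  (ip (tb r1) (tb r1) + eps ^+ 2 * Gen g1) - (ip (tb r0) (tb r0) + eps ^+ 2 * Gen g0)
   + 2 * tau * (1 - sigma) * (eps / 2 * Jen g1 + Gen g1) <= 2 * tau * (S + F).
Proof.
move=> e0 t0 s01 ts g02 g12 HS HF.
have pol (a b : U) : ip (tb (b - a)) (tb b) =
   2^-1 * (ip (tb b) (tb b) - ip (tb a) (tb a) + ip (tb (b - a)) (tb (b - a))).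
  rewrite !(linB (lin_ipUl xmin xmax _)) !(linB (lin_ipUr xmin xmax _)).
  by rewrite (ip_sym _ _ (tb b) (tb a)); field.
set d := r1 - r0 in HS.
have aB : a_h m xmin xmax fl g1 d = a_h m xmin xmax fl g1 r1 - a_h m xmin xmax fl g1 r0.
  rewrite !a_hE// /d /wfl (linB (lin_wform _ _ _ _))//; last exact: bcont_tb.
  by ring.
have := a_h_young fl d t0 g12; rewrite ler_norml => /andP[+ _].
rewrite aB => Ha.
pose De := avg (fun v => ip (tb (g1 v - g0 v)) (tb (g1 v - g0 v))).
have gd2 : UL2 m (fun v => g1 v - g0 v) by exact: UL2_B.
have Epol : avg (fun v => ip (tb (g1 v - g0 v)) (tb (g1 v))) = 2^-1 * (Gen g1 - Gen g0 + De).
  under eq_fun do rewrite pol.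
  rewrite avgZ; last by apply: vintD; [apply: vintB|]; apply: vint_ip.
  rewrite avgD ?avgB//; try exact: vint_ip.
  by apply: vintB; apply: vint_ip.
have Hadv : eps / 2 * Jen g1 - eps ^+ 2 / (2 * tau) * De
   - tau * (cvol / h ^+ 2 * Gen g1 + cjmp / h * Jen g1)
   <= eps * avg (fun v => adv v (g0 v) (g1 v)).
  rewrite -(avgZ _ (vint_adv _ _ g02 g12)) /Jen /Gen /De.
  have i1 := vint_jump_sq xmin xmax g12.
  have i2 := vint_ip xmin xmax gd2 gd2.
  have i3 := vint_ip xmin xmax g12 g12.
  rewrite -!(avgZ _ i1) -(avgZ _ i2) -(avgZ _ i3) -(avgD (vintZ _ i3) (vintZ _ i1)).
  rewrite -(avgB (vintZ _ i1) (vintZ _ i2)).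
  rewrite -(avgZ _ (vintD (vintZ _ i3) (vintZ _ i1))).
  rewrite -(avgB (vintB (vintZ _ i1) (vintZ _ i2)) (vintZ _ (vintD (vintZ _ i3) (vintZ _ i1)))).
  apply: avg_le.
  - apply: vintB; first exact: vintB (vintZ _ i1) (vintZ _ i2).
    exact: vintZ (vintD (vintZ _ i3) (vintZ _ i1)).
  - exact/vintZ/vint_adv.
  move=> v Ov; have := adv_lower (g0 v) (g1 v) Ov e0 t0.
  apply: le_trans; rewrite le_eqVlt; apply/orP; left; apply/eqP; ring.
have Hst := time_step_absorbs e0 t0 s01 ts (Gen_ge0 g1) (Jen_ge0 g1) (Jen_le g12).
rewrite pol -/d in HS; rewrite Epol in HF.
have Ha2 := ler_wpM2l (ltW t0) Ha; have Hadv2 := ler_wpM2l (ltW t0) Hadv.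
have Hst2 := ler_wpM2l (ltW t0) Hst.
have E1 : tau * - (ip (tb d) (tb d) / (2 * tau) + tau * (vsqr * cvol / h ^+ 2 * Gen g1 + vabs * cjmp / h * Jen g1))
  = - (ip (tb d) (tb d) / 2) - tau * (tau * (vsqr * (cvol / h ^+ 2 * Gen g1) + vabs * (cjmp / h * Jen g1))).
  by field; rewrite !gt_eqF.
have E2 : tau * (eps / 2 * Jen g1 - eps ^+ 2 / (2 * tau) * De - tau * (cvol / h ^+ 2 * Gen g1 + cjmp / h * Jen g1))
  = tau * (eps / 2 * Jen g1) - eps ^+ 2 / 2 * De - tau * (tau * (cvol / h ^+ 2 * Gen g1 + cjmp / h * Jen g1)).
  by field; rewrite !gt_eqF.
have E3 : tau * (tau * ((1 + vsqr) * cvol / h ^+ 2 * Gen g1 + (1 + vabs) * cjmp / h * Jen g1) +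
     (1 - sigma) * (Gen g1 + eps / 2 * Jen g1)) =
  tau * (tau * (cvol / h ^+ 2 * Gen g1 + cjmp / h * Jen g1)) + tau * (tau * (vsqr * (cvol / h ^+ 2 * Gen g1) + vabs * (cjmp / h * Jen g1)))
  + tau * (1 - sigma) * (eps / 2 * Jen g1 + Gen g1) by ring.
rewrite E1 in Ha2; rewrite E2 in Hadv2; rewrite E3 in Hst2.
move: HS HF Ha2 Hadv2 Hst2.
set X1 := tau * (tau * _); set X2 := tau * (tau * _).
set P := tau * (1 - sigma) * _.
have -> : 2 * tau * (1 - sigma) * (eps / 2 * Jen g1 + Gen g1) = 2 * P by rewrite /P; ring.
have -> : 2 * tau * (S + F) = 2 * (tau * S) + 2 * (tau * F) by ring.
set A1 := a_h _ _ _ _ _ _; set A0 := a_h _ _ _ _ _ _.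
set AD := avg _.
clearbody X1 X2 P A1 A0 AD.
lra.
Qed.

End Stability.

(** * Local and global projections *)

Definition hornerR := (hornerD, hornerN, hornerZ, hornerM, hornerX, hornerC, horner0).

Inductive projection_kind := ProjL2 | ProjLeft | ProjRight.

Section LocalProjection.
Variables (R : realType) (k : nat) (Cinv Chinv : R).
Hypotheses (Cinv0 : 0 < Cinv) (Chinv0 : 0 < Chinv)
  (inv : inverse_inequalities k Cinv Chinv).
Local Notation V := {poly_k.+1 R}.

(* [L^2] projection, or Gauss--Radau projection that interpolates at one end. *)
Definition is_projection (kd : projection_kind) (a b : R) (w : R -> R) (p : {poly R}) : Prop :=
  match kd with
  | ProjL2 => forall q : {poly R}, (size q <= k.+1)%N -> I a b (fun x => (p.[x] - w x) * q.[x]) = 0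
  | ProjLeft => p.[a] = w a /\
      forall q : {poly R}, (size q <= k)%N -> I a b (fun x => (p.[x] - w x) * q.[x]) = 0
  | ProjRight => p.[b] = w b /\
      forall q : {poly R}, (size q <= k)%N -> I a b (fun x => (p.[x] - w x) * q.[x]) = 0
  end.

Lemma is_projection_orth kd a b w p (q : {poly R}) : is_projection kd a b w p ->
  (size q <= k)%N -> I a b (fun x => (p.[x] - w x) * q.[x]) = 0.
Proof. by case: kd => [H sq|[_ H]|[_ H]]; apply: H => //; exact: leqW. Qed.

Lemma orth_lin (a b c : R) (u w : R -> R) (p p' q : {poly R}) :
  continuous u -> continuous w ->
  I a b (fun x => (p.[x] - u x) * q.[x]) = 0 ->
  I a b (fun x => (p'.[x] - w x) * q.[x]) = 0 ->
  I a b (fun x => ((c *: p + p').[x] - (c * u x + w x)) * q.[x]) = 0.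
Proof.
move=> cu cw H1 H2.
have cq := @cont_poly R q.
have -> : 0 = c * I a b (fun x => (p.[x] - u x) * q.[x]) + I a b (fun x => (p'.[x] - w x) * q.[x]).
  by rewrite H1 H2 mulr0 addr0.
rewrite -I_linear; last 2 first.
- by apply: contM => //; apply: contB => //; exact: cont_poly.
- by apply: contM => //; apply: contB => //; exact: cont_poly.
by apply: eq_I => x _; rewrite !hornerR; ring.
Qed.

Lemma is_projection_lin kd (a b c : R) (u w : R -> R) (p p' : {poly R}) : continuous u -> continuous w ->
  is_projection kd a b u p -> is_projection kd a b w p' ->
  is_projection kd a b (fun x => c * u x + w x) (c *: p + p').
Proof.
move=> cu cw; case: kd => /=.
- by move=> H1 H2 q sq; apply: orth_lin; [..|exact: H1|exact: H2].
- move=> [E1 H1] [E2 H2]; split; first by rewrite !hornerR E1 E2.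
  by move=> q sq; apply: orth_lin; [..|exact: H1|exact: H2].
- move=> [E1 H1] [E2 H2]; split; first by rewrite !hornerR E1 E2.
  by move=> q sq; apply: orth_lin; [..|exact: H1|exact: H2].
Qed.

Lemma is_projection_poly kd a b (t : {poly R}) : is_projection kd a b (fun x => t.[x]) t.
Proof.
have Z (q : {poly R}) : I a b (fun x => (t.[x] - t.[x]) * q.[x]) = 0.
  rewrite (@eq_I _ _ _ _ (fun=> 0)); first by rewrite Rintegral_cst// mul0r.
  by move=> x _; rewrite subrr mul0r.
by case: kd; [move=> q _|split=> // q _..].
Qed.

(** The factor [2 * Cinv] comes from [poly_sup]; the other one is the $L^2$ stability constant of
    the Gauss--Radau projections found in [projection_sup]. *)
Definition Kproj : R := 2 * Cinv * (2 + 8 * (Chinv + k%:R ^+ 2)).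

Lemma Kproj_gt0 : 0 < Kproj.
Proof.
by rewrite /Kproj !mulr_gt0// addr_gt0// mulr_gt0// ltr_pwDl// sqr_ge0.
Qed.

(** The Euler operator multiplies $(x-c)^j$ by $j$; subtracting [k] removes the term of degree [k].
    The result is an admissible test polynomial for the Gauss--Radau conditions. *)
Lemma size_euler_operator (c : R) (p : {poly R}) : (size p <= k.+1)%N ->
  (size (('X - c%:P) * deriv p - k%:R *: p)%R <= k)%N.
Proof.
move=> sp; apply/leq_sizeP => j kj.
have pj i : (k < i)%N -> p`_i = 0 by move=> ki; apply: nth_default; apply: leq_trans sp ki.
rewrite coefB coefZ mulrBl coefB coefXM coefCM !coef_deriv.
rewrite (pj j.+1) ?ltnS// mul0rn mulr0 subr0.
move: kj; rewrite leq_eqVlt => /predU1P[<-|kj].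
  case: (k) => [|n] /=; first by rewrite mul0r subrr.
  by rewrite -[X in X - _]mulr_natl subrr.
rewrite (pj j kj) mulr0 subr0; case: j kj => // j kj /=.
by rewrite (pj j.+1 kj) mul0rn.
Qed.

(** Integrate the derivative of $\frac12(x-c')p^2$: the factor vanishes at the free end [c'], so
    only the interpolated end [c] contributes. The negative multiple of $\int p^2$ is what later
    bounds [p]. *)
Lemma radau_I (a b c c' : R) (p : {poly R}) : a < b -> (c = b /\ c' = a) \/ (c = a /\ c' = b) ->
  I a b (fun x => p.[x] * (('X - c'%:P) * deriv p - k%:R *: p).[x]) =
  2^-1 * (b - a) * p.[c] ^+ 2 - (2^-1 + k%:R) * I a b (fun x => p.[x] ^+ 2).
Proof.
move=> ab cc.
pose F := 2^-1 *: (('X - c'%:P) * (p * p)).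
have cF : continuous (fun x => (deriv F).[x]) by exact: cont_poly.
have := I_FTC (ltW ab) cF (is_derive_horner_fun F).
have cp := contX2 (@cont_poly R p).
have -> : I a b (fun x => (deriv F).[x]) =
  I a b (fun x => (2^-1 + k%:R) * p.[x] ^+ 2 + p.[x] * (('X - c'%:P) * deriv p - k%:R *: p).[x]).
  apply: eq_I => x _; rewrite /F derivZ !derivM derivXsubC !hornerR.
  by field.
rewrite I_linear//; last by apply: contM; exact: cont_poly.
rewrite /F !hornerR.
by case: cc => -[-> ->] H; lra.
Qed.

(** The $L^2$ projection is tested with [p] itself, the Gauss--Radau projections with the Euler
    operator applied to [p]. The resulting bound on $\int p^2$ becomes pointwise by [poly_sup]. The
    inverse inequalities hold on every interval, so no reference cell is needed. *)
Lemma projection_sup kd (a b e : R) (w : R -> R) (p : {poly R}) (x : R) : a < b ->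
  continuous w -> (size p <= k.+1)%N -> is_projection kd a b w p ->
  (forall y, a <= y <= b -> `|w y| <= e) -> a <= x <= b -> p.[x] ^+ 2 <= Kproj * e ^+ 2.
Proof.
move=> ab cw sp pw we xab.
have ba : 0 < b - a by rewrite subr_gt0.
have e0 : 0 <= e by apply: le_trans (we x xab).
have cp := @cont_poly R p; have cp2 := contX2 cp; have cw2 := contX2 cw.
set P := I a b (fun x => p.[x] ^+ 2).
have P0 : 0 <= P by apply: I_ge0 => y _; exact: sqr_ge0.
have W2 : I a b (fun x => w x ^+ 2) <= (b - a) * e ^+ 2.
  rewrite mulrC -(I_cst _ (ltW ab)); apply: I_le => //; first exact: cont_cst.
  by move=> y yab; rewrite -[w y ^+ 2]real_normK ?num_real// lerXn2r ?nnegrE// we.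
have kC : 0 < Chinv + k%:R ^+ 2 by rewrite ltr_pwDl// sqr_ge0.
suff HP : P <= (2 + 8 * (Chinv + k%:R ^+ 2)) * ((b - a) * e ^+ 2).
  have := poly_sup Cinv0 inv sp ab xab; rewrite -/P => H.
  rewrite -(ler_pM2r ba); apply: le_trans H _.
  have -> : Kproj * e ^+ 2 * (b - a) = 2 * Cinv * ((2 + 8 * (Chinv + k%:R ^+ 2)) * ((b - a) * e ^+ 2)).
    by rewrite /Kproj; ring.
  by rewrite ler_wpM2l// mulr_ge0// ltW.
have he0 : 0 <= (b - a) * e ^+ 2 by rewrite mulr_ge0 ?sqr_ge0// ltW.
have wq (q : {poly R}) th : 0 < th -> I a b (fun x => (p.[x] - w x) * q.[x]) = 0 ->
    `|I a b (fun x => p.[x] * q.[x])| <= th / 2 * ((b - a) * e ^+ 2) + (2 * th)^-1 * I a b (fun x => q.[x] ^+ 2).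
  move=> th0 H.
  have cq := @cont_poly R q; have cq2 := contX2 cq.
  have -> : I a b (fun x => p.[x] * q.[x]) = I a b (fun x => w x * q.[x]).
    apply/eqP; rewrite -subr_eq0 -mulN1r addrC -I_linear; [|exact: contM..].
    by rewrite -H; apply/eqP; apply: eq_I => y _; ring.
  apply: (@le_trans _ _ (th / 2 * I a b (fun x => w x ^+ 2) + (2 * th)^-1 * I a b (fun x => q.[x] ^+ 2))); last first.
    by rewrite lerD2r ler_wpM2l// divr_ge0// ltW.
  rewrite -!I_Z// -I_D; [|exact: contZ..].
  apply: I_abs; [exact: contM|by apply: contD; exact: contZ|].
  move=> y _; rewrite normrM -[w y ^+ 2]real_normK ?num_real// -[q.[y] ^+ 2]real_normK ?num_real//.
  exact: young.
have radau (c c' : R) : (c = b /\ c' = a) \/ (c = a /\ c' = b) -> p.[c] = w c ->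
  (forall q : {poly R}, (size q <= k)%N -> I a b (fun x => (p.[x] - w x) * q.[x]) = 0) ->
  P <= (2 + 8 * (Chinv + k%:R ^+ 2)) * ((b - a) * e ^+ 2).
  move=> cc pc H.
  set q := ('X - c'%:P) * deriv p - k%:R *: p.
  have := H q (size_euler_operator c' sp); have := radau_I p ab cc; rewrite -/q -/P.
  (* With this weight the square of the test polynomial costs at most [P / 4], less than the
     coefficient $\frac12+k$ of [P] in [radau_I]. *)
  move=> E; have th0 : 0 < 4 * (Chinv + k%:R ^+ 2) by rewrite mulr_gt0.
  move=> /(wq q _ th0); rewrite E ler_norml => /andP[Hq _].
  have cd := @cont_poly R (deriv p); have cd2 := contX2 cd.
  have Q2 : I a b (fun x => q.[x] ^+ 2) <= 2 * (Chinv + k%:R ^+ 2) * P.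
    have [_ _ Hd] := inv (NPoly (sp : p \is a poly_of_size k.+1)) ab.
    rewrite /= -/P in Hd.
    apply: (@le_trans _ _ (2 * ((b - a) ^+ 2 * I a b (fun x => (deriv p).[x] ^+ 2)) + 2 * k%:R ^+ 2 * P)); last first.
      have : 2 * ((b - a) ^+ 2 * I a b (fun x => (deriv p).[x] ^+ 2)) <= 2 * (Chinv * P).
        by rewrite ler_wpM2l.
      by lra.
    rewrite mulrA -!I_Z// -I_D; [|exact: contZ..].
    apply: I_le; [exact/contX2/cont_poly|by apply: contD; exact: contZ|].
    move=> y yab; rewrite /q !hornerR.
    have yc : (y - c') ^+ 2 <= (b - a) ^+ 2.
      by case: cc => -[_ ->]; move: yab => /andP[ay yb]; nra.
    set dp := (deriv p).[y]; have := ler_wpM2r (sqr_ge0 dp) yc.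
    by have := sqr_ge0 ((y - c') * dp + k%:R * p.[y]); nra.
  have pc2 : p.[c] ^+ 2 <= e ^+ 2.
    rewrite pc -[w c ^+ 2]real_normK ?num_real// lerXn2r ?nnegrE// we//.
    by case: cc => -[-> _]; rewrite lexx ltW.
  have Q3 := ler_wpM2l (_ : 0 <= (2 * (4 * (Chinv + k%:R ^+ 2)))^-1) Q2.
  have {}Q3 := Q3 (ltW _); rewrite invr_gt0 mulr_gt0// in Q3.
  have {}Q3 := Q3 isT.
  have Q4 : (2 * (4 * (Chinv + k%:R ^+ 2)))^-1 * (2 * (Chinv + k%:R ^+ 2) * P) = P / 4.
    by field; rewrite gt_eqF.
  rewrite Q4 in Q3.
  have pcb : (b - a) * p.[c] ^+ 2 <= (b - a) * e ^+ 2 by rewrite ler_wpM2l// ltW.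
  have k0 : 0 <= k%:R * P by rewrite mulr_ge0.
  by move: Hq pcb Q3; set Q := _^-1 * _; clearbody Q P; nra.
case: kd pw => /=.
- move=> H; have := wq p _ ltr01 (H p sp).
  have -> : I a b (fun x => p.[x] * p.[x]) = P by apply: eq_I => y _.
  rewrite ger0_norm// -/P => H2.
  apply: (@le_trans _ _ ((b - a) * e ^+ 2)); first by lra.
  by rewrite ler_peMl//; lra.
- by move=> [E H]; apply: (radau a b) => //; right.
- by move=> [E H]; apply: (radau b a) => //; left.
Qed.

Lemma projection_unique kd (a b : R) (w : R -> R) (p p' : V) : a < b -> continuous w ->
  is_projection kd a b w p -> is_projection kd a b w p' -> p = p'.
Proof.
move=> ab cw H1 H2; have H := is_projection_lin (-1) cw cw H1 H2.
apply/esym/eqP; rewrite -subr_eq0; apply/eqP; apply: (npoly_eq0 ab) => x xab.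
have cz : continuous (fun x => -1 * w x + w x) by apply: contD => //; exact: contZ.
have sz : (size (-1 *: (p : {poly R}) + (p' : {poly R}))%R <= k.+1)%N.
  have -> : -1 *: (p : {poly R}) + (p' : {poly R}) = (-1 *: p + p' : V) by [].
  exact: size_npoly.
have := @projection_sup kd a b 0 _ _ x ab cz sz H _ xab.
rewrite expr0n mulr0 => H3; apply/eqP; rewrite -sqrf_eq0 eq_le sqr_ge0 andbT.
have -> : (p' - p : V) = (-1 *: (p : {poly R}) + (p' : {poly R})) :> {poly R} by rewrite scaleN1r addrC.
by apply: H3 => y _; rewrite mulN1r addNr normr0.
Qed.

Lemma projection_exists kd (a b : R) (w : R -> R) : a < b -> continuous w ->
  exists p : V, is_projection kd a b w p.
Proof.
move=> ab cw.
(* One test polynomial carries both kinds of conditions: its part below degree [k] tests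
   orthogonality and its coefficient of degree [k] multiplies the value at the end point. The
   conditions become a bilinear form on polynomials of degree at most [k], nondegenerate by
   uniqueness. *)
pose tr (q : {poly R}) : {poly R} := q - q`_k *: 'X^k.
have tr_lin c (q q' : {poly R}) x : (tr (c *: q + q')).[x] = c * (tr q).[x] + (tr q').[x].
  by rewrite /tr coefD coefZ !hornerR; ring.
pose form (u : R -> R) (q : {poly R}) : R := match kd with
  | ProjL2 => I a b (fun x => u x * q.[x])
  | ProjLeft => I a b (fun x => u x * (tr q).[x]) + q`_k * u a
  | ProjRight => I a b (fun x => u x * (tr q).[x]) + q`_k * u b end.
have form_r (u : R -> R) : continuous u -> lin (fun q : V => form u q).
  move=> cu c q q'; rewrite /form.
  have E1 : I a b (fun x => u x * (c *: (q : {poly R}) + q').[x]) = c * I a b (fun x => u x * (q : {poly R}).[x]) + I a b (fun x => u x * (q' : {poly R}).[x]).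
    rewrite -I_linear; [|by apply: contM => //; exact: cont_poly..].
    by apply: eq_I => x _; rewrite !hornerR; ring.
  have E2 : I a b (fun x => u x * (tr (c *: (q : {poly R}) + q')).[x]) = c * I a b (fun x => u x * (tr q).[x]) + I a b (fun x => u x * (tr q').[x]).
    rewrite -I_linear; [|by apply: contM => //; exact: cont_poly..].
    by apply: eq_I => x _; rewrite tr_lin; ring.
  by case: (kd) => //=; rewrite ?E1 ?E2 ?coefD ?coefZ//; ring.
have form_l (u u' : R -> R) (c : R) (q : {poly R}) : continuous u -> continuous u' ->
    form (fun x => c * u x + u' x) q = c * form u q + form u' q.
  move=> cu cu'; rewrite /form.
  have E (r : {poly R}) : I a b (fun x => (c * u x + u' x) * r.[x]) = c * I a b (fun x => u x * r.[x]) + I a b (fun x => u' x * r.[x]).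
    rewrite -I_linear; [|by apply: contM => //; exact: cont_poly..].
    by apply: eq_I => x _; ring.
  by case: (kd); rewrite /= ?E; ring.
have spec (u : R -> R) (p : {poly R}) : continuous u ->
    (forall q : V, form (fun x => p.[x]) q = form u q) -> is_projection kd a b u p.
  move=> cu H.
  have dif (r : {poly R}) : I a b (fun x => (p.[x] - u x) * r.[x]) =
      I a b (fun x => p.[x] * r.[x]) - I a b (fun x => u x * r.[x]).
    rewrite -mulN1r addrC -I_linear; [|by apply: contM => //; exact: cont_poly..].
    by apply: eq_I => x _; ring.
  have trs (r : {poly R}) : (size r <= k)%N -> tr r = r.
    by move=> sr; rewrite /tr nth_default// scale0r subr0.
  have Hq (q : {poly R}) : (size q <= k.+1)%N -> form (fun x => p.[x]) q = form u q.
    by move=> sq; exact: (H (NPoly (sq : q \is a poly_of_size k.+1))).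
  have HX := Hq 'X^k; rewrite size_polyXn leqnn in HX; have {}HX := HX isT.
  have trX : tr 'X^k = 0 by rewrite /tr coefXn eqxx scale1r subrr.
  have I0 (v : R -> R) : I a b (fun x => v x * (0 : {poly R}).[x]) = 0.
    rewrite (@eq_I _ _ _ _ (fun=> 0)); first by rewrite Rintegral_cst// mul0r.
    by move=> x _; rewrite horner0 mulr0.
  move: Hq HX; rewrite /form /is_projection; case: (kd) => Hq HX.
  - by move=> q sq; rewrite dif (Hq q sq) subrr.
  - rewrite trX !I0 coefXn eqxx !mul1r !add0r in HX; split=> // q sq.
    have := Hq q (leqW sq); rewrite trs// nth_default// !mul0r !addr0 => E.
    by rewrite dif E subrr.
  - rewrite trX !I0 coefXn eqxx !mul1r !add0r in HX; split=> // q sq.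
    have := Hq q (leqW sq); rewrite trs// nth_default// !mul0r !addr0 => E.
    by rewrite dif E subrr.
have [] := @nondegenerate_represents R V (fun p q => form (fun x => (p : {poly R}).[x]) q) _ _ _ (fun q => form w q) (form_r w cw).
- move=> q c p p'; rewrite -form_l; [|exact: cont_poly..].
  by congr (form _ _); apply/funext => x; rewrite !hornerR.
- by move=> p; apply: form_r; exact: cont_poly.
- move=> p Hp; have c0 : continuous ((fun=> 0) : R -> R) by exact: cont_cst.
  have pj : is_projection kd a b (fun=> 0) p.
    apply: spec => // q; rewrite (Hp q).
    have E := form_l (fun=> 0) (fun=> 0) 1 q c0 c0.
    have Ef : (fun _ : R => 1 * (0 : R) + 0) = (fun=> 0) by apply/funext => x; rewrite mulr0 addr0.
    by rewrite Ef mul1r in E; lra.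
  have pz : is_projection kd a b (fun=> 0) (0 : V).
    have := is_projection_poly kd a b (0 : V).
    by congr (is_projection _ _ _ _ _); apply/funext => x; rewrite horner0.
  exact: projection_unique ab c0 pj pz.
- by move=> p Hp; exists p; apply: spec.
Qed.

Definition proj kd a b (w : R -> R) : V := xget 0 [set p : V | is_projection kd a b w p].

Lemma projP kd (a b : R) (w : R -> R) : a < b -> continuous w -> is_projection kd a b w (proj kd a b w).
Proof.
move=> ab cw; rewrite /proj; case: xgetP => [p -> //|H].
by have [p /H] := projection_exists kd ab cw.
Qed.

Lemma proj_lin kd (a b c : R) (u w : R -> R) : a < b -> continuous u -> continuous w ->
  proj kd a b (fun x => c * u x + w x) = c *: proj kd a b u + proj kd a b w.
Proof.
move=> ab cu cw.
have cc : continuous (fun x => c * u x + w x) by apply: contD => //; exact: contZ.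
apply: (projection_unique ab cc); first exact: projP.
by apply: is_projection_lin => //; exact: projP.
Qed.

Lemma proj_poly kd a b (t : V) : a < b -> proj kd a b (fun x => (t : {poly R}).[x]) = t.
Proof.
move=> ab; have ct := @cont_poly R t.
by apply: (projection_unique ab ct); [exact: projP|exact: is_projection_poly].
Qed.

(** Polynomials are reproduced, so the error of [w] is the error of [w - t], and stability bounds
    the projection of that difference. *)
Lemma projection_error_le kd (a b e : R) (w : R -> R) (t : {poly R}) (x : R) : a < b -> continuous w ->
  (size t <= k.+1)%N -> (forall y, a <= y <= b -> `|w y - t.[y]| <= e) -> a <= x <= b ->
  (w x - (proj kd a b w : {poly R}).[x]) ^+ 2 <= 2 * (1 + Kproj) * e ^+ 2.
Proof.
move=> ab cw st we xab.
pose tt : V := NPoly (st : t \is a poly_of_size k.+1).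
have ct := @cont_poly R t.
have cr : continuous (fun x => -1 * t.[x] + w x) by apply: contD => //; exact: contZ.
have := proj_lin kd (-1) ab ct cw; rewrite (proj_poly kd tt ab) => E.
have H := projP kd ab cr.
have re y : a <= y <= b -> `|-1 * t.[y] + w y| <= e by move=> /we; rewrite mulN1r addrC.
have := projection_sup ab cr (size_npoly _) H re xab.
rewrite E /= !hornerR; rewrite -/(t.[x]); set q := (proj kd a b w : {poly R}).[x]; set tx := t.[x] => H1.
have := re x xab; rewrite -/tx => H2.
have H3 : (-1 * tx + w x) ^+ 2 <= e ^+ 2.
  rewrite -[leLHS]real_normK ?num_real// lerXn2r ?nnegrE//.
  by apply: le_trans H2.
have := sqr_ge0 ((w x - tx) + (q - tx)); nra.
Qed.

Lemma poly_antiderivative (p : {poly R}) (a c : R) n : (size p <= n)%N ->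
  exists P : {poly R}, [/\ deriv P = p, P.[a] = c & (size P <= n.+1)%N].
Proof.
move=> sp; pose Q := \poly_(i < n.+1) (p`_i.-1 / i%:R).
exists (Q + (c - Q.[a])%:P); split.
- rewrite derivD derivC addr0; apply/polyP => i; rewrite coef_deriv coef_poly.
  case: ltnP => ni; last by rewrite mul0rn nth_default// (leq_trans sp).
  by rewrite -[LHS]mulr_natr divfK// pnatr_eq0.
- by rewrite !hornerR; ring.
- rewrite (leq_trans (size_polyD _ _))// geq_max size_poly/=.
  by apply: leq_trans (size_polyC_leq1 _) _.
Qed.

(** Induction on the order: antidifferentiate the polynomial found for the derivative and apply
    Cauchy--Schwarz. The bound is pointwise, yet only the $L^2$ norm of the highest derivative on
    the same interval enters, so it can be summed over the cells and also controls traces. *)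
Lemma taylor_approximation (a b : R) n (D : nat -> R -> R) : a < b ->
  (forall j, (j <= n)%N -> forall x, is_derive x (1 : R) (D j) (D j.+1 x)) ->
  continuous (D n.+1) ->
  exists2 t : {poly R}, (size t <= n.+1)%N &
    forall x, a <= x <= b ->
      (D 0%N x - t.[x]) ^+ 2 <= (b - a) ^+ (2 * n + 1) * I a b (fun x => D n.+1 x ^+ 2).
Proof.
move=> ab; have ba : 0 < b - a by rewrite subr_gt0.
elim: n D => [|n IH] D dD cD.
  exists (D 0%N a)%:P; first exact: size_polyC_leq1.
  move=> x xab; have /andP[ax xb] := xab; rewrite hornerC.
  rewrite -(I_FTC ax cD (dD 0%N isT)) expr1.
  apply: le_trans (I_CS ax cD) _.
  have c2 := contX2 cD.
  have i0 : 0 <= I a x (fun x => D 1%N x ^+ 2) by apply: I_ge0 => y _; exact: sqr_ge0.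
  have i1 : 0 <= I x b (fun x => D 1%N x ^+ 2) by apply: I_ge0 => y _; exact: sqr_ge0.
  rewrite (I_split c2 xab); apply: ler_pM => //; last by rewrite lerDl.
    by rewrite subr_ge0.
  by rewrite lerD2r.
have [|t st Ht] := IH (fun j => D j.+1) _ cD; first by move=> j jn; apply: dD.
have [P [dP Pa sP]] := poly_antiderivative a (D 0%N a) st.
exists P => // x xab; have /andP[ax xb] := xab.
move: Ht; set E := (b - a) ^+ (2 * n + 1) * _ => Ht.
have E0 : 0 <= E by apply: le_trans (sqr_ge0 _) (Ht a _); rewrite lexx ltW.
have cd1 : continuous (D 1%N).
  move=> y; apply: differentiable_continuous; apply/derivable1_diffP.
  exact: (@ex_derive _ _ _ _ _ _ _ (dD 1%N isT y)).
have cdt : continuous (fun x => D 1%N x - t.[x]) by apply: contB => //; exact: cont_poly.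
have -> : D 0%N x - P.[x] = I a x (fun x => D 1%N x - t.[x]).
  have dd y : is_derive y (1 : R) (fun x => D 0%N x - P.[x]) (D 1%N y - t.[y]).
    have H1 := dD 0%N isT y; have H2 := is_derive_horner_fun P y.
    by rewrite dP in H2; exact: is_deriveB.
  by rewrite (I_FTC ax cdt dd) Pa subrr subr0.
apply: le_trans (I_CS ax cdt) _.
have H1 : I a x (fun x => (D 1%N x - t.[x]) ^+ 2) <= E * (x - a).
  rewrite -I_cst//; apply: I_le; [exact: contX2|exact: cont_cst|].
  by move=> y /andP[ay yx]; apply: Ht; rewrite ay (le_trans yx).
apply: le_trans (ler_wpM2l _ H1) _; first by rewrite subr_ge0.
have -> : (2 * n.+1 + 1)%N = (2 * n + 1).+2 by rewrite mulnS add2n !addSn.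
rewrite !exprS -mulrA -mulrA -/E.
have xa : 0 <= x - a by rewrite subr_ge0.
have xab' : x - a <= b - a by rewrite lerD2r.
have := mulr_ge0 xa xa; have : (x - a) * (x - a) <= (b - a) * (b - a) by apply: ler_pM.
by move: (E) E0 => E' E0 H2 H3; have := ler_wpM2r E0 H2; lra.
Qed.

Lemma projection_approximation kd (a b : R) (D : nat -> R -> R) x : a < b ->
  (forall j, (j <= k)%N -> forall x, is_derive x (1 : R) (D j) (D j.+1 x)) ->
  continuous (D k.+1) -> a <= x <= b ->
  (D 0%N x - (proj kd a b (D 0%N) : {poly R}).[x]) ^+ 2 <=
    2 * (1 + Kproj) * ((b - a) ^+ (2 * k + 1) * I a b (fun x => D k.+1 x ^+ 2)).
Proof.
move=> ab dD cD xab.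
have [t st Ht] := taylor_approximation ab dD cD.
move: Ht; set E := (b - a) ^+ _ * I a b (fun x => D k.+1 x ^+ 2) => Ht.
have E0 : 0 <= E by apply: le_trans (sqr_ge0 _) (Ht x xab).
have c0 : continuous (D 0%N).
  move=> y; apply: differentiable_continuous; apply/derivable1_diffP.
  exact: (@ex_derive _ _ _ _ _ _ _ (dD 0%N isT y)).
rewrite -[E]sqr_sqrtr//; apply: (projection_error_le kd ab c0 st) => // y yab.
by rewrite -sqrtr_sqr ler_wsqrtr// Ht.
Qed.

End LocalProjection.

(** * Cellwise projections on the mesh and their errors *)

Section GlobalProjection.
Variables (R : realType) (xmin xmax : R) (k N : nat) (Cinv Chinv : R).
Hypotheses (xab : xmin < xmax) (N0 : (0 < N)%N)
  (Cinv0 : 0 < Cinv) (Chinv0 : 0 < Chinv)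
  (inv : inverse_inequalities k Cinv Chinv).
Local Notation U := (Uh R k N).
Local Notation B := (broken R N).
Local Notation h := (mesh_size xmin xmax N).
Local Notation node := (node xmin xmax N).
Local Notation ip := (@ip R xmin xmax N).
Local Notation tb := (@to_broken R k N).
Local Notation trl := (@trace_l R xmin xmax N).
Local Notation trr := (@trace_r R xmin xmax N).
Local Notation fvg := (@flux_vg R xmin xmax N).
Local Notation wfl := (@wfl R xmin xmax k N).
Implicit Types (w u : R -> R) (kd : projection_kind).

Definition projU kd w : U := [ffun i : 'I_N => proj k kd (node i) (node i.+1) w].

Definition perr kd w : B := fun i x => w x - tb (projU kd w) i x.

Lemma tb_projU kd w i x : tb (projU kd w) i x = (proj k kd (node i) (node i.+1) w : {poly R}).[x].
Proof. by rewrite /to_broken /poly_at ffunE. Qed.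

Lemma projU_lin kd (c : R) u w : continuous u -> continuous w ->
  projU kd (fun x => c * u x + w x) = c *: projU kd u + projU kd w.
Proof.
move=> cu cw; apply/ffunP => i; rewrite !ffunE/=.
by apply: (proj_lin Cinv0 Chinv0 inv) => //; exact: node_lt.
Qed.

Lemma perr_lin kd (c : R) u w : continuous u -> continuous w ->
  perr kd (fun x => c * u x + w x) = (fun i x => c * perr kd u i x + perr kd w i x).
Proof.
move=> cu cw; apply/funext => i; apply/funext => x.
by rewrite /perr projU_lin// tb_lin; ring.
Qed.

Lemma bcont_perr kd w : continuous w -> bcont (perr kd w).
Proof. by move=> cw i; apply: contB => //; exact: bcont_tb. Qed.

Definition Kerr : R := 2 * (1 + Kproj k Cinv Chinv).

Lemma Kerr_ge1 : 1 <= Kerr.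
Proof. by have := Kproj_gt0 k Cinv0 Chinv0; rewrite /Kerr; lra. Qed.

Lemma perr_sup kd w (e : R) (i : 'I_N) x : continuous w ->
  (forall y, xmin <= y <= xmax -> `|w y| <= e) ->
  node i <= x <= node i.+1 -> `|perr kd w i x| <= Kerr * e.
Proof.
move=> cw we xi.
have e0 : 0 <= e by apply: le_trans (we x (cell_sub xab N0 xi)).
have H : perr kd w i x ^+ 2 <= Kerr * e ^+ 2.
  rewrite /perr tb_projU.
  apply: (@projection_error_le R k Cinv Chinv Cinv0 Chinv0 inv kd _ _ e w 0 x (node_lt xab N0 i) cw) => //.
    by rewrite size_poly0.
  by move=> y yi; rewrite horner0 subr0; apply/we/(cell_sub xab N0 yi).
have K1 := Kerr_ge1.
rewrite -(@ler_pXn2r _ 2)// ?nnegrE//; last by rewrite mulr_ge0//; lra.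
rewrite real_normK ?num_real//; apply: le_trans H _; rewrite exprMn.
by rewrite ler_wpM2r ?sqr_ge0// expr2 ler_peMl//; lra.
Qed.

(** The derivative of [psi] has degree below [k] on each cell, and all three projections are
    orthogonal to such polynomials. Hence the weak forms see the projection error only through the
    fluxes. *)
Lemma perr_orth kd w (psi : U) : continuous w -> ip (perr kd w) (bder psi) = 0.
Proof.
move=> cw; rewrite /ip big1// => i _.
have H := projP Cinv0 Chinv0 inv kd (node_lt xab N0 i) cw.
have := is_projection_orth (q := deriv (poly_at psi i)) H.
have sz : (size (deriv (poly_at psi i)) <= k)%N.
  have := size_npoly (psi i); case: (eqVneq (poly_at psi i) 0) => [->|nz]; first by rewrite linear0 size_poly0.
  by move=> /(leq_trans (lt_size_deriv nz)).
move=> /(_ sz) E; rewrite -[RHS]oppr0 -E -mulN1r -I_Z; last first.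
  by apply: contM; [apply: contB => //|]; exact: cont_poly.
by apply: eq_I => x _; rewrite /perr tb_projU /bder; ring.
Qed.

Lemma perr_L2_orth w (psi : U) : continuous w -> ip (perr ProjL2 w) (tb psi) = 0.
Proof.
move=> cw; rewrite /ip big1// => i _.
have /= H := projP Cinv0 Chinv0 inv ProjL2 (node_lt xab N0 i) cw.
have E := H _ (size_npoly (psi i)).
rewrite -[RHS]oppr0 -E -mulN1r -I_Z; last first.
  by apply: contM; [apply: contB => //|]; exact: cont_poly.
by apply: eq_I => x _; rewrite /perr tb_projU /to_broken /poly_at; ring.
Qed.

(** The discrete space has no continuity between cells, so the global $L^2$ projection, defined by
    choice of a representative, is the cellwise one. *)
Lemma pi_h_projU w : continuous w -> pi_h xmin xmax k N w = projU ProjL2 w.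
Proof.
move=> cw; apply: (ip_inj xab N0 Cinv0 inv) => psi.
rewrite /pi_h (rieszP xab N0 Cinv0 inv); last by apply: lin_ip => i.
apply/eqP; rewrite -subr_eq0 -(perr_L2_orth psi cw).
have := ip_lin xmin xmax (-1) (@bcont_tb R k N (projU ProjL2 w)) (fun i : 'I_N => cw) (@bcont_tb R k N psi).
rewrite mulN1r addrC => <-; apply/eqP; apply: eq_ip => // i x _.
by rewrite /perr; ring.
Qed.

Lemma projU_trl w i : continuous w -> trl (perr ProjRight w) i = 0.
Proof.
move=> cw; have /= [H _] := projP Cinv0 Chinv0 inv ProjRight (node_lt xab N0 (ord_pred i)) cw.
by rewrite /trace_l /perr tb_projU H subrr.
Qed.

Lemma projU_trr w i : continuous w -> trr (perr ProjLeft w) i = 0.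
Proof.
move=> cw; have /= [H _] := projP Cinv0 Chinv0 inv ProjLeft (node_lt xab N0 i) cw.
by rewrite /trace_r /perr tb_projU H subrr.
Qed.

(** The left trace at a node is the value at the right end of the preceding cell; this is why a left
    flux goes with interpolation at the right end. *)
Definition flux_kind (fl : flux) : projection_kind :=
  match fl with LeftRight => ProjRight | RightLeft => ProjLeft | Central => ProjL2 end.

Lemma wfl_perr fl w psi : continuous w ->
  wfl fl (perr (flux_kind fl) w) psi =
  \sum_i fvg fl (perr (flux_kind fl) w) i * jump xmin xmax (tb psi) i.
Proof. by move=> cw; rewrite /wfl weak_formE perr_orth// add0r. Qed.

Lemma wfl_perr_alternating fl w psi : continuous w -> alternating fl ->
  wfl fl (perr (flux_kind fl) w) psi = 0.
Proof.
move=> cw al; rewrite wfl_perr// big1// => i _.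
by case: fl al => //= _; rewrite ?projU_trl ?projU_trr// mul0r.
Qed.

Lemma sum_cells w : continuous w ->
  \sum_(i < N) I (node i) (node i.+1) w = I xmin xmax w.
Proof.
move=> cw; suff H n : \sum_(i < n) I (node i) (node i.+1) w = I (node 0) (node n) w.
  by rewrite H node0 nodeN.
elim: n => [|n IH]; first by rewrite big_ord0 set_itv1 Rintegral_set1.
rewrite big_ord_recr/= IH -I_split//.
by rewrite (node_le xab N0) ?ltW ?node_lt.
Qed.

Section Approximation.
Variables (D : nat -> R -> R).
Hypotheses (dD : forall j, (j <= k)%N -> forall x : R, is_derive x (1 : R) (D j) (D j.+1 x))
  (cD : continuous (D k.+1)).
Local Notation w := (D 0%N).

Definition seminorm2 : R := I xmin xmax (fun x => D k.+1 x ^+ 2).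

Let cell2 (i : 'I_N) : R := I (node i) (node i.+1) (fun x => D k.+1 x ^+ 2).

Let cell2_ge0 i : 0 <= cell2 i.
Proof. by apply: I_ge0 => x _; exact: sqr_ge0. Qed.

Let sum_cell2 : \sum_i cell2 i = seminorm2.
Proof. by rewrite sum_cells//; exact: contX2. Qed.

Let cw : continuous w.
Proof.
move=> y; apply: differentiable_continuous; apply/derivable1_diffP.
exact: (@ex_derive _ _ _ _ _ _ _ (dD (leq0n k) y)).
Qed.

Lemma perr_cell kd (i : 'I_N) x : node i <= x <= node i.+1 ->
  perr kd w i x ^+ 2 <= Kerr * (h ^+ (2 * k + 1) * cell2 i).
Proof.
move=> xi; rewrite /perr tb_projU -(nodeS xmin xmax N i).
exact: (projection_approximation Cinv0 Chinv0 inv kd (node_lt xab N0 i) dD cD xi).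
Qed.

Lemma perr_norm kd : ip (perr kd w) (perr kd w) <= Kerr * (h ^+ (2 * k + 2) * seminorm2).
Proof.
rewrite -sum_cell2 !mulr_sumr; apply: ler_sum => i _; rewrite /cell.
have cp : bcont (perr kd w) by exact: bcont_perr.
apply: (@le_trans _ _ (I (node i) (node i.+1) (fun=> Kerr * (h ^+ (2 * k + 1) * cell2 i)))).
  apply: I_le; [exact: contM|exact: cont_cst|].
  by move=> x xi; rewrite -expr2 perr_cell.
rewrite I_cst; last exact/ltW/node_lt.
have -> : (2 * k + 2 = (2 * k + 1).+1)%N by rewrite addnS.
by rewrite nodeS exprS le_eqVlt; apply/orP; left; apply/eqP; ring.
Qed.

(** The cell estimate is already pointwise, so no trace inequality is spent; without the integration
    over the cell one power of [h] is missing. *)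
Lemma perr_trl kd : \sum_i trl (perr kd w) i ^+ 2 <= Kerr * (h ^+ (2 * k + 1) * seminorm2).
Proof.
rewrite (sum_ord_pred (fun i => perr kd w i (node i.+1) ^+ 2)).
rewrite -sum_cell2 !mulr_sumr; apply: ler_sum => i _.
by apply: perr_cell; rewrite lexx ltW// node_lt.
Qed.

Lemma perr_trr kd : \sum_i trr (perr kd w) i ^+ 2 <= Kerr * (h ^+ (2 * k + 1) * seminorm2).
Proof.
rewrite -sum_cell2 !mulr_sumr; apply: ler_sum => i _; rewrite /trace_r.
by apply: perr_cell; rewrite lexx ltW// node_lt.
Qed.

Lemma perr_fvg fl kd : \sum_i fvg fl (perr kd w) i ^+ 2 <= Kerr * (h ^+ (2 * k + 1) * seminorm2).
Proof.
case: fl => /=; [exact: perr_trl|exact: perr_trr|].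
have := perr_trl kd; have := perr_trr kd; set E := Kerr * _ => Hr Hl.
apply: (@le_trans _ _ (2^-1 * (\sum_i trl (perr kd w) i ^+ 2) + 2^-1 * (\sum_i trr (perr kd w) i ^+ 2))); last by lra.
rewrite !mulr_sumr -big_split/=; apply: ler_sum => i _; rewrite /mean.
by have := sqr_ge0 (trr (perr kd w) i - trl (perr kd w) i); nra.
Qed.

Lemma perr_upwind kd v : \sum_i upwind xmin xmax v (perr kd w) i ^+ 2 <=
  v ^+ 2 * (Kerr * (h ^+ (2 * k + 1) * seminorm2)).
Proof.
under eq_bigr do rewrite upwindE.
by case: (0 <= v); under eq_bigr do rewrite exprMn; rewrite -mulr_sumr ler_wpM2l ?sqr_ge0 ?perr_trl ?perr_trr.
Qed.

End Approximation.

End GlobalProjection.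

(** * Regularity of the exact solution *)

(** Continuity is only known within [K]. The near-covering form of compactness, with the radius [d]
    tending to 0 from the right as parameter, makes the local radii uniform. *)
Lemma uniformly_continuous_on_compact (R : realType) (X : pseudoMetricType R) (K : set X) (f : X -> R) :
  compact K -> {within K, continuous f} -> forall e : R, 0 < e ->
  exists2 d : R, 0 < d & forall x y, K x -> K y -> ball x d y -> `|f x - f y| < e.
Proof.
move=> /compact_near_coveringP cK cf e e0.
have H := cK R (0 : R)^'+ (fun d x => K x -> forall y, K y -> ball x d y -> `|f x - f y| < e).
suff /(H _) U : forall x, K x -> \forall x' \near x & d \near (0 : R)^'+,
    K x' -> forall y, K y -> ball x' d y -> `|f x' - f y| < e.
  near (0 : R)^'+ => d; exists d => //.
  move=> x y Kx; move: x Kx (Kx) y; near: d; exact: U.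
move=> x Kx.
have /subspace_continuousP/(_ x Kx)/cvgrPdist_lt/(_ (e / 2)) := cf.
rewrite divr_gt0// near_withinE => /(_ isT) /nbhs_ballP[r /= r0 Hr].
have r20 : 0 < r / 2 by rewrite divr_gt0.
exists (ball x (r / 2), [set d : R | d < r / 2]); first split => /=.
- exact: nbhsx_ballx.
- exact: nbhs_right_lt.
- move=> [x' d] /= [xx' dr] Kx' y Ky x'y.
  have H1 : `|f x - f x'| < e / 2 by apply: Hr => //; apply: le_ball xx'; lra.
  have H2 : `|f x - f y| < e / 2.
    apply: Hr => //; have -> : r = r / 2 + r / 2 by lra.
    by apply: ball_triangle xx' _; apply: le_ball x'y; exact: ltW.
  rewrite (_ : f x' - f y = (f x - f y) - (f x - f x')); last by ring.
  by apply: le_lt_trans (ler_normB _ _) _; lra.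
Unshelve. all: by end_near. Qed.

Lemma within_compact_bounded (R : realType) (X : pseudoMetricType R) (K : set X) (f : X -> R) :
  compact K -> {within K, continuous f} ->
  exists2 M : R, 0 <= M & forall x, K x -> `|f x| <= M.
Proof.
move=> cK cf; have /compact_bounded[M [_ mrt]] := continuous_compact cf cK.
exists (`|M| + 1); first by rewrite addr_ge0.
move=> x Kx; apply: mrt; last by exists x.
by rewrite (le_lt_trans (ler_norm _))// ltrDl.
Qed.

(** * Functions uniformly continuous in position and velocity *)

Section Nice.
Variables (R : realType) (m : model).
Local Notation Om := (@Omega_v R m).
Local Notation avg := (avg m).

Lemma Omega_compact : compact Om.
Proof.
rewrite /Omega_v; case: m; last exact: segment_compact.
rewrite (_ : [set v | _] = [set -1] `|` [set 1])//.
by apply: compactU; exact: compact_set1.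
Qed.

(** Boundedness and uniform continuity on each box $[A,B]\times\Omega_v$. All boxes are included, so
    that continuity in [x] at the ends of the domain is two-sided and periodic extensions can be
    differentiated there. *)
Definition nice (W : R -> R -> R) : Prop := forall A B : R,
  (exists2 M : R, 0 <= M & forall x v, A <= x <= B -> Om v -> `|W x v| <= M) /\
  (forall e : R, 0 < e -> exists2 d : R, 0 < d &
    forall x y v w, A <= x <= B -> A <= y <= B -> Om v -> Om w ->
      `|x - y| < d -> `|v - w| < d -> `|W x v - W y w| < e).

Definition jet_nice (D : R -> R -> R -> R) (T : R) : Prop := forall A B : R,
  (exists2 M : R, 0 <= M &
     forall x v t, A <= x <= B -> Om v -> 0 <= t <= T -> `|D x v t| <= M) /\
  (forall e : R, 0 < e -> exists2 d : R, 0 < d &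
    forall x y v w t s, A <= x <= B -> A <= y <= B -> Om v -> Om w ->
      0 <= t <= T -> 0 <= s <= T ->
      `|x - y| < d -> `|v - w| < d -> `|t - s| < d -> `|D x v t - D y w s| < e).

Lemma nice_of_jet D T t : jet_nice D T -> 0 <= t <= T -> nice (fun x v => D x v t).
Proof.
move=> H tT A B; have [[M M0 HM] HU] := H A B; split.
  by exists M => // x v xA Ov; apply: HM.
move=> e e0; have [d d0 Hd] := HU e e0; exists d => // x y v w *.
by apply: Hd => //; rewrite subrr normr0.
Qed.

Lemma nice_cont W v : nice W -> Om v -> continuous (fun x => W x v).
Proof.
move=> nW Ov x; apply/cvgrPdist_lt => e e0.
have [_ HU] := nW (x - 1) (x + 1); have [d d0 Hd] := HU e e0.
have dd : 0 < Num.min d 1 by rewrite lt_min d0 ltr01.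
apply/nbhs_ballP; exists (Num.min d 1) => //= y.
rewrite /ball/= lt_min => /andP[xyd].
rewrite ltr_norml => /andP[H1 H2]; apply: Hd => //; last by rewrite subrr normr0.
- by apply/andP; split; lra.
- by apply/andP; split; lra.
Qed.

Lemma nice_lin c W W' : nice W -> nice W' -> nice (fun x v => c * W x v + W' x v).
Proof.
move=> H H' A B; have [[M M0 HM] HU] := H A B; have [[M' M0' HM'] HU'] := H' A B; split.
  exists (`|c| * M + M'); first by rewrite addr_ge0// mulr_ge0.
  move=> x v xA Ov; apply: le_trans (ler_normD _ _) _.
  by rewrite normrM lerD ?HM'// ler_wpM2l// HM.
move=> e e0.
have c0 : 0 < `|c| + 1 by rewrite ltr_wpDl.
have e1 : 0 < e / 2 / (`|c| + 1) by rewrite !divr_gt0.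
have [d d0 Hd] := HU _ e1; have [d' d0' Hd'] := HU' (e / 2) ltac:(by rewrite divr_gt0).
exists (Num.min d d'); first by rewrite lt_min d0.
move=> x y v w xA yA Ov Ow; rewrite !lt_min => /andP[x1 x2] /andP[v1 v2].
have := Hd _ _ _ _ xA yA Ov Ow x1 v1; rewrite ltr_pdivlMr// => H1.
have H2 := Hd' _ _ _ _ xA yA Ov Ow x2 v2.
rewrite (_ : _ - _ = c * (W x v - W y w) + (W' x v - W' y w)); last by ring.
apply: le_lt_trans (ler_normD _ _) _; rewrite normrM.
by have := normr_ge0 c; have := normr_ge0 (W x v - W y w); nra.
Qed.

Lemma nice_B W W' : nice W -> nice W' -> nice (fun x v => W x v - W' x v).
Proof.
move=> H H'; have := nice_lin (-1) H' H.
by under eq_fun do under eq_fun do rewrite mulN1r addrC.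
Qed.

Lemma nice_M W W' : nice W -> nice W' -> nice (fun x v => W x v * W' x v).
Proof.
move=> H H' A B; have [[M M0 HM] HU] := H A B; have [[M' M0' HM'] HU'] := H' A B; split.
  exists (M * M'); first exact: mulr_ge0.
  by move=> x v xA Ov; rewrite normrM ler_pM// ?HM ?HM'.
move=> e e0.
have e1 : 0 < e / 2 / (M' + 1) by rewrite !divr_gt0// ltr_wpDl.
have e2 : 0 < e / 2 / (M + 1) by rewrite !divr_gt0// ltr_wpDl.
have [d d0 Hd] := HU _ e1; have [d' d0' Hd'] := HU' _ e2.
exists (Num.min d d'); first by rewrite lt_min d0.
move=> x y v w xA yA Ov Ow; rewrite !lt_min => /andP[x1 x2] /andP[v1 v2].
have := Hd _ _ _ _ xA yA Ov Ow x1 v1; have := Hd' _ _ _ _ xA yA Ov Ow x2 v2.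
rewrite !ltr_pdivlMr ?ltr_wpDl// => H1 H2.
rewrite (_ : _ - _ = (W x v - W y w) * W' x v + W y w * (W' x v - W' y w)); last by ring.
apply: le_lt_trans (ler_normD _ _) _; rewrite !normrM.
have := HM y w yA Ow; have := HM' x v xA Ov.
have := normr_ge0 (W x v - W y w); have := normr_ge0 (W' x v - W' y w).
by have := normr_ge0 (W y w); have := normr_ge0 (W' x v); nra.
Qed.

Lemma nice_v : nice (fun _ v => v).
Proof.
move=> A B; split; first by exists 1 => // x v _ /Omega_abs.
by move=> e e0; exists e.
Qed.

Lemma nice_x (p : R -> R) : continuous p -> nice (fun x _ => p x).
Proof.
move=> cp A B; have cw : {within `[A, B], continuous p} by exact: continuous_subspaceT.
split.
  have [M M0 HM] := within_compact_bounded (@segment_compact R A B) cw.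
  by exists M => // x v xA _; apply: HM; rewrite /= in_itv.
move=> e e0; have [d d0 Hd] := uniformly_continuous_on_compact (@segment_compact R A B) cw e0.
by exists d => // x y v w xA yA _ _ xy _; apply: Hd; rewrite /= ?in_itv.
Qed.

Lemma vL2_nice W x : nice W -> vL2 m (W x).
Proof.
move=> nW; apply: vL2_unif => e e0; have [_ HU] := nW x x.
have [d d0 Hd] := HU e e0; exists d => // v w Ov Ow vw.
by apply: Hd => //; rewrite ?lexx ?subrr ?normr0.
Qed.

Lemma avg_le_bound (f : R -> R) (M : R) : vint m f ->
  (forall v, Om v -> `|f v| <= M) -> `|avg f| <= M.
Proof.
move=> fi fM; rewrite ler_norml -{1}[M](avg_cst m) -mulN1r -avgZ; last exact: vint_cst.
rewrite -[M in X in _ && X](avg_cst m); apply/andP; split; apply: avg_le => //.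
- exact/vintZ/vint_cst.
- by move=> v /fM; rewrite ler_norml mulN1r => /andP[].
- exact: vint_cst.
- by move=> v /fM; rewrite ler_norml => /andP[].
Qed.

Lemma nice_avg W : nice W -> nice (fun x _ => avg (W x)).
Proof.
move=> nW A B; have [[M M0 HM] HU] := nW A B; split.
  exists M => // x v xA _; apply: avg_le_bound; first exact/vint_vL2/vL2_nice.
  by move=> w Ow; apply: HM.
move=> e e0; have e20 : 0 < e / 2 by rewrite divr_gt0.
have [d d0 Hd] := HU _ e20; exists d => // x y v w xA yA _ _ xy _.
rewrite -avgB; [|exact/vint_vL2/vL2_nice..].
apply: (@le_lt_trans _ _ (e / 2)); last by lra.
apply: avg_le_bound; first by apply: vintB; exact/vint_vL2/vL2_nice.
by move=> z Oz; apply/ltW/Hd => //; rewrite subrr normr0.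
Qed.

Lemma cont_avg W : nice W -> continuous (fun x => avg (W x)).
Proof.
move=> nW; have [v Ov] : exists v, Om v.
  by exists 1; rewrite /Omega_v; case: m => /=; [right|rewrite in_itv/= lexx andbT; lra].
exact: (nice_cont (nice_avg nW) Ov).
Qed.

Lemma vunif_I a b W : a <= b -> nice W -> vunif m (fun v => I a b (fun x => W x v)).
Proof.
move=> ab nW e e0; have [_ HU] := nW a b.
have e1 : 0 < e / 2 / (b - a + 1) by rewrite !divr_gt0// ltr_wpDl// subr_ge0.
have [d d0 Hd] := HU _ e1; exists d => // v w Ov Ow vw.
have cv := nice_cont nW Ov; have cw := nice_cont nW Ow.
have -> : I a b (fun x => W x v) - I a b (fun x => W x w) = I a b (fun x => -1 * W x w + W x v).
  by rewrite I_linear// mulN1r addrC.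
have H : `|I a b (fun x => -1 * W x w + W x v)| <= e / 2 / (b - a + 1) * (b - a).
  apply: I_bound => //; first by apply: contD => //; exact: contZ.
  by move=> x xab; rewrite mulN1r addrC; apply/ltW/Hd => //; rewrite subrr normr0.
apply: le_lt_trans H _; rewrite -mulrA mulrC.
have : (b - a + 1)^-1 * (b - a) <= 1.
  by rewrite mulrC ler_pdivrMr ?mul1r ?lerDl// ltr_wpDl// subr_ge0.
have e20 : 0 < e / 2 by rewrite divr_gt0.
by move=> H; nra.
Qed.

(** Fubini by differentiation: as a function of the upper limit, the difference [F] of the two sides
    has local rate 0, since on a short interval [W] is close to its value at one end uniformly in
    [v]. [lipschitz_of_local_rate] with constant 0 concludes. *)
Lemma avg_I a b W : a <= b -> nice W ->
  avg (fun v => I a b (fun x => W x v)) = I a b (fun x => avg (W x)).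
Proof.
move=> ab nW.
have vi s t : s <= t -> vint m (fun v => I s t (fun x => W x v)).
  by move=> st; exact/vint_vL2/vL2_unif/vunif_I.
have ca := cont_avg nW.
pose F y := avg (fun v => I a y (fun x => W x v)) - I a y (fun x => avg (W x)).
have Fa : F a = 0.
  rewrite /F set_itv1 Rintegral_set1 subr0 -[RHS](avg_cst m 0); apply: avg_ext => v _.
  by rewrite Rintegral_set1.
suff : `|F b - F a| <= 0 * (b - a).
  by rewrite mul0r normr_le0 Fa subr0 /F subr_eq0 => /eqP.
have step (t s : R) (e : R) : 0 < e -> a <= t -> t <= s -> s <= b ->
    (forall x v, t <= x <= s -> Om v -> `|W x v - W t v| <= e / 2) -> `|F s - F t| <= e * (s - t).
  move=> e0 at_ ts sb He.
  have E : F s - F t = avg (fun v => I t s (fun x => W x v - W t v)) - I t s (fun x => avg (W x) - avg (W t)).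
    have Wc v : Om v -> I t s (fun x => W x v - W t v) = I t s (fun x => W x v) - W t v * (s - t).
      move=> Ov; rewrite -I_cst// -[in RHS]mulN1r addrC -I_linear; first by apply: eq_I => x _; ring.
        exact: cont_cst.
      exact: nice_cont.
    rewrite (avg_ext Wc) avgB; last 2 first.
      exact: vi.
      by apply: (@vint_ext _ _ (fun v => (s - t) * W t v)); [move=> v _; rewrite mulrC|exact/vintZ/vint_vL2/vL2_nice].
    have -> : avg (fun v => W t v * (s - t)) = avg (W t) * (s - t).
      rewrite [RHS]mulrC -avgZ; last exact/vint_vL2/vL2_nice.
      by apply: avg_ext => v _; rewrite mulrC.
    have -> : I t s (fun x => avg (W x) - avg (W t)) = I t s (fun x => avg (W x)) - avg (W t) * (s - t).
      rewrite -I_cst// -[in RHS]mulN1r addrC -I_linear//; first by apply: eq_I => x _; ring.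
      exact: cont_cst.
    rewrite /F (@I_split _ a s t _ ca) ?at_//.
    have -> : avg (fun v => I a s (fun x => W x v)) = avg (fun v => I a t (fun x => W x v)) + avg (fun v => I t s (fun x => W x v)).
      rewrite -avgD; [|exact: vi..].
      apply: avg_ext => v Ov; rewrite (@I_split _ a s t)//; first exact: nice_cont.
      by rewrite at_.
    move: (avg (fun v => I a t (fun x => W x v))) (avg (fun v => I t s (fun x => W x v)))
      (I a t (fun x => avg (W x))) (I t s (fun x => avg (W x))) (avg (W t)) => p1 p2 q1 q2 c.
    by ring.
  rewrite E; apply: le_trans (ler_normB _ _) _.
  have -> : e * (s - t) = e / 2 * (s - t) + e / 2 * (s - t) by field.
  apply: lerD.
    apply: avg_le_bound.
      apply/vint_vL2/vL2_unif/vunif_I => //; apply: nice_B => // A B.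
      have [[M M0 HM] HU] := nW t t; split.
        by exists M => // x v _ Ov; apply: HM; rewrite ?lexx.
      move=> e' e0'; have [d d0 Hd] := HU e' e0'; exists d => // x y v w _ _ Ov Ow _ vw.
      by apply: Hd => //; rewrite ?lexx ?subrr ?normr0.
    move=> v Ov; apply: I_bound => //; last by move=> x xts; apply: He.
    by apply: contB; [exact: nice_cont|exact: cont_cst].
  apply: I_bound => //; first by apply: contB => //; exact: cont_cst.
  move=> x xts; rewrite -avgB; [|exact/vint_vL2/vL2_nice..].
  apply: avg_le_bound; first by apply: vintB; exact/vint_vL2/vL2_nice.
  by move=> v Ov; apply: He.
apply: lipschitz_of_local_rate => // t tab e e0; rewrite add0r.
have [_ HU] := nW a b; have [d d0 Hd] := HU (e / 2) ltac:(by rewrite divr_gt0).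
have /andP[at_ tb] := tab.
exists d => // s /andP[as_ sb]; have [ts|st] := leP t s.
  rewrite ger0_norm ?subr_ge0// => sd; apply: step => // x v /andP[tx xs] Ov.
  apply/ltW/Hd => //; rewrite ?subrr ?normr0//.
    by rewrite (le_trans at_ tx) (le_trans xs sb).
  by rewrite ger0_norm ?subr_ge0//; lra.
have -> : `|s - t| = t - s by rewrite distrC ger0_norm// subr_ge0 ltW.
move=> sd; rewrite distrC; apply: step => //; first exact: ltW.
move=> x v /andP[sx xt] Ov; apply/ltW/Hd => //; rewrite ?subrr ?normr0//.
- by rewrite (le_trans as_ sx) (le_trans xt tb).
- by rewrite as_ sb.
- by rewrite ger0_norm ?subr_ge0//; lra.
Qed.

(** To differentiate under the average, write [W] as a value at [c] plus the integral of [Wx],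
    exchange average and integral by [avg_I], and differentiate the integral. *)
Lemma is_derive_avg W Wx x : nice W -> nice Wx ->
  (forall y v, Om v -> is_derive y (1 : R) (fun y => W y v) (Wx y v)) ->
  is_derive x (1 : R) (fun y => avg (W y)) (avg (Wx x)).
Proof.
move=> nW nWx dW; have cx := cont_avg nWx.
pose c := x - 1.
have E y : c <= y -> avg (W y) = avg (W c) + I c y (fun z => avg (Wx z)).
  move=> cy; rewrite -avg_I// -avgD.
  - apply: avg_ext => v Ov; rewrite (I_FTC cy (nice_cont nWx Ov) (fun z => dW z v Ov)); ring.
  - exact/vint_vL2/vL2_nice.
  - exact/vint_vL2/vL2_unif/vunif_I.
have xx1 : x < x + 1 by rewrite ltrDl.
have cx' : c < x by rewrite /c; lra.
have [dI eI] := continuous_FTC1_closed xx1 (cont_integrable c (x + 1) cx) cx' (cx x).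
apply: (@near_eq_is_derive _ _ _ (fun y => avg (W c) + I c y (fun z => avg (Wx z)))).
  apply/nbhs_ballP; exists 1 => //= y; rewrite /ball/= ltr_norml => /andP[H1 H2].
  by rewrite -E// /c; lra.
have dI' : is_derive x (1 : R) (fun y => I c y (fun z => avg (Wx z))) (avg (Wx x)).
  apply: DeriveDef; first exact: dI.
  by rewrite -derive1E; exact: eI.
have := is_deriveD (is_derive_cst (avg (W c)) x 1) dI'.
by rewrite add0r.
Qed.

End Nice.

(** * Bounded functionals of functions of position and velocity *)

Section Functionals.
Variables (R : realType) (m : model) (xmin xmax : R).
Local Notation Om := (@Omega_v R m).
Local Notation avg := (avg m).
Local Notation nice := (@nice R m).

Definition bounded_form (l : (R -> R) -> R) : Prop :=
  (forall (c : R) (u w : R -> R), continuous u -> continuous w ->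
     l (fun x => c * u x + w x) = c * l u + l w) /\
  (exists2 K : R, 0 <= K & forall (u : R -> R) (e : R), continuous u ->
     (forall x, xmin <= x <= xmax -> `|u x| <= e) -> `|l u| <= K * e).

(** Linear functionals continuous for the sup norm on the domain. A discrete form tested with a
    fixed discrete function and averaged in [v] is of this kind as a function of the exact solution,
    and time derivatives pass through such functionals. *)
Definition nice_functional (L : (R -> R -> R) -> R) : Prop :=
  (forall c W W', nice W -> nice W' -> L (fun x v => c * W x v + W' x v) = c * L W + L W') /\
  (exists2 K : R, 0 <= K & forall W (e : R), nice W -> 0 <= e ->
     (forall x v, xmin <= x <= xmax -> Om v -> `|W x v| <= e) -> `|L W| <= K * e).

Lemma vunif_bounded_form l W : xmin <= xmax -> bounded_form l -> nice W ->
  vunif m (fun v => l (fun x => W x v)).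
Proof.
move=> xab [ll [K K0 lK]] nW e e0.
have K1 : 0 < K + 1 by rewrite ltr_wpDl.
have e1 : 0 < e / (K + 1) by rewrite divr_gt0.
have [_ HU] := nW xmin xmax; have [d d0 Hd] := HU _ e1.
exists d => // v w Ov Ow vw.
have cv := nice_cont nW Ov; have cw := nice_cont nW Ow.
have -> : l (fun x => W x v) - l (fun x => W x w) = l (fun x => -1 * W x w + W x v).
  by rewrite ll// mulN1r addrC.
have H : `|l (fun x => -1 * W x w + W x v)| <= K * (e / (K + 1)).
  apply: lK; first by apply: contD => //; exact: contZ.
  by move=> x xab'; rewrite mulN1r addrC; apply/ltW/Hd => //; rewrite subrr normr0.
apply: le_lt_trans H _; rewrite mulrA ltr_pdivrMr//; lra.
Qed.

Lemma vL2_bounded_form l W : xmin <= xmax -> bounded_form l -> nice W ->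
  vL2 m (fun v => l (fun x => W x v)).
Proof. by move=> xab bl nW; exact/vL2_unif/vunif_bounded_form. Qed.

Section Pairing.
Variables (k N : nat) (b : (R -> R) -> Uh R k N -> R) (xi : R -> Uh R k N).
Hypotheses (xab : xmin <= xmax)
  (lb : forall w, continuous w -> lin (b w))
  (bb : forall psi, bounded_form (fun w => b w psi))
  (xi2 : UL2 m xi).

Lemma pairing_expansion W v : nice W -> Om v ->
  b (fun x => W x v) (xi v) = \sum_j coordU j (xi v) * b (fun x => W x v) (basisU R j).
Proof. by move=> nW Ov; rewrite -(lin_expansion (lb (nice_cont nW Ov))). Qed.

Lemma vint_pairing W : nice W -> vint m (fun v => b (fun x => W x v) (xi v)).
Proof.
move=> nW; apply: (vint_ext (fun v Ov => esym (pairing_expansion nW Ov))).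
apply: vint_sum => j; apply: vintM; first exact: xi2.
exact: (vL2_bounded_form xab (bb (basisU R j)) nW).
Qed.

(** The test function is only square integrable in [v], so no bound uniform in [v] exists. In
    coordinates, each basis vector contributes its own bound [K j] times a coordinate of [xi], and
    $|c|\le 1+c^2$ makes the average finite. *)
Lemma pairing_functional :
  nice_functional (fun W => avg (fun v => b (fun x => W x v) (xi v))).
Proof.
split=> [c W W' nW nW'|].
  rewrite -avg_lin; [|exact: vint_pairing..].
  apply: avg_ext => v Ov; have [bl _] := bb (xi v).
  by rewrite bl//; exact: nice_cont.
have /choice[K HK] : forall j, exists K : R, 0 <= K /\ forall (u : R -> R) (e : R), continuous u ->
     (forall x, xmin <= x <= xmax -> `|u x| <= e) -> `|b u (basisU R j)| <= K * e.
  by move=> j; have [_ [K K0 HK]] := bb (basisU R j); exists K.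
have ci j : vint m (fun v => 1 + coordU j (xi v) * coordU j (xi v)).
  by apply: vintD; [exact: vint_cst|exact: vintM].
exists (\sum_j K j * avg (fun v => 1 + coordU j (xi v) * coordU j (xi v))).
  apply: sumr_ge0 => j _; have [K0 _] := HK j; rewrite mulr_ge0//.
  by apply: avg_ge0 => v _; rewrite addr_ge0// -expr2 sqr_ge0.
move=> W e nW e0 We.
have H v : Om v -> `|b (fun x => W x v) (xi v)| <= e * \sum_j K j * (1 + coordU j (xi v) * coordU j (xi v)).
  move=> Ov; rewrite pairing_expansion//; apply: le_trans (ler_norm_sum _ _ _) _.
  rewrite mulr_sumr; apply: ler_sum => j _; rewrite normrM.
  have [K0 Kj] := HK j.
  have := Kj _ e (nice_cont nW Ov) (fun x xab' => We x v xab' Ov).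
  set B := `|b _ _|; set c := coordU _ _ => HB.
  have c1 : `|c| <= 1 + c * c.
    rewrite -expr2 -[c ^+ 2]real_normK ?num_real//.
    by have := sqr_ge0 (`|c| - 1); have := normr_ge0 c; nra.
  have Ke : 0 <= K j * e by rewrite mulr_ge0.
  apply: (@le_trans _ _ (`|c| * (K j * e))); first by rewrite ler_wpM2l.
  by apply: le_trans (ler_wpM2r Ke c1) _; rewrite le_eqVlt; apply/orP; left; apply/eqP; ring.
have iS : vint m (fun v => \sum_j K j * (1 + coordU j (xi v) * coordU j (xi v))).
  by apply: vint_sum => j; exact: vintZ.
have E : avg (fun v => e * \sum_j K j * (1 + coordU j (xi v) * coordU j (xi v))) =
    (\sum_j K j * avg (fun v => 1 + coordU j (xi v) * coordU j (xi v))) * e.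
  rewrite avgZ// mulrC avg_sum; last by move=> j; exact: vintZ.
  by congr (_ * _); apply: eq_bigr => j _; rewrite avgZ.
rewrite -E ler_norml; apply/andP; split; last first.
  apply: avg_le; [exact: vint_pairing|exact: vintZ|].
  by move=> v Ov; apply: le_trans (ler_norm _) (H v Ov).
rewrite -mulN1r -avgZ; last exact: vintZ.
apply: avg_le; [exact/vintZ/vintZ|exact: vint_pairing|].
by move=> v Ov; rewrite mulN1r lerNl; apply: le_trans (H v Ov); rewrite -normrN ler_norm.
Qed.

End Pairing.

End Functionals.

(** * Time derivatives and mean value inequalities under a functional *)

Section TimeDerivative.
Variables (R : realType) (m : model) (xmin xmax T : R).
Local Notation Om := (@Omega_v R m).

Definition time_derivative (D Dt : R -> R -> R -> R) : Prop :=
  forall x v t, Om v -> 0 <= t <= T ->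
    time_quotient (D x v) t s @[s --> time_filter T t] --> Dt x v t.

Lemma time_derivative_rate D Dt x v t (e : R) : time_derivative D Dt -> Om v -> 0 <= t <= T ->
  0 < e -> exists2 d : R, 0 < d & forall s, 0 <= s <= T -> `|s - t| < d ->
    `|D x v s - D x v t - (s - t) * Dt x v t| <= e * `|s - t|.
Proof.
move=> H Ov tT e0; have := H x v t Ov tT.
move=> /cvgrPdist_le /(_ e e0); rewrite /time_filter near_withinE near_withinE.
move=> /nbhs_ballP[d /= d0 Hd]; exists d => // s sT sd.
have [->|st] := eqVneq s t; first by rewrite !subrr mul0r subrr normr0 mulr0.
have := Hd s; rewrite /ball/= distrC => /(_ sd st); rewrite in_itv/= => /(_ sT).
rewrite /time_quotient => H1.
have st0 : s - t != 0 by rewrite subr_eq0.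
rewrite -[D x v s - _](divfK st0) [X in X - _]mulrC -mulrBr normrM mulrC distrC.
by rewrite ler_wpM2r.
Qed.

Section Functional.
Variables (D Dt : R -> R -> R -> R) (L : (R -> R -> R) -> R).
Hypotheses (nD : jet_nice m D T) (nDt : jet_nice m Dt T) (DDt : time_derivative D Dt)
  (LL : nice_functional m xmin xmax L).

(** Pointwise differentiability in time does not pass through [L]; a rate uniform in [x] and [v]
    does. It follows from the uniform continuity of [Dt] by [lipschitz_of_local_rate], applied at
    fixed [x] and [v] to [D] minus its linear part at [t]. *)
Lemma functional_rate t (e : R) : 0 <= t <= T -> 0 < e ->
  exists2 d : R, 0 < d & forall s, 0 <= s <= T -> `|s - t| < d ->
    `|L (fun x v => D x v s) - L (fun x v => D x v t) - (s - t) * L (fun x v => Dt x v t)|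
      <= e * `|s - t|.
Proof.
move=> tT e0; have [ll [K K0 LK]] := LL.
have K1 : 0 < K + 1 by rewrite ltr_wpDl.
have e1 : 0 < e / (K + 1) by rewrite divr_gt0.
have [_ HU] := nDt xmin xmax; have [d d0 Hd] := HU _ e1.
exists d => // s sT sd.
have nDs := nice_of_jet nD sT; have nDtt := nice_of_jet nD tT; have nd := nice_of_jet nDt tT.
have n1 : nice m (fun x v => (- (s - t)) * Dt x v t + D x v s) by exact: nice_lin.
have -> : L (fun x v => D x v s) - L (fun x v => D x v t) - (s - t) * L (fun x v => Dt x v t) =
    L (fun x v => -1 * D x v t + ((- (s - t)) * Dt x v t + D x v s)).
  by rewrite ll// ll//; ring.
apply: (@le_trans _ _ (K * (e / (K + 1) * `|s - t|))); last first.
  rewrite mulrA ler_wpM2r// mulrA ler_pdivrMr//; lra.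
apply: LK; first exact: nice_lin.
  by rewrite mulr_ge0// ltW.
move=> x v xab Ov.
have key (p q : R) : 0 <= p <= T -> 0 <= q <= T -> p <= q -> (forall r, p <= r <= q -> `|Dt x v r - Dt x v t| <= e / (K + 1)) ->
    `|D x v q - D x v p - (q - p) * Dt x v t| <= e / (K + 1) * (q - p).
  move=> pT qT pq Hr.
  have := @lipschitz_of_local_rate R (fun r => D x v r - r * Dt x v t) p q (e / (K + 1)) pq _.
  rewrite (_ : D x v q - q * Dt x v t - (D x v p - p * Dt x v t) = D x v q - D x v p - (q - p) * Dt x v t); last by ring.
  apply => r rpq e' e0'.
  have rT : 0 <= r <= T.
    by move: rpq pT qT => /andP[? ?] /andP[? ?] /andP[? ?]; apply/andP; split; lra.
  have [d' d0' Hd'] := time_derivative_rate x DDt Ov rT e0'.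
  exists d' => // r' r'pq r'd.
  have r'T : 0 <= r' <= T.
    by move: r'pq pT qT => /andP[? ?] /andP[? ?] /andP[? ?]; apply/andP; split; lra.
  have H1 := Hd' r' r'T r'd; have H2 := Hr r rpq.
  rewrite (_ : D x v r' - r' * Dt x v t - (D x v r - r * Dt x v t) =
    (D x v r' - D x v r - (r' - r) * Dt x v r) + (r' - r) * (Dt x v r - Dt x v t)); last by ring.
  apply: le_trans (ler_normD _ _) _; rewrite [leRHS]mulrDl [leRHS]addrC; apply: lerD => //; rewrite normrM mulrC.
  by rewrite ler_wpM2r.
have Hclose r : 0 <= r <= T -> `|r - t| <= `|s - t| -> `|Dt x v r - Dt x v t| <= e / (K + 1).
  move=> rT rt; apply/ltW/Hd => //; rewrite ?subrr ?normr0//.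
  exact: le_lt_trans rt sd.
have [ts|st] := leP t s.
  rewrite (ger0_norm (_ : 0 <= s - t)) ?subr_ge0//.
  have H : forall r, t <= r <= s -> `|Dt x v r - Dt x v t| <= e / (K + 1).
    move=> r /andP[tr rs]; apply: Hclose.
      by move: tT sT => /andP[? ?] /andP[? ?]; apply/andP; split; lra.
    by rewrite !ger0_norm ?subr_ge0// lerD2r.
  have := key t s tT sT ts H.
  by congr (`|_| <= _); ring.
have st' := ltW st.
rewrite (_ : `|s - t| = t - s); last by rewrite distrC ger0_norm ?subr_ge0.
have H : forall r, s <= r <= t -> `|Dt x v r - Dt x v t| <= e / (K + 1).
  move=> r /andP[sr rt]; apply: Hclose.
    by move: tT sT => /andP[? ?] /andP[? ?]; apply/andP; split; lra.
  by rewrite distrC [leRHS]distrC !ger0_norm ?subr_ge0// lerD2l lerN2.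
have := key s t sT tT st' H; rewrite -normrN.
by congr (`|_| <= _); ring.
Qed.

Lemma functional_lipschitz (M a b : R) : 0 <= a -> a <= b -> b <= T ->
  (forall s, a <= s <= b -> `|L (fun x v => Dt x v s)| <= M) ->
  `|L (fun x v => D x v b) - L (fun x v => D x v a)| <= M * (b - a).
Proof.
move=> a0 ab bT LM.
apply: (lipschitz_of_local_rate (f := fun t => L (fun x v => D x v t))) => // t tab e e0.
have tT : 0 <= t <= T by move: tab => /andP[? ?]; apply/andP; split; lra.
have [d d0 Hd] := functional_rate tT e0; exists d => // s sab sd.
have sT : 0 <= s <= T by move: sab => /andP[? ?]; apply/andP; split; lra.
have H1 := Hd s sT sd; have H2 := LM t tab.
move: H1 H2; set p := L _; set q := L _; set r := L _ => H1 H2.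
rewrite (_ : p - q = (p - q - (s - t) * r) + (s - t) * r); last by ring.
apply: le_trans (ler_normD _ _) _; rewrite [leRHS]mulrDl [leRHS]addrC; apply: lerD => //; rewrite normrM mulrC.
by rewrite ler_wpM2r.
Qed.

End Functional.

(** Two mean value inequalities in succession: after subtraction of the linear part at [a], the rate
    is at most [M * (b - a)]. The price is [M] where Taylor's formula would give [M / 2]. *)
Lemma functional_second_order (D Dt Dtt : R -> R -> R -> R) (L : (R -> R -> R) -> R) (M a b : R) :
  jet_nice m D T -> jet_nice m Dt T -> jet_nice m Dtt T ->
  time_derivative D Dt -> time_derivative Dt Dtt -> nice_functional m xmin xmax L ->
  0 <= a -> a <= b -> b <= T ->
  (forall s, a <= s <= b -> `|L (fun x v => Dtt x v s)| <= M) ->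
  `|L (fun x v => D x v b) - L (fun x v => D x v a) - (b - a) * L (fun x v => Dt x v a)|
    <= M * (b - a) ^+ 2.
Proof.
move=> nD nDt nDtt dD dDt LL a0 ab bT LM.
have M0 : 0 <= M by apply: le_trans (LM a _); rewrite ?lexx.
pose La := L (fun x v => Dt x v a).
have := @lipschitz_of_local_rate R (fun t => L (fun x v => D x v t) - t * La) a b (M * (b - a)) ab _.
rewrite (_ : L (fun x v => D x v b) - b * La - (L (fun x v => D x v a) - a * La) = L (fun x v => D x v b) - L (fun x v => D x v a) - (b - a) * La); last by ring.
rewrite -mulrA -expr2; apply => t tab e e0.
have tT : 0 <= t <= T by move: tab => /andP[? ?]; apply/andP; split; lra.
have [d d0 Hd] := functional_rate nD nDt dD LL tT e0; exists d => // s sab sd.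
have sT : 0 <= s <= T by move: sab => /andP[? ?]; apply/andP; split; lra.
have H1 := Hd s sT sd.
have /andP[at_ tb] := tab.
have H2 : `|L (fun x v => Dt x v t) - La| <= M * (b - a).
  apply: (@le_trans _ _ (M * (t - a))); last by rewrite ler_wpM2l// lerD2r.
  apply: (functional_lipschitz nDt nDtt dDt LL) => //; first exact: le_trans bT.
  by move=> r /andP[ar rt]; apply: LM; rewrite ar (le_trans rt).
move: H1 H2; set p := L _; set q := L _; set r := L _ => H1 H2.
rewrite (_ : p - s * La - (q - t * La) = (p - q - (s - t) * r) + (s - t) * (r - La)); last by ring.
apply: le_trans (ler_normD _ _) _; rewrite [leRHS]mulrDl [leRHS]addrC; apply: lerD => //; rewrite normrM mulrC.
by rewrite ler_wpM2r.
Qed.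

End TimeDerivative.

Section Smooth.
Variables (R : realType) (m : model) (T : R) (u : R -> R -> R -> R).
Hypothesis su : smooth m T u.

(** The head of the word is the outermost derivative: [[:: DirX; DirT]] stands for
    $\partial_x\partial_t u$. *)
Definition jet (w : seq direction) : R -> R -> R -> R :=
  fun x v t => pderiv T w (fun x t => u x v t) x t.

Lemma jet_jet_nice w : jet_nice m (jet w) T.
Proof.
have [_ _ H] := su w.
move=> A B.
pose K : set (R * R * R) := (`[A, B]%classic `*` Omega_v m) `*` `[0, T]%classic.
have cK : compact K.
  apply: compact_setX; last exact: segment_compact.
  by apply: compact_setX; [exact: segment_compact|exact: Omega_compact].
have cf : {within K, continuous (fun z : R * R * R => jet w z.1.1 z.1.2 z.2)}.
  apply: continuous_subspaceW H => -[[x v] t] /= [[_ Ov]].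
  by rewrite /= in_itv.
split.
  have [M M0 HM] := within_compact_bounded cK cf; exists M => // x v t xA Ov tT.
  by apply: (HM (x, v, t)); split; [split|] => //=; rewrite in_itv.
move=> e e0; have [d d0 Hd] := uniformly_continuous_on_compact cK cf e0.
exists d => // x y v w' t s xA yA Ov Ow tT sT xy vw ts.
apply: (Hd (x, v, t) (y, w', s)).
- by split; [split|] => //=; rewrite in_itv.
- by split; [split|] => //=; rewrite in_itv.
- by split; [split|].
Qed.

Lemma jet_nice_at w t : 0 <= t <= T -> nice m (fun x v => jet w x v t).
Proof. exact: (nice_of_jet (jet_jet_nice w)). Qed.

Lemma jet_time w : time_derivative m T (jet w) (jet (DirT :: w)).
Proof. by move=> x v t Ov tT; have [_ H _] := su w; exact: (H x v t Ov tT). Qed.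

Lemma jet_is_derive w x v t : Omega_v m v -> 0 <= t <= T ->
  is_derive x (1 : R) (fun y => jet w y v t) (jet (DirX :: w) x v t).
Proof.
move=> Ov tT; have [H _ _] := su w; have dx := H x v t Ov tT.
apply: DeriveDef; first exact: dx.
by rewrite -derive1E.
Qed.

Lemma jet_chain w v t : Omega_v m v -> 0 <= t <= T ->
  forall j (x : R), is_derive x (1 : R) (fun y => jet (nseq j DirX ++ w) y v t)
     (jet (nseq j.+1 DirX ++ w) x v t).
Proof. by move=> Ov tT j x; exact: jet_is_derive. Qed.

Lemma jet_cont w v t : Omega_v m v -> 0 <= t <= T -> continuous (fun x => jet w x v t).
Proof. by move=> Ov tT; apply: (nice_cont (jet_nice_at w tT)). Qed.

Lemma jet_derive1n w v t j : jet (nseq j DirX ++ w) ^~ v ^~ t = derive1n j (fun x => jet w x v t).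
Proof.
elim: j => [//|j IH]; rewrite /derive1n/= -/(derive1n j _) -IH.
by [].
Qed.

End Smooth.

(** * Consistency of the discrete forms *)

Section TestedForms.
Variables (R : realType) (m : model) (xmin xmax : R) (k N : nat) (Cinv Chinv : R).
Hypotheses (xab : xmin < xmax) (N0 : (0 < N)%N)
  (Cinv0 : 0 < Cinv) (Chinv0 : 0 < Chinv)
  (inv : inverse_inequalities k Cinv Chinv).
Local Notation U := (Uh R k N).
Local Notation B := (broken R N).
Local Notation h := (mesh_size xmin xmax N).
Local Notation node := (node xmin xmax N).
Local Notation ip := (@ip R xmin xmax N).
Local Notation tb := (@to_broken R k N).
Local Notation trl := (@trace_l R xmin xmax N).
Local Notation trr := (@trace_r R xmin xmax N).
Local Notation jump := (@jump R xmin xmax N).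
Local Notation fvg := (@flux_vg R xmin xmax N).
Local Notation wfl := (@wfl R xmin xmax k N).
Local Notation perr := (@perr R xmin xmax k N).
Local Notation projU := (@projU R xmin xmax k N).
Local Notation avg := (avg m).
Local Notation Om := (@Omega_v R m).
Local Notation bounded_form := (@bounded_form R xmin xmax).
Local Notation Kerr := (Kerr k Cinv Chinv).

Let h0 : 0 < h := h_gt0 xab N0.

Definition whole (w : R -> R) : B := fun _ => w.

Lemma bcont_whole w : continuous w -> bcont (whole w).
Proof. by move=> cw i. Qed.

Lemma bounded_form_ip (P : (R -> R) -> B) (b : B) : bcont b ->
  (forall (c : R) (u w : R -> R), continuous u -> continuous w ->
     P (fun x => c * u x + w x) = (fun i x => c * P u i x + P w i x)) ->
  (forall w, continuous w -> bcont (P w)) ->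
  (exists2 K : R, 0 <= K & forall (w : R -> R) (e : R), continuous w ->
     (forall x, xmin <= x <= xmax -> `|w x| <= e) ->
     forall (i : 'I_N) x, node i <= x <= node i.+1 -> `|P w i x| <= K * e) ->
  bounded_form (fun w => ip (P w) b).
Proof.
move=> cb Pl cP [K K0 PK]; split.
  by move=> c u w cu cw; rewrite Pl// ip_lin//; exact: cP.
have cab i : continuous (fun x => `|b i x|).
  by move=> x; apply: continuous_comp; [exact: cb|exact: norm_continuous].
exists (K * \sum_(i < N) I (node i) (node i.+1) (fun x => `|b i x|)).
  by rewrite mulr_ge0// sumr_ge0// => i _; apply: I_ge0.
move=> w e cw we; apply: le_trans (ler_norm_sum _ _ _) _.
rewrite -mulrA [X in _ * X]mulrC mulrA mulr_sumr; apply: ler_sum => i _.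
rewrite /cell -I_Z//; apply: I_abs; [by apply: contM; [exact: cP|]|exact: contZ|].
by move=> x xi; rewrite normrM ler_wpM2r// PK.
Qed.

Lemma bounded_form_whole (b : B) : bcont b -> bounded_form (fun w => ip (whole w) b).
Proof.
move=> cb; apply: bounded_form_ip => //; first by move=> w cw i.
by exists 1 => // w e cw we i x xi; rewrite mul1r; apply/we/(cell_sub xab N0 xi).
Qed.

Lemma bounded_form_perr kd (b : B) : bcont b -> bounded_form (fun w => ip (perr kd w) b).
Proof.
move=> cb; apply: bounded_form_ip => //.
- by move=> c u w cu cw; rewrite (perr_lin xab N0 Cinv0 Chinv0 inv).
- by move=> w cw; exact: bcont_perr.
exists Kerr; first by apply: le_trans (Kerr_ge1 k Cinv0 Chinv0).
by move=> w e cw we i x xi; exact: (perr_sup xab N0 Cinv0 Chinv0 inv).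
Qed.

Lemma bounded_form_D l l' : bounded_form l -> bounded_form l' -> bounded_form (fun w => l w + l' w).
Proof.
move=> [ll [K K0 lK]] [ll' [K' K0' lK']]; split.
  by move=> c u w cu cw; rewrite ll// ll'//; ring.
exists (K + K'); first exact: addr_ge0.
move=> u e cu ue; rewrite mulrDl; apply: le_trans (ler_normD _ _) _.
by apply: lerD; [exact: lK|exact: lK'].
Qed.

Lemma bounded_form_Z c l : bounded_form l -> bounded_form (fun w => c * l w).
Proof.
move=> [ll [K K0 lK]]; split; first by move=> d u w cu cw; rewrite ll//; ring.
exists (`|c| * K); first exact: mulr_ge0.
by move=> u e cu ue; rewrite normrM -mulrA ler_wpM2l// lK.
Qed.

Lemma node_in (j : nat) : (j <= N)%N -> xmin <= node j <= xmax.
Proof.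
move=> jN; have := node_le xab N0 (leq0n j); rewrite node0 => ->.
by have := node_le xab N0 jN; rewrite nodeN.
Qed.

Lemma bounded_form_flux fl psi : bounded_form (fun w => \sum_i fvg fl (whole w) i * jump (tb psi) i).
Proof.
split.
  move=> c u w cu cw; rewrite mulr_sumr -big_split/=; apply: eq_bigr => i _.
  by rewrite /whole fvg_lin; ring.
exists (\sum_i `|jump (tb psi) i|); first by apply: sumr_ge0.
move=> u e cu ue; apply: le_trans (ler_norm_sum _ _ _) _.
rewrite mulr_suml; apply: ler_sum => i _; rewrite normrM mulrC ler_wpM2l//.
have Hl : `|trl (whole u) i| <= e by apply/ue/node_in; exact: ltn_ord.
have Hr : `|trr (whole u) i| <= e by apply/ue/node_in; exact: ltnW.
case: fl => //=; rewrite /mean normrM [`|2^-1|]ger0_norm ?invr_ge0//.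
rewrite ler_pdivrMr//; apply: le_trans (ler_normD _ _) _; lra.
Qed.

Lemma bounded_form_wfl fl psi : bounded_form (fun w => wfl fl (whole w) psi).
Proof.
apply: bounded_form_D; last exact: bounded_form_flux.
by apply: bounded_form_whole; exact: bcont_bder.
Qed.

(** A coordinate of the projection is its $L^2$ product with a fixed Riesz element, hence a bounded
    functional of the function that is projected, and uniform continuity in [v] is inherited. *)
Lemma UL2_projU kd W : nice m W -> UL2 m (fun v => projU kd (fun x => W x v)).
Proof.
move=> nW j.
pose r := riesz xmin xmax (fun psi : U => coordU j psi).
have bf : bounded_form (fun w => ip (whole w) (tb r) + -1 * ip (perr kd w) (tb r)).
  apply: bounded_form_D; first by apply: bounded_form_whole; exact: bcont_tb.
  by apply/bounded_form_Z/bounded_form_perr; exact: bcont_tb.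
apply: (vL2_ext _ (vL2_bounded_form (ltW xab) bf nW)) => v Ov.
have cw := nice_cont nW Ov.
have cp : bcont (perr kd (fun x => W x v)) by exact: bcont_perr.
have := ip_lin xmin xmax (-1) cp (bcont_whole cw) (@bcont_tb R k N r).
rewrite addrC => <-.
transitivity (ip (tb (projU kd (fun x => W x v))) (tb r)).
  by apply: eq_ip => // i x _; rewrite /perr /whole; ring.
by rewrite ip_sym /r (rieszP xab N0 Cinv0 inv (lin_coordU j)).
Qed.

Lemma avg_ip W (b : B) : nice m W -> bcont b ->
  avg (fun v => ip (whole (fun x => W x v)) b) = ip (whole (fun x => avg (W x))) b.
Proof.
move=> nW cb; rewrite /Defs.ip avg_sum; last first.
  move=> i; apply/vint_vL2/vL2_unif/vunif_I; first exact/ltW/node_lt.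
  by apply: nice_M => //; exact: nice_x.
apply: eq_bigr => i _; rewrite /cell /whole (avg_I (W := fun x v => W x v * b i x)).
- apply: eq_I => x _; rewrite [RHS]mulrC -avgZ; last exact/vint_vL2/vL2_nice.
  by apply: avg_ext => v _; rewrite mulrC.
- exact/ltW/node_lt.
- by apply: nice_M => //; exact: nice_x.
Qed.

(** Projection in [x] commutes with averaging in [v]: the average of the projections satisfies the
    conditions that characterize the projection of $\langle W\rangle=0$, and these have only the
    zero solution. *)
Lemma vmean_projU kd W : nice m W -> (forall x, xmin <= x <= xmax -> avg (W x) = 0) ->
  vmean m (fun=> 1) (fun v => projU kd (fun x => W x v)) = 0.
Proof.
move=> nW W0; set u : R -> U := fun v => projU kd _; have u2 : UL2 m u by exact: UL2_projU.
have one (l : U -> R) : lin l -> l (vmean m (fun=> 1) u) = avg (fun v => l (u v)).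
  move=> ll; rewrite -(avg_vmean ll (vL2_cst m 1) u2); apply: avg_ext => v _.
  by rewrite mul1r.
have niab (i : 'I_N) := node_lt xab N0 i.
have c0 : continuous ((fun=> 0) : R -> R) by exact: cont_cst.
have pu v (i : 'I_N) : Om v -> is_projection k kd (node i) (node i.+1) (fun x => W x v) (poly_at (u v) i).
  move=> Ov; rewrite /u /poly_at /projU ffunE.
  exact: (projP Cinv0 Chinv0 inv kd (niab i) (nice_cont nW Ov)).
apply/ffunP => i; rewrite ffunE.
set p := vmean m _ u i.
have ev y : node i <= y <= node i.+1 -> (forall v, Om v -> (poly_at (u v) i).[y] = W y v) ->
    (p : {poly R}).[y] = 0.
  move=> yi H; rewrite -(W0 y (cell_sub xab N0 yi)).
  have := one (fun w => tb w i y) (fun a w w' => tb_lin a w w' i y).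
  by rewrite /to_broken /poly_at => ->; exact: avg_ext.
have orth (q : {poly R}) : (forall v, Om v -> I (node i) (node i.+1) (fun x => ((poly_at (u v) i).[x] - W x v) * q.[x]) = 0) ->
    I (node i) (node i.+1) (fun x => ((p : {poly R}).[x] - 0) * q.[x]) = 0.
  move=> H.
  have ll : lin (fun w : U => I (node i) (node i.+1) (fun x => tb w i x * q.[x])).
    move=> a w w'; rewrite -I_linear; [|by apply: contM; exact: cont_poly..].
    by apply: eq_I => x _; rewrite tb_lin; ring.
  rewrite (@eq_I _ _ _ _ (fun x => tb (vmean m (fun=> 1) u) i x * q.[x])); last first.
    by move=> x _; rewrite subr0.
  rewrite (one _ ll).
  have nWq : nice m (fun x v => W x v * q.[x]) by apply: nice_M => //; apply: nice_x; exact: cont_poly.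
  transitivity (avg (fun v => I (node i) (node i.+1) (fun x => W x v * q.[x]))).
    apply: avg_ext => v Ov; apply/eqP; rewrite -subr_eq0 -mulN1r addrC -I_linear; last 2 first.
    - by apply: contM; [exact: nice_cont|exact: cont_poly].
    - by apply: contM; exact: cont_poly.
    by rewrite -(H v Ov); apply/eqP; apply: eq_I => x _; rewrite /to_broken; ring.
  rewrite (avg_I (W := fun x v => W x v * q.[x]) (ltW (niab i)) nWq).
  rewrite (@eq_I _ _ _ _ (fun=> 0)); first by rewrite Rintegral_cst// mul0r.
  move=> x xi; transitivity (q.[x] * avg (W x)).
    by rewrite -avgZ; [apply: avg_ext => v _; rewrite mulrC|exact/vint_vL2/vL2_nice].
  by rewrite W0 ?mulr0//; exact: (cell_sub xab N0 xi).
have pp : is_projection k kd (node i) (node i.+1) (fun=> 0) p.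
  have pu' v := pu v i; move: pu'; rewrite /is_projection; case: kd @u u2 one pu p ev orth => u u2 one pu p ev orth pu'.
  - by move=> q sq; apply: orth => v Ov; exact: pu'.
  - split; first by apply: ev => [|v Ov]; [rewrite lexx ltW|have [] := pu' v Ov].
    by move=> q sq; apply: orth => v Ov; have [_] := pu' v Ov; exact.
  - split; first by apply: ev => [|v Ov]; [rewrite lexx ltW|have [] := pu' v Ov].
    by move=> q sq; apply: orth => v Ov; have [_] := pu' v Ov; exact.
have pz : is_projection k kd (node i) (node i.+1) (fun=> 0) (0 : {poly_k.+1 R}).
  rewrite (_ : (fun=> 0) = (fun x => (0 : {poly R}).[x])); last by apply/funext => x; rewrite horner0.
  exact: is_projection_poly.
exact: (projection_unique Cinv0 Chinv0 inv (niab i) c0 pp pz).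
Qed.

Lemma node_periodic (w : R -> R) (i : 'I_N) : w xmin = w xmax -> w (node (ord_pred i).+1) = w (node i).
Proof.
move=> per; case: i => -[|i] iN /=.
  by rewrite add0n modn_small ?prednK// nodeN// node0.
by rewrite modnDr modn_small// ltnW.
Qed.

Lemma ip_whole_bder (w w' : R -> R) (psi : U) : (forall x, is_derive x (1 : R) w (w' x)) ->
  continuous w' -> w xmin = w xmax ->
  ip (whole w) (bder psi) + \sum_(i < N) w (node i) * jump (tb psi) i = - ip (whole w') (tb psi).
Proof.
move=> dw cw' per.
have cw : continuous w.
  move=> y; apply: differentiable_continuous; apply/derivable1_diffP.
  exact: (@ex_derive _ _ _ _ _ _ _ (dw y)).
apply/eqP; rewrite -addr_eq0 addrAC; apply/eqP.
have -> : ip (whole w) (bder psi) + ip (whole w') (tb psi) =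
    \sum_(i < N) (w (node i.+1) * tb psi i (node i.+1) - w (node i) * tb psi i (node i)).
  rewrite -big_split/=; apply: eq_bigr => i _; rewrite /cell -I_D; last 2 first.
  - by apply: contM => //; exact: bcont_bder.
  - by apply: contM => //; exact: bcont_tb.
  have D x : is_derive x (1 : R) (fun y => w y * (poly_at psi i).[y])
    (whole w i x * bder psi i x + whole w' i x * tb psi i x).
    have H1 := dw x; have H2 := is_derive_horner_fun (poly_at psi i) x.
    have H := is_deriveM H1 H2.
    by apply: is_derive_eq H _; rewrite /GRing.scale/= /whole /bder /to_broken; ring.
  rewrite (I_FTC _ _ D)//; first exact/ltW/node_lt.
  by apply: contD; apply: contM => //; [exact: bcont_bder|exact: bcont_tb].
rewrite sumrB -(sum_ord_pred (fun i : 'I_N => w (node i.+1) * tb psi i (node i.+1))).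
rewrite -sumrB -big_split/= big1// => i _.
by rewrite node_periodic// /Defs.jump /trace_r /trace_l; ring.
Qed.

(** A continuous periodic function has equal traces on both sides of each node, so every flux
    returns the nodal value and integration by parts applies. Consistency is thus the same for all
    flux pairs. *)
Lemma wfl_exact fl (w w' : R -> R) (psi : U) : (forall x, is_derive x (1 : R) w (w' x)) ->
  continuous w' -> w xmin = w xmax -> wfl fl (whole w) psi = - ip (whole w') (tb psi).
Proof.
move=> dw cw' per; rewrite -(ip_whole_bder psi dw cw' per) /wfl weak_formE; congr (_ + _).
apply: eq_bigr => i _; congr (_ * _).
by case: fl => /=; rewrite /mean /trace_l /trace_r /whole ?node_periodic//; field.
Qed.

Definition advb (v : R) (u : B) (psi : U) : R :=
  - weak_form xmin xmax (fun i x => v * u i x) (upwind xmin xmax v u) psi.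

Lemma advb_lin v a u w psi : bcont u -> bcont w ->
  advb v (fun i x => a * u i x + w i x) psi = a * advb v u psi + advb v w psi.
Proof.
move=> cu cw; rewrite /advb.
have -> : (fun (i : 'I_N) x => v * (a * u i x + w i x)) = (fun i x => a * (v * u i x) + v * w i x).
  by apply/funext => i; apply/funext => x; ring.
have -> : upwind xmin xmax v (fun i x => a * u i x + w i x) =
  (fun i => a * upwind xmin xmax v u i + upwind xmin xmax v w i).
  by apply/funext => i; rewrite upwind_lin.
by rewrite wform_linl; [ring|move=> i; exact: contZ..].
Qed.

Lemma advb_exact v (w w' : R -> R) (psi : U) : (forall x, is_derive x (1 : R) w (w' x)) ->
  continuous w' -> w xmin = w xmax -> advb v (whole w) psi = v * ip (whole w') (tb psi).
Proof.
move=> dw cw' per; rewrite -[ip _ _]opprK -(ip_whole_bder psi dw cw' per) /advb weak_formE.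
have cw : continuous w.
  move=> y; apply: differentiable_continuous; apply/derivable1_diffP.
  exact: (@ex_derive _ _ _ _ _ _ _ (dw y)).
rewrite ip_Z//; last exact: bcont_bder.
rewrite mulrN mulrDr; congr (- (_ + _)); rewrite mulr_sumr; apply: eq_bigr => i _.
by rewrite upwindE mulrA; congr (_ * _); case: ifP; rewrite /trace_l /trace_r /whole ?node_periodic.
Qed.

Lemma advb_perr v kd w psi : continuous w ->
  advb v (perr kd w) psi = - \sum_i upwind xmin xmax v (perr kd w) i * jump (tb psi) i.
Proof.
move=> cw; rewrite /advb weak_formE ip_Z; [|exact: bcont_perr|exact: bcont_bder].
by rewrite (perr_orth xab N0 Cinv0 Chinv0 inv)// mulr0 add0r.
Qed.

End TestedForms.

(** * Young bounds for tested derivatives and projection errors *)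

Section YoungBounds.
Variables (R : realType) (m : model) (xmin xmax : R) (k N : nat) (Cinv Chinv T : R).
Hypotheses (xab : xmin < xmax) (N0 : (0 < N)%N)
  (Cinv0 : 0 < Cinv) (Chinv0 : 0 < Chinv)
  (inv : inverse_inequalities k Cinv Chinv).
Variable u : R -> R -> R -> R.
Hypothesis su : smooth m T u.
Local Notation U := (Uh R k N).
Local Notation B := (broken R N).
Local Notation h := (mesh_size xmin xmax N).
Local Notation ip := (@ip R xmin xmax N).
Local Notation tb := (@to_broken R k N).
Local Notation jump := (@jump R xmin xmax N).
Local Notation fvg := (@flux_vg R xmin xmax N).
Local Notation wfl := (@wfl R xmin xmax k N).
Local Notation adv := (@adv R xmin xmax k N).
Local Notation advb := (@advb R xmin xmax k N).
Local Notation perr := (@perr R xmin xmax k N).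
Local Notation projU := (@projU R xmin xmax k N).
Local Notation avg := (avg m).
Local Notation Om := (@Omega_v R m).
Local Notation Kerr := (Kerr k Cinv Chinv).
Local Notation Gen := (@Gen R m xmin xmax k N).
Local Notation Jen := (@Jen R m xmin xmax k N).
Local Notation whole := (@whole R N).

Let h0 : 0 < h := h_gt0 xab N0.

Lemma avg_abs_le (f g : R -> R) : vint m f -> vint m g ->
  (forall v, Om v -> `|f v| <= g v) -> `|avg f| <= avg g.
Proof.
move=> fi gi fg; rewrite ler_norml -mulN1r -avgZ//; apply/andP; split.
  apply: avg_le => //; first exact: vintZ.
  by move=> v /fg; rewrite ler_norml mulN1r => /andP[].
by apply: avg_le => // v /fg; rewrite ler_norml => /andP[].
Qed.

Lemma ip_young_abs (th : R) (p q : B) : 0 < th -> bcont p -> bcont q ->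
  `|ip p q| <= th / 2 * ip p p + (2 * th)^-1 * ip q q.
Proof.
move=> th0 cp cq; rewrite ler_norml; apply/andP; split; last exact: ip_young.
have cn : bcont (fun i x => -1 * p i x) by move=> i; exact: contZ.
have := ip_young xmin xmax th0 cn cq.
rewrite (ip_Z xmin xmax _ cp cn) (ip_sym _ _ p) !ip_Z//.
by lra.
Qed.

Lemma sum_young_abs (J : finType) (th : R) (a b : J -> R) : 0 < th ->
  `|\sum_j a j * b j| <= th / 2 * (\sum_j a j ^+ 2) + (2 * th)^-1 * (\sum_j b j ^+ 2).
Proof.
move=> th0; rewrite ler_norml; apply/andP; split; last exact: sum_young.
have := sum_young (fun j => - a j) b th0.
under eq_bigr do rewrite mulNr; under [X in _ <= th / 2 * X + _]eq_bigr do rewrite sqrrN.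
by rewrite sumrN lerNl.
Qed.

Lemma ip_whole_self (w : R -> R) : continuous w -> ip (whole w) (whole w) = I xmin xmax (fun x => w x ^+ 2).
Proof.
move=> cw; rewrite -(sum_cells xab N0 (contX2 cw)); apply: eq_bigr => i _.
by apply: eq_I => x _; rewrite expr2.
Qed.

Definition normsq w t : R := avg (fun v => I xmin xmax (fun x => jet T u w x v t ^+ 2)).

Lemma vint_normsq w t : 0 <= t <= T -> vint m (fun v => I xmin xmax (fun x => jet T u w x v t ^+ 2)).
Proof.
move=> tT; apply/vint_vL2/vL2_unif/vunif_I; first exact: ltW.
by apply: (nice_M (W := fun x v => jet T u w x v t)); exact: jet_nice_at.
Qed.

Lemma normsq_ge0 w t : 0 <= normsq w t.
Proof. by apply: avg_ge0 => v _; apply: I_ge0 => x _; exact: sqr_ge0. Qed.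

Definition highx (w : seq direction) := nseq k.+1 DirX ++ w.

Section FixedTime.
Variables (w : seq direction) (t : R) (xi : R -> U).
Hypotheses (tT : 0 <= t <= T) (xi2 : UL2 m xi).
Local Notation W v := (fun x => jet T u w x v t).

Let nW : nice m (fun x v => jet T u w x v t).
Proof. exact: jet_nice_at. Qed.

Let cW v : Om v -> continuous (W v).
Proof. by move=> Ov; exact: (jet_cont su). Qed.

Let chain v (Ov : Om v) j (_ : (j <= k)%N) (x : R) :
  is_derive x (1 : R) (fun y => jet T u (nseq j DirX ++ w) y v t)
     (jet T u (nseq j.+1 DirX ++ w) x v t) := jet_chain su w Ov tT j x.

Let chigh v : Om v -> continuous (fun x => jet T u (nseq k.+1 DirX ++ w) x v t).
Proof. by move=> Ov; exact: (jet_cont su). Qed.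

Lemma vint_ip_whole : vint m (fun v => ip (whole (W v)) (tb (xi v))).
Proof.
apply: (@vint_pairing _ _ xmin xmax _ _ (fun w psi => ip (whole w) (tb psi))) => //; first exact: ltW.
- by move=> p cp; apply: lin_ip => i.
- by move=> psi; apply: (bounded_form_whole xab N0); exact: bcont_tb.
Qed.

Lemma vint_ip_perr kd : vint m (fun v => ip (perr kd (W v)) (tb (xi v))).
Proof.
apply: (@vint_pairing _ _ xmin xmax _ _ (fun w psi => ip (perr kd w) (tb psi))) => //; first exact: ltW.
- by move=> p cp; apply: lin_ip; exact: bcont_perr.
- by move=> psi; apply: (bounded_form_perr xab N0 Cinv0 Chinv0 inv); exact: bcont_tb.
Qed.

Lemma vint_wfl_whole fl : vint m (fun v => wfl fl (whole (W v)) (xi v)).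
Proof.
apply: (@vint_pairing _ _ xmin xmax _ _ (fun w psi => wfl fl (whole w) psi)) => //; first exact: ltW.
- by move=> p cp; apply: lin_wform => i.
- by move=> psi; exact: (bounded_form_wfl xab N0).
Qed.

Lemma UL2_proj kd : UL2 m (fun v => projU kd (W v)).
Proof. exact: (UL2_projU xab N0 Cinv0 Chinv0 inv). Qed.

Lemma vint_wfl_tb fl (g : R -> U) : UL2 m g -> vint m (fun v => wfl fl (tb (g v)) (xi v)).
Proof.
move=> g2; apply: (@UL2_bilin _ _ _ _ (fun p q => wfl fl (tb p) q)) => //.
- by move=> q; exact: lin_wfl.
- by move=> p; apply: lin_wform; exact: bcont_tb.
Qed.

Lemma wfl_projU fl kd v : Om v ->
  wfl fl (tb (projU kd (W v))) (xi v) = wfl fl (whole (W v)) (xi v) - wfl fl (perr kd (W v)) (xi v).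
Proof.
move=> Ov; have cp : bcont (perr kd (W v)) by apply: bcont_perr; exact: cW.
have cw : bcont (whole (W v)) by move=> i; exact: cW.
have := wfl_linl xmin xmax fl (-1) (xi v) cp cw; rewrite mulN1r addrC => <-.
by congr (wfl _ _ _); apply/funext => i; apply/funext => x; rewrite /perr /whole; ring.
Qed.

Lemma ip_projU kd v : Om v ->
  ip (tb (projU kd (W v))) (tb (xi v)) = ip (whole (W v)) (tb (xi v)) - ip (perr kd (W v)) (tb (xi v)).
Proof.
move=> Ov; have cp : bcont (perr kd (W v)) by apply: bcont_perr; exact: cW.
have cw : bcont (whole (W v)) by move=> i; exact: cW.
have := ip_lin xmin xmax (-1) cp cw (@bcont_tb R k N (xi v)); rewrite mulN1r addrC => <-.
by apply: eq_ip => // i x _; rewrite /perr /whole; ring.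
Qed.

Lemma advb_projU kd v : Om v ->
  adv v (projU kd (W v)) (xi v) = advb v (whole (W v)) (xi v) - advb v (perr kd (W v)) (xi v).
Proof.
move=> Ov; have cp : bcont (perr kd (W v)) by apply: bcont_perr; exact: cW.
have cw : bcont (whole (W v)) by move=> i; exact: cW.
have := advb_lin xmin xmax v (-1) (xi v) cp cw; rewrite mulN1r addrC => <-.
rewrite /adv /advb; congr (- weak_form _ _ _ _).
  by apply/funext => i; apply/funext => x; rewrite /perr /whole; ring.
apply/funext => i; congr (upwind _ _ _ _ _).
by apply/funext => j; apply/funext => x; rewrite /perr /whole; ring.
Qed.

Lemma vint_wfl_perr fl kd : vint m (fun v => wfl fl (perr kd (W v)) (xi v)).
Proof.
have H := vintB (vint_wfl_whole fl) (vint_wfl_tb fl (UL2_proj kd)).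
by apply: (vint_ext _ H) => v Ov; rewrite wfl_projU//; ring.
Qed.

Lemma tested_ip_le (th : R) : 0 < th ->
  `|avg (fun v => ip (whole (W v)) (tb (xi v)))| <= th / 2 * normsq w t + (2 * th)^-1 * Gen xi.
Proof.
move=> th0; have i1 := vint_normsq w tT; have i2 := vint_ip xmin xmax xi2 xi2.
rewrite /normsq /Gen -(avgZ _ i1) -(avgZ _ i2) -(avgD (vintZ _ i1) (vintZ _ i2)).
apply: avg_abs_le; first exact: vint_ip_whole.
  by apply: vintD; exact: vintZ.
move=> v Ov; rewrite -(ip_whole_self (cW Ov)).
by apply: ip_young_abs => //; [move=> i; exact: cW|exact: bcont_tb].
Qed.

Lemma tested_perr_le kd (th : R) : 0 < th ->
  `|avg (fun v => ip (perr kd (W v)) (tb (xi v)))| <=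
    th / 2 * (Kerr * (h ^+ (2 * k + 2) * normsq (highx w) t)) + (2 * th)^-1 * Gen xi.
Proof.
move=> th0; have i1 := vint_normsq (highx w) tT; have i2 := vint_ip xmin xmax xi2 xi2.
rewrite [th / 2 * _]mulrA mulrA -[_ * h ^+ _ * _]mulrA.
rewrite /normsq /Gen -!(avgZ _ i1) -(avgZ _ (vintZ _ i1)) -(avgZ _ i2) -(avgD (vintZ _ (vintZ _ i1)) (vintZ _ i2)).
apply: avg_abs_le; first exact: vint_ip_perr.
  by apply: vintD; [exact/vintZ/vintZ|exact: vintZ].
move=> v Ov; have cp : bcont (perr kd (W v)) by apply: bcont_perr; exact: cW.
apply: le_trans (ip_young_abs th0 cp (@bcont_tb R k N (xi v))) _; rewrite lerD2r -[leRHS]mulrA ler_wpM2l//.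
  by rewrite divr_ge0// ltW.
exact: (perr_norm xab N0 Cinv0 Chinv0 inv (chain Ov) (chigh Ov) kd).
Qed.

Lemma avg_jump_sq_le : avg (fun v => jump_sq xmin xmax (xi v)) <= 4 * Cinv / h * Gen xi.
Proof.
have i2 := vint_ip xmin xmax xi2 xi2.
rewrite /Gen -(avgZ _ i2); apply: avg_le; [|exact: vintZ|].
  apply: vint_sum => i; apply: vintM; exact: (UL2_form (lin_jump xmin xmax i)).
move=> v _; have := jump_bound xab N0 inv (xi v).
set X := ip _ _ => H.
have -> : 4 * Cinv / h * X = (4 * Cinv * X) / h by ring.
by rewrite ler_pdivlMr// mulrC.
Qed.

(** The jumps of [xi] are paid by the inverse inequality, at the price $1/h$. Together with the
    order $h^{2k+1}$ of the squared traces this gives $h^{2k}$, the order lost with central fluxes.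
    Using the jump dissipation instead would bring in $1/\varepsilon$, since that dissipation
    carries a factor $\varepsilon$. *)
Lemma tested_flux_perr_le fl (th : R) : 0 < th ->
  `|avg (fun v => v * wfl fl (perr (flux_kind fl) (W v)) (xi v))| <=
    th / 2 * (Kerr * (h ^+ (2 * k + 1) * normsq (highx w) t)) + (2 * th)^-1 * (4 * Cinv / h * Gen xi).
Proof.
move=> th0; have i1 := vint_normsq (highx w) tT.
have i3 : vint m (fun v => jump_sq xmin xmax (xi v)).
  apply: vint_sum => i; apply: vintM; exact: (UL2_form (lin_jump xmin xmax i)).
have th1 : 0 <= (2 * th)^-1 by rewrite invr_ge0 mulr_ge0// ltW.
have th2 : 0 <= th / 2 by rewrite divr_ge0// ltW.
apply: (@le_trans _ _ (th / 2 * (Kerr * (h ^+ (2 * k + 1) * normsq (highx w) t)) + (2 * th)^-1 * avg (fun v => jump_sq xmin xmax (xi v)))); last first.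
  by rewrite lerD2l ler_wpM2l// avg_jump_sq_le.
rewrite [th / 2 * _]mulrA mulrA -[_ * h ^+ _ * _]mulrA.
rewrite /normsq -!(avgZ _ i1) -(avgZ _ (vintZ _ i1)) -(avgZ _ i3) -(avgD (vintZ _ (vintZ _ i1)) (vintZ _ i3)).
apply: avg_abs_le.
- have xv2 := UL2_idZ xi2.
  have H := vintB
    (@vint_pairing _ _ xmin xmax _ _ (fun w psi => wfl fl (whole w) psi) _ (ltW xab)
      (fun p cp => lin_wform xmin xmax (fvg fl (whole p)) (fun i => cp)) (bounded_form_wfl xab N0 fl) xv2 _ nW)
    (@UL2_bilin _ _ _ _ (fun p q => wfl fl (tb p) q) _ _ (fun q => lin_wfl xmin xmax fl q)
      (fun p => lin_wform xmin xmax (fvg fl (tb p)) (@bcont_tb R k N p)) (UL2_proj (flux_kind fl)) xv2).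
  apply: (vint_ext _ H) => v Ov.
  rewrite [wfl _ (whole _) _](linZ (lin_wform _ _ _ (fun i => cW Ov))).
  rewrite [wfl _ (tb _) _](linZ (lin_wform _ _ _ (@bcont_tb R k N _))).
  by rewrite -!/(wfl _ _ _) wfl_projU//; ring.
- by apply: vintD; [exact/vintZ/vintZ|exact: vintZ].
move=> v Ov; rewrite (wfl_perr xab N0 Cinv0 Chinv0 inv fl (xi v) (cW Ov)) normrM.
apply: (@le_trans _ _ (1 * `|\sum_i fvg fl (perr (flux_kind fl) (W v)) i * jump (tb (xi v)) i|)).
  by rewrite ler_wpM2r// (Omega_abs Ov).
rewrite mul1r; apply: le_trans (sum_young_abs _ _ th0) _; rewrite lerD2r -[leRHS]mulrA ler_wpM2l//.
exact: (perr_fvg xab N0 Cinv0 Chinv0 inv (chain Ov) (chigh Ov) fl).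
Qed.

(** Here the flux is upwind and the term comes with a factor $\varepsilon$ in the equation, so the
    jump dissipation has the right size. The weight [th / |v|] depends on the velocity, so that the
    squared jumps appear with the factor [|v|] of [Jen]. *)
Lemma tested_advb_perr_le kd (th : R) : 0 < th ->
  (forall v, Om v -> jet T u w xmin v t = jet T u w xmax v t) ->
  `|avg (fun v => advb v (perr kd (W v)) (xi v))| <=
    th / 2 * (Kerr * (h ^+ (2 * k + 1) * normsq (highx w) t)) + (2 * th)^-1 * Jen xi.
Proof.
move=> th0 per; have i1 := vint_normsq (highx w) tT.
have i3 := vint_jump_sq xmin xmax xi2.
rewrite [th / 2 * _]mulrA mulrA -[_ * h ^+ _ * _]mulrA.
rewrite /normsq /Jen -!(avgZ _ i1) -(avgZ _ (vintZ _ i1)) -(avgZ _ i3) -(avgD (vintZ _ (vintZ _ i1)) (vintZ _ i3)).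
apply: avg_abs_le.
(* Integrability in [v] is obtained from a difference: by consistency, the form on the exact
   function is a plain integral of its [x] derivative against [v *: xi v], and the form on the
   projection is discrete. *)
- have H1 : vint m (fun v => ip (whole (fun x => jet T u (DirX :: w) x v t)) (tb (v *: xi v))).
    apply: (@vint_pairing _ _ xmin xmax _ _ (fun w psi => ip (whole w) (tb psi)) _ (ltW xab)).
    + by move=> p cp; apply: lin_ip => i.
    + by move=> psi; apply: (bounded_form_whole xab N0); exact: bcont_tb.
    + exact: UL2_idZ.
    + exact: jet_nice_at.
  have H := vintB H1 (vint_adv xmin xmax (UL2_proj kd) xi2).
  apply: (vint_ext _ H) => v Ov; rewrite advb_projU//.
  have lx : lin (fun psi : U => ip (whole (fun x => jet T u (DirX :: w) x v t)) (tb psi)).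
    by apply: lin_ip => i; exact: (jet_cont su).
  rewrite (advb_exact xab N0 v (xi v) (fun x => jet_is_derive su w x Ov tT) _ (per v Ov)).
    by rewrite (linZ lx); ring.
  exact: (jet_cont su).
- by apply: vintD; [exact/vintZ/vintZ|exact: vintZ].
move=> v Ov; rewrite (advb_perr xab N0 Cinv0 Chinv0 inv v kd (xi v) (cW Ov)) normrN.
have UB := perr_upwind xab N0 Cinv0 Chinv0 inv (chain Ov) (chigh Ov) kd v.
move: UB; rewrite /seminorm2; set E := Kerr * _ => UB.
have -> : th / 2 * Kerr * (h ^+ (2 * k + 1) * I xmin xmax (fun x => jet T u (highx w) x v t ^+ 2)) = th / 2 * E.
  by rewrite -mulrA.
have E0 : 0 <= E.
  rewrite /E mulr_ge0//; first by apply: le_trans (Kerr_ge1 k Cinv0 Chinv0).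
  by rewrite mulr_ge0 ?exprn_ge0 ?(ltW h0)//; apply: I_ge0 => x _; exact: sqr_ge0.
have J0 := jump_sq_ge0 xmin xmax (xi v).
have [v0|v0] := eqVneq v 0.
  rewrite big1; last by move=> i _; rewrite /upwind v0 normr0 !mul0r subrr mul0r.
  rewrite normr0 v0 normr0 mul0r mulr0 addr0; apply: mulr_ge0 => //.
  by apply: divr_ge0 => //; exact: ltW.
have va : 0 < `|v| by rewrite normr_gt0.
have tv : 0 < th / `|v| by rewrite divr_gt0.
apply: le_trans (sum_young_abs _ _ tv) _.
have -> : (2 * (th / `|v|))^-1 = (2 * th)^-1 * `|v| by field; rewrite !gt_eqF.
rewrite -[(2 * th)^-1 * `|v| * _]mulrA lerD2r.
apply: le_trans (ler_wpM2l _ UB) _; first by rewrite divr_ge0// ltW.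
have -> : th / `|v| / 2 * (v ^+ 2 * E) = th / 2 * (`|v| * E).
  by rewrite -[v ^+ 2]real_normK ?num_real//; field; rewrite gt_eqF.
rewrite ler_wpM2l ?divr_ge0 ?(ltW th0)//.
by rewrite -[leRHS]mul1r ler_wpM2r// (Omega_abs Ov).
Qed.

End FixedTime.

End YoungBounds.

(** This transfers periodicity from $\rho$ to $\partial_t\rho$. The derivative is one-sided at the
    ends of $[0,T]$, so the comparison time [s] is taken on the side of [t] where at least [T / 2]
    is left. *)
Lemma time_derivative_unique (R : realType) (m : model) (T : R) (D Dt : R -> R -> R -> R) x y v t :
  0 < T -> time_derivative m T D Dt -> Omega_v m v -> 0 <= t <= T ->
  (forall s, 0 <= s <= T -> D x v s = D y v s) -> Dt x v t = Dt y v t.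
Proof.
move=> T0 DDt Ov tT E; apply/eqP; rewrite -subr_eq0 -normr_le0; apply/ler_addgt0Pr => e e0.
rewrite add0r.
have e20 : 0 < e / 2 by rewrite divr_gt0.
have [d d0 Hd] := time_derivative_rate x DDt Ov tT e20.
have [d' d0' Hd'] := time_derivative_rate y DDt Ov tT e20.
have [s sT [st [sd sd']]] : exists2 s, 0 <= s <= T & s != t /\ (`|s - t| < d /\ `|s - t| < d').
  have /andP[t0 t1] := tT.
  pose r := Num.min (Num.min d d') (T / 2) / 2.
  have r0 : 0 < r by rewrite divr_gt0// !lt_min d0 d0' divr_gt0.
  have rd : r * 2 <= Num.min (Num.min d d') (T / 2) by rewrite divfK.
  move: rd; rewrite !le_min => /andP[/andP[rd rd'] rT].
  have [tl|tg] := leP t (T / 2).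
    exists (t + r); first by apply/andP; split; lra.
    rewrite addrAC subrr add0r gtr0_norm//; split; first by rewrite gt_eqF// ltrDl.
    by split; lra.
  exists (t - r); first by apply/andP; split; lra.
  rewrite addrAC subrr add0r normrN gtr0_norm//; split; first by rewrite lt_eqF// gtrBl.
  by split; lra.
have H1 := Hd s sT sd; have H2 := Hd' s sT sd'.
rewrite -!E// in H2.
have st0 : 0 < `|s - t| by rewrite normr_gt0 subr_eq0.
rewrite -(ler_pM2l st0) -normrM.
rewrite (_ : (s - t) * _ = (D x v s - D x v t - (s - t) * Dt y v t) - (D x v s - D x v t - (s - t) * Dt x v t)); last by ring.
apply: le_trans (ler_normB _ _) _; rewrite [leRHS]mulrC.
by move: H1 H2; move: `|_ - (s - t) * Dt y v t| `|_ - (s - t) * Dt x v t| `|s - t| => a b c; lra.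
Qed.

Lemma avg_id0 (R : realType) (m : model) : avg m (fun v : R => v) = 0.
Proof.
case: m => /=; first by rewrite addNr mul0r.
rewrite /avg.
have D (v : R) : is_derive v (1 : R) (fun v : R => 2^-1 * v ^+ 2) v.
  apply: is_derive_eq.
  by rewrite /GRing.scale/=; field.
have id_cont : continuous (fun v : R => v) by move=> v; exact: cvg_id.
have N1 : (-1 : R) <= 1 by lra.
by rewrite (I_FTC N1 id_cont D) sqrrN subrr mulr0.
Qed.

Lemma avg_combination (R : realType) (m : model) (a b : R) (f1 f2 f3 f4 f5 : R -> R) :
  vint m f1 -> vint m f2 -> vint m f3 -> vint m f4 -> vint m f5 -> avg m f5 = 0 ->
  a * avg m f1 + b * avg m f2 - avg m f3 + avg m f4 =
  avg m (fun v => (a * f1 v + b * (f2 v - f5 v) - f3 v) + f4 v).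
Proof.
move=> i1 i2 i3 i4 i5 f50; have i25 := vintB i2 i5.
rewrite (avgD (vintB (vintD (vintZ _ i1) (vintZ _ i25)) i3) i4).
rewrite (avgB (vintD (vintZ _ i1) (vintZ _ i25)) i3) (avgD (vintZ _ i1) (vintZ _ i25)).
by rewrite (avgZ _ i1) (avgZ _ i25) (avgB i2 i5) f50 subr0.
Qed.

Definition vconst (R : realType) (rho : R -> R -> R) : R -> R -> R -> R := fun x _ t => rho x t.

(** * The micro-macro system tested with discrete functions *)

Section ExactEquations.
Variables (R : realType) (m : model) (xmin xmax : R) (k N : nat) (Cinv Chinv T eps : R).
Variables (rho : R -> R -> R) (g : R -> R -> R -> R).
Hypotheses (xab : xmin < xmax) (N0 : (0 < N)%N)
  (Cinv0 : 0 < Cinv) (Chinv0 : 0 < Chinv)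
  (inv : inverse_inequalities k Cinv Chinv)
  (T0 : 0 < T) (eps0 : 0 < eps)
  (sol : smooth_solution m xmin xmax eps T rho g).
Local Notation U := (Uh R k N).
Local Notation h := (mesh_size xmin xmax N).
Local Notation ip := (@ip R xmin xmax N).
Local Notation tb := (@to_broken R k N).
Local Notation wfl := (@wfl R xmin xmax k N).
Local Notation avg := (avg m).
Local Notation Om := (@Omega_v R m).
Local Notation whole := (@whole R N).
Local Notation r_ := (vconst rho).

Let h0 : 0 < h := h_gt0 xab N0.

Lemma smooth_rho : smooth m T r_. Proof. by case: sol. Qed.
Lemma smooth_g : smooth m T g. Proof. by case: sol => _ []. Qed.
Let sr := smooth_rho.
Let sg := smooth_g.

Lemma rho_periodic v t : 0 <= t <= T -> jet T r_ [::] xmin v t = jet T r_ [::] xmax v t.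
Proof.
case: sol => _ [_ [H _]] tT; have := H xmin t tT.
by rewrite addrC subrK.
Qed.

Lemma g_periodic v t : Om v -> 0 <= t <= T -> jet T g [::] xmin v t = jet T g [::] xmax v t.
Proof.
case: sol => _ [_ [_ [H _]]] Ov tT; have := H xmin v t Ov tT.
by rewrite addrC subrK.
Qed.

Lemma rho_t_periodic v t : Om v -> 0 <= t <= T ->
  jet T r_ [:: DirT] xmin v t = jet T r_ [:: DirT] xmax v t.
Proof.
move=> Ov tT; refine (@time_derivative_unique R m T (jet T r_ [::]) (jet T r_ [:: DirT]) xmin xmax v t T0 (@jet_time _ _ _ _ sr [::]) Ov tT _) => s sT.
exact: rho_periodic.
Qed.

Lemma avg_g x t : 0 <= t <= T -> avg (fun v => jet T g [::] x v t) = 0.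
Proof. by case: sol => _ [_ [_ [_ [H _]]]]; exact: H. Qed.

Lemma nice_vM (W : R -> R -> R) : nice m W -> nice m (fun x v => v * W x v).
Proof. by move=> nW; apply: (nice_M (nice_v m) nW). Qed.

Lemma rho_equation x v t : 0 <= t <= T ->
  jet T r_ [:: DirT] x v t = - avg (fun w => w * jet T g [:: DirX] x w t).
Proof.
move=> tT; case: sol => _ [_ [_ [_ [_ [H _]]]]]; have := H x t tT.
have D := @is_derive_avg R m (fun y w => w * jet T g [::] y w t) (fun y w => w * jet T g [:: DirX] y w t) x
  (nice_vM (jet_nice_at sg [::] tT)) (nice_vM (jet_nice_at sg [:: DirX] tT)) _.
have {}D : is_derive x (1 : R) (fun y => avg (fun w => w * jet T g [::] y w t)) (avg (fun w => w * jet T g [:: DirX] x w t)).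
  apply: D => y w Ow; have H1 := jet_is_derive sg [::] y Ow tT.
  have := is_deriveZ w H1; exact.
have E : dx (fun y s => avg (fun v0 => v0 * g y v0 s)) x t = avg (fun w => w * jet T g [:: DirX] x w t).
  by rewrite /dx derive1E; exact: (@derive_val _ _ _ _ _ _ _ D).
by rewrite E => /eqP; rewrite addr_eq0 => /eqP.
Qed.

Lemma g_equation x v t : Om v -> 0 <= t <= T ->
  eps ^+ 2 * jet T g [:: DirT] x v t +
   eps * (v * jet T g [:: DirX] x v t - avg (fun w => w * jet T g [:: DirX] x w t)) +
   v * jet T r_ [:: DirX] x v t + jet T g [::] x v t = 0.
Proof.
move=> Ov tT; case: sol => _ [_ [_ [_ [_ [_ H]]]]].
have key (a b c d e : R) : a + eps^-1 * (b - c) + (eps ^+ 2)^-1 * d = - (eps ^+ 2)^-1 * e ->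
    eps ^+ 2 * a + eps * (b - c) + d + e = 0.
  move=> E.
  have -> : eps ^+ 2 * a + eps * (b - c) + d + e = eps ^+ 2 * (a + eps^-1 * (b - c) + (eps ^+ 2)^-1 * d - (- (eps ^+ 2)^-1 * e)).
    by field; rewrite gt_eqF.
  by rewrite E subrr mulr0.
exact: key (H x v t Ov tT).
Qed.

Section Tested.
Variable t : R.
Hypothesis tT : 0 <= t <= T.
Local Notation gw w v := (fun x => jet T g w x v t).
Local Notation rw w v := (fun x => jet T r_ w x v t).

Let cg w v : Om v -> continuous (gw w v).
Proof. by move=> Ov; exact: (jet_cont sg). Qed.
Let cr w v : Om v -> continuous (rw w v).
Proof. by move=> Ov; exact: (jet_cont sr). Qed.

Lemma wfl_g fl v psi : Om v -> wfl fl (whole (gw [::] v)) psi = - ip (whole (gw [:: DirX] v)) (tb psi).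
Proof.
move=> Ov; apply: (wfl_exact xab N0 fl psi (fun x => jet_is_derive sg [::] x Ov tT) _ (g_periodic Ov tT)).
exact: cg.
Qed.

Lemma wfl_rho fl v psi : Om v -> wfl fl (whole (rw [::] v)) psi = - ip (whole (rw [:: DirX] v)) (tb psi).
Proof.
move=> Ov; apply: (wfl_exact xab N0 fl psi (fun x => jet_is_derive sr [::] x Ov tT) _ (rho_periodic v tT)).
exact: cr.
Qed.

Lemma wfl_rho_t fl v psi : Om v ->
  wfl fl (whole (rw [:: DirT] v)) psi = - ip (whole (rw [:: DirX; DirT] v)) (tb psi).
Proof.
move=> Ov; apply: (wfl_exact xab N0 fl psi (fun x => jet_is_derive sr [:: DirT] x Ov tT) _ (rho_t_periodic Ov tT)).
exact: cr.
Qed.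

Lemma tested_rho_equation fl (phi : U) :
  avg (fun v => ip (whole (rw [:: DirT] v)) (tb phi)) =
  avg (fun v => v * wfl fl (whole (gw [::] v)) phi).
Proof.
transitivity (ip (whole (fun x => -1 * avg (fun w => w * jet T g [:: DirX] x w t))) (tb phi)).
  rewrite -[RHS](avg_cst m); apply: avg_ext => v _; apply: eq_ip => // i x _.
  by rewrite /whole rho_equation// mulN1r.
have nvg := nice_vM (jet_nice_at sg [:: DirX] tT).
have cv := cont_avg nvg.
rewrite (ip_Z xmin xmax (-1) (u := whole (fun x => avg (fun w => w * jet T g [:: DirX] x w t)))); last 2 first.
- by move=> i.
- exact: bcont_tb.
rewrite -(avg_ip xab N0 nvg (@bcont_tb R k N phi)) -avgZ; last first.
  apply: (@vint_pairing _ _ xmin xmax _ _ (fun w (psi : U) => ip (whole w) (tb psi)) (fun=> phi) (ltW xab) _ _ (UL2_cst m phi) _ nvg).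
  + by move=> p cp; apply: lin_ip => i.
  + by move=> psi; apply: (bounded_form_whole xab N0); exact: bcont_tb.
apply: avg_ext => v Ov; rewrite wfl_g// mulrN mulN1r; congr (- _).
rewrite -ip_Z//; last exact: bcont_tb.
by move=> i; exact: cg.
Qed.

(** The term $\langle v\partial_xg\rangle$, named [q], does not depend on [v] and pairs to zero with
    a test function of zero mean. It is inserted through [avg_combination] to recover the pointwise
    equation under the average. *)
Lemma tested_g_equation fl (xi : R -> U) : UL2 m xi -> vmean m (fun=> 1) xi = 0 ->
  eps ^+ 2 * avg (fun v => ip (whole (gw [:: DirT] v)) (tb (xi v))) +
  eps * avg (fun v => v * ip (whole (gw [:: DirX] v)) (tb (xi v)))
  - avg (fun v => wfl fl (whole (rw [::] v)) (v *: xi v))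
  + avg (fun v => ip (whole (gw [::] v)) (tb (xi v))) = 0.
Proof.
move=> x2 x0; have xv2 := UL2_idZ x2.
pose q x := avg (fun w => w * jet T g [:: DirX] x w t).
have nvg := nice_vM (jet_nice_at sg [:: DirX] tT).
have cq : continuous q := cont_avg nvg.
have q0 : avg (fun v => ip (whole q) (tb (xi v))) = 0.
  have ll : lin (fun psi : U => ip (whole q) (tb psi)) by apply: lin_ip => i.
  have := avg_vmean ll (vL2_cst m 1) x2; rewrite x0 (lin0 ll) => <-.
  by apply: avg_ext => v _; rewrite mul1r.
have i1 := vint_ip_whole xab N0 sg [:: DirT] tT x2.
have i2 : vint m (fun v => v * ip (whole (gw [:: DirX] v)) (tb (xi v))).
  apply: (vint_ext _ (vint_ip_whole xab N0 sg [:: DirX] tT xv2)) => v Ov.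
  have ll : lin (fun psi : U => ip (whole (gw [:: DirX] v)) (tb psi)) by apply: lin_ip => i; exact: cg.
  by rewrite (linZ ll).
have i3 := vint_wfl_whole xab N0 sr [::] tT xv2 fl.
have i4 := vint_ip_whole xab N0 sg [::] tT x2.
have i5 : vint m (fun v => ip (whole q) (tb (xi v))).
  have ll : lin (fun psi : U => ip (whole q) (tb psi)) by apply: lin_ip => i.
  exact/vint_vL2/(UL2_form ll).
rewrite (avg_combination (eps ^+ 2) eps i1 i2 i3 i4 i5 q0).
rewrite -[RHS](avg_cst m); apply: avg_ext => v Ov.
have c1 : bcont (whole (gw [:: DirT] v)) by move=> i; exact: cg.
have c2 : bcont (whole (gw [:: DirX] v)) by move=> i; exact: cg.
have c3 : bcont (whole (rw [:: DirX] v)) by move=> i; exact: cr.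
have c4 : bcont (whole (gw [::] v)) by move=> i; exact: cg.
have c5 : bcont (whole q) by move=> i.
have cb := @bcont_tb R k N (xi v).
have ll3 : lin (fun psi : U => ip (whole (rw [:: DirX] v)) (tb psi)) by apply: lin_ip.
rewrite wfl_rho// (linZ ll3).
have c45 : bcont (fun i x => v * whole (rw [:: DirX] v) i x + whole (gw [::] v) i x).
  by move=> i; apply: contD; [exact: contZ|exact: c4].
have c5' : bcont (fun i x => (- eps) * whole q i x + (v * whole (rw [:: DirX] v) i x + whole (gw [::] v) i x)).
  by move=> i; apply: contD; [exact: contZ|exact: c45].
have c6 : bcont (fun i x => (eps * v) * whole (gw [:: DirX] v) i x + ((- eps) * whole q i x + (v * whole (rw [:: DirX] v) i x + whole (gw [::] v) i x))).
  by move=> i; apply: contD; [exact: contZ|exact: c5'].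
have E := ip_lin xmin xmax (eps ^+ 2) c1 c6 cb.
rewrite (ip_lin xmin xmax (eps * v) c2 c5' cb) (ip_lin xmin xmax (- eps) c5 c45 cb) (ip_lin xmin xmax v c3 c4 cb) in E.
have Z : ip (fun i x => eps ^+ 2 * whole (gw [:: DirT] v) i x + ((eps * v) * whole (gw [:: DirX] v) i x + ((- eps) * whole q i x + (v * whole (rw [:: DirX] v) i x + whole (gw [::] v) i x)))) (tb (xi v)) = 0.
  rewrite /Defs.ip big1// => i _; rewrite (@eq_I _ _ _ _ (fun=> 0)); first by rewrite Rintegral_cst// mul0r.
  move=> x _; rewrite -[RHS](mul0r (tb (xi v) i x)); congr (_ * _).
  rewrite -[RHS](g_equation x Ov tT) /whole /q.
  move: (avg _) (jet T g [:: DirT] x v t) (jet T g [:: DirX] x v t) (jet T r_ [:: DirX] x v t) (jet T g [::] x v t) => a1 a2 a3 a4 a5.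
  by ring.
rewrite Z in E.
move: E; move: (ip (whole (gw [:: DirT] v)) _) (ip (whole (gw [:: DirX] v)) _) (ip (whole q) _) (ip (whole (rw [:: DirX] v)) _) (ip (whole (gw [::] v)) _) => a1 a2 a3 a4 a5 E.
by rewrite [RHS]E; ring.
Qed.

End Tested.

End ExactEquations.

(** * Residuals of the projected exact solution *)

Section TimeIncrements.
Variables (R : realType) (m : model) (xmin xmax : R) (k N : nat) (Cinv Chinv T : R).
Hypotheses (xab : xmin < xmax) (N0 : (0 < N)%N)
  (Cinv0 : 0 < Cinv) (Chinv0 : 0 < Chinv)
  (inv : inverse_inequalities k Cinv Chinv).
Local Notation U := (Uh R k N).
Local Notation h := (mesh_size xmin xmax N).
Local Notation ip := (@ip R xmin xmax N).
Local Notation tb := (@to_broken R k N).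
Local Notation wfl := (@wfl R xmin xmax k N).
Local Notation advb := (@advb R xmin xmax k N).
Local Notation perr := (@perr R xmin xmax k N).
Local Notation avg := (avg m).
Local Notation Om := (@Omega_v R m).
Local Notation Kerr := (Kerr k Cinv Chinv).
Local Notation Gen := (@Gen R m xmin xmax k N).
Local Notation Jen := (@Jen R m xmin xmax k N).
Local Notation whole := (@whole R N).
Local Notation normsq := (@normsq R m xmin xmax T).

Let h0 : 0 < h := h_gt0 xab N0.

Definition test_ip (u : R -> R -> R -> R) w t (xi : R -> U) : R :=
  avg (fun v => ip (whole (fun x => jet T u w x v t)) (tb (xi v))).
Definition test_perr kd (u : R -> R -> R -> R) w t (xi : R -> U) : R :=
  avg (fun v => ip (perr kd (fun x => jet T u w x v t)) (tb (xi v))).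
Definition test_wfl fl (u : R -> R -> R -> R) w t (xi : R -> U) : R :=
  avg (fun v => wfl fl (whole (fun x => jet T u w x v t)) (xi v)).
Definition test_flux_perr fl (u : R -> R -> R -> R) w t (xi : R -> U) : R :=
  avg (fun v => v * wfl fl (perr (flux_kind fl) (fun x => jet T u w x v t)) (xi v)).
Definition test_advb_perr kd (u : R -> R -> R -> R) w t (xi : R -> U) : R :=
  avg (fun v => advb v (perr kd (fun x => jet T u w x v t)) (xi v)).

Lemma Kerr_h_ge0 n : 0 <= Kerr * h ^+ n.
Proof.
rewrite mulr_ge0//; first by apply: le_trans (Kerr_ge1 k Cinv0 Chinv0).
by rewrite exprn_ge0// ltW.
Qed.

Lemma Gen_idZ (xi : R -> U) : UL2 m xi -> Gen (fun v => v *: xi v) <= Gen xi.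
Proof.
move=> x2; apply: avg_le; [exact: vint_ip (UL2_idZ x2) (UL2_idZ x2)|exact: vint_ip|].
move=> v Ov; rewrite (linZ (lin_ipUl _ _ _)) (linZ (lin_ipUr _ _ _)) mulrA -expr2.
rewrite -[leRHS]mul1r ler_wpM2r ?ip_ge0//.
exact: le_trans (sqr_le_abs Ov) (Omega_abs Ov).
Qed.

Section Increments.
Variables (u : R -> R -> R -> R) (su : smooth m T u) (xi : R -> U) (xi2 : UL2 m xi) (Mb th : R) (th0 : 0 < th).
Variables (a b : R) (a0 : 0 <= a) (ab : a <= b) (bT : b <= T).

Let sT s : a <= s <= b -> 0 <= s <= T.
Proof. by move=> /andP[as_ sb]; rewrite (le_trans a0 as_) (le_trans sb bT). Qed.

Let th2 : 0 <= th / 2. Proof. by rewrite divr_ge0// ltW. Qed.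

Lemma test_ip_le w s : 0 <= s <= T -> normsq u w s <= Mb ->
  `|test_ip u w s xi| <= th / 2 * Mb + (2 * th)^-1 * Gen xi.
Proof.
move=> sT' H; apply: le_trans (tested_ip_le xab N0 su w sT' xi2 th0) _.
by rewrite lerD2r ler_wpM2l.
Qed.

Lemma test_perr_le kd w s : 0 <= s <= T -> normsq u (highx k w) s <= Mb ->
  `|test_perr kd u w s xi| <= th / 2 * (Kerr * h ^+ (2 * k + 2) * Mb) + (2 * th)^-1 * Gen xi.
Proof.
move=> sT' H; apply: le_trans (tested_perr_le xab N0 Cinv0 Chinv0 inv su w sT' xi2 kd th0) _.
by rewrite lerD2r ler_wpM2l// mulrA ler_wpM2l// Kerr_h_ge0.
Qed.

Lemma test_flux_perr_le fl w s : 0 <= s <= T -> normsq u (highx k w) s <= Mb ->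
  `|test_flux_perr fl u w s xi| <=
    th / 2 * (Kerr * h ^+ (2 * k + 1) * Mb) + (2 * th)^-1 * (4 * Cinv / h * Gen xi).
Proof.
move=> sT' H; apply: le_trans (tested_flux_perr_le xab N0 Cinv0 Chinv0 inv su w sT' xi2 fl th0) _.
by rewrite lerD2r ler_wpM2l// mulrA ler_wpM2l// Kerr_h_ge0.
Qed.

Lemma test_flux_perr_alternating fl w s : 0 <= s <= T -> alternating fl ->
  test_flux_perr fl u w s xi = 0.
Proof.
move=> sT' al; rewrite -[RHS](avg_cst m); apply: avg_ext => v Ov.
by rewrite (wfl_perr_alternating xab N0 Cinv0 Chinv0 inv)// ?mulr0//; exact: (jet_cont su).
Qed.

Lemma test_advb_perr_le kd w s : 0 <= s <= T -> normsq u (highx k w) s <= Mb ->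
  (forall v, Om v -> jet T u w xmin v s = jet T u w xmax v s) ->
  `|test_advb_perr kd u w s xi| <= th / 2 * (Kerr * h ^+ (2 * k + 1) * Mb) + (2 * th)^-1 * Jen xi.
Proof.
move=> sT' H per; apply: le_trans (tested_advb_perr_le xab N0 Cinv0 Chinv0 inv su sT' xi2 kd th0 per) _.
by rewrite lerD2r ler_wpM2l// mulrA ler_wpM2l// Kerr_h_ge0.
Qed.

Lemma test_ip_functional :
  nice_functional m xmin xmax (fun W => avg (fun v => ip (whole (fun x => W x v)) (tb (xi v)))).
Proof.
apply: (@pairing_functional _ _ _ _ _ _ (fun w (psi : U) => ip (whole w) (tb psi)) xi (ltW xab)) => //.
- by move=> p cp; apply: lin_ip => i.
- by move=> psi; apply: (bounded_form_whole xab N0); exact: bcont_tb.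
Qed.

Lemma test_perr_functional kd :
  nice_functional m xmin xmax (fun W => avg (fun v => ip (perr kd (fun x => W x v)) (tb (xi v)))).
Proof.
apply: (@pairing_functional _ _ _ _ _ _ (fun w (psi : U) => ip (perr kd w) (tb psi)) xi (ltW xab)) => //.
- by move=> p cp; apply: lin_ip; exact: bcont_perr.
- by move=> psi; apply: (bounded_form_perr xab N0 Cinv0 Chinv0 inv); exact: bcont_tb.
Qed.

Lemma test_wfl_functional fl :
  nice_functional m xmin xmax (fun W => avg (fun v => wfl fl (whole (fun x => W x v)) (xi v))).
Proof.
apply: (@pairing_functional _ _ _ _ _ _ (fun w (psi : U) => wfl fl (whole w) psi) xi (ltW xab)) => //.
- by move=> p cp; apply: lin_wform => i.
- by move=> psi; exact: (bounded_form_wfl xab N0).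
Qed.

Lemma test_ip_increment w : (forall s, 0 <= s <= T -> normsq u (DirT :: w) s <= Mb) ->
  `|test_ip u w b xi - test_ip u w a xi| <= (th / 2 * Mb + (2 * th)^-1 * Gen xi) * (b - a).
Proof.
move=> H; apply: (functional_lipschitz (jet_jet_nice su w) (jet_jet_nice su (DirT :: w))
  (@jet_time _ _ _ _ su w) test_ip_functional a0 ab bT) => s sab.
by apply: (@test_ip_le (DirT :: w) s (sT sab)); exact/H/sT.
Qed.

Lemma test_perr_increment kd w : (forall s, 0 <= s <= T -> normsq u (highx k (DirT :: w)) s <= Mb) ->
  `|test_perr kd u w b xi - test_perr kd u w a xi| <=
    (th / 2 * (Kerr * h ^+ (2 * k + 2) * Mb) + (2 * th)^-1 * Gen xi) * (b - a).
Proof.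
move=> H; apply: (functional_lipschitz (jet_jet_nice su w) (jet_jet_nice su (DirT :: w))
  (@jet_time _ _ _ _ su w) (test_perr_functional kd) a0 ab bT) => s sab.
by apply: (@test_perr_le kd (DirT :: w) s (sT sab)); exact/H/sT.
Qed.

Lemma test_ip_taylor w : (forall s, 0 <= s <= T -> normsq u [:: DirT, DirT & w] s <= Mb) ->
  `|test_ip u w b xi - test_ip u w a xi - (b - a) * test_ip u (DirT :: w) a xi| <=
    (th / 2 * Mb + (2 * th)^-1 * Gen xi) * (b - a) ^+ 2.
Proof.
move=> H; apply: (functional_second_order (jet_jet_nice su w) (jet_jet_nice su (DirT :: w))
  (jet_jet_nice su [:: DirT, DirT & w]) (@jet_time _ _ _ _ su w) (@jet_time _ _ _ _ su (DirT :: w))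
  test_ip_functional a0 ab bT) => s sab.
by apply: (@test_ip_le [:: DirT, DirT & w] s (sT sab)); exact/H/sT.
Qed.

End Increments.

End TimeIncrements.

Section Residuals.
Variables (R : realType) (m : model) (xmin xmax : R) (k N : nat) (Cinv Chinv T eps Mb : R).
Variables (rho : R -> R -> R) (g : R -> R -> R -> R) (fl : flux).
Hypotheses (xab : xmin < xmax) (N0 : (0 < N)%N)
  (Cinv0 : 0 < Cinv) (Chinv0 : 0 < Chinv)
  (inv : inverse_inequalities k Cinv Chinv)
  (T0 : 0 < T) (eps0 : 0 < eps)
  (sol : smooth_solution m xmin xmax eps T rho g).
Local Notation U := (Uh R k N).
Local Notation h := (mesh_size xmin xmax N).
Local Notation ip := (@ip R xmin xmax N).
Local Notation tb := (@to_broken R k N).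
Local Notation wfl := (@wfl R xmin xmax k N).
Local Notation adv := (@adv R xmin xmax k N).
Local Notation advb := (@advb R xmin xmax k N).
Local Notation perr := (@perr R xmin xmax k N).
Local Notation projU := (@projU R xmin xmax k N).
Local Notation avg := (avg m).
Local Notation Om := (@Omega_v R m).
Local Notation Kerr := (Kerr k Cinv Chinv).
Local Notation Gen := (@Gen R m xmin xmax k N).
Local Notation whole := (@whole R N).
Local Notation normsq := (@normsq R m xmin xmax T).
Local Notation r_ := (vconst rho).
Local Notation Tip := (@test_ip R m xmin xmax k N T).
Local Notation Tpe := (@test_perr R m xmin xmax k N T).
Local Notation Twf := (@test_wfl R m xmin xmax k N T).
Local Notation Tfl := (@test_flux_perr R m xmin xmax k N T).
Local Notation Tad := (@test_advb_perr R m xmin xmax k N T).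

Hypotheses
  (Hr1 : forall s, 0 <= s <= T -> normsq r_ [:: DirT; DirT] s <= Mb)
  (Hr2 : forall s, 0 <= s <= T -> normsq r_ [:: DirX; DirT] s <= Mb)
  (Hr3 : forall s, 0 <= s <= T -> normsq r_ (highx k [::]) s <= Mb)
  (Hr4 : forall s, 0 <= s <= T -> normsq r_ (highx k [:: DirT]) s <= Mb)
  (Hg1 : forall s, 0 <= s <= T -> normsq g [:: DirT; DirT] s <= Mb)
  (Hg2 : forall s, 0 <= s <= T -> normsq g [:: DirT] s <= Mb)
  (Hg3 : forall s, 0 <= s <= T -> normsq g (highx k [::]) s <= Mb)
  (Hg4 : forall s, 0 <= s <= T -> normsq g (highx k [:: DirT]) s <= Mb).

Let h0 : 0 < h := h_gt0 xab N0.
Let sr := smooth_rho sol.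
Let sg := smooth_g sol.
Let kg := flux_kind fl.
Let kr := flux_kind (swap fl).

Definition Pg t v : U := projU kg (fun x => jet T g [::] x v t).
(** The velocity 0 is a dummy argument of [vconst rho], possibly outside [Omega_v]; [Prho_v]
    exchanges it for any other. *)
Definition Prho t : U := projU kr (fun x => jet T r_ [::] x 0 t).

Lemma Prho_v t v : Prho t = projU kr (fun x => jet T r_ [::] x v t).
Proof. by []. Qed.

Lemma UL2_Pg t : 0 <= t <= T -> UL2 m (Pg t).
Proof. by move=> tT; exact: (UL2_proj xab N0 Cinv0 Chinv0 inv sg). Qed.

(** The time derivative of the form is, by consistency and periodicity of $\partial_t\rho$, minus a
    pairing with $\partial_x\partial_t\rho$. No inverse inequality is spent, and this is where the
    norm of that mixed derivative is needed. *)
Lemma test_wfl_increment (xi : R -> U) (th a b : R) : UL2 m xi -> 0 < th -> 0 <= a -> a <= b -> b <= T ->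
  `|Twf (swap fl) r_ [::] b (fun v => v *: xi v) - Twf (swap fl) r_ [::] a (fun v => v *: xi v)| <=
    (th / 2 * Mb + (2 * th)^-1 * Gen xi) * (b - a).
Proof.
move=> x2 th0 a0 ab bT; have xv2 := UL2_idZ x2.
apply: (functional_lipschitz (jet_jet_nice sr [::]) (jet_jet_nice sr [:: DirT])
  (@jet_time _ _ _ _ sr [::]) (test_wfl_functional xab N0 xv2 (swap fl)) a0 ab bT) => s sab.
have sT : 0 <= s <= T by move: sab => /andP[as_ sb]; rewrite (le_trans a0 as_) (le_trans sb bT).
have -> : avg (fun v => wfl (swap fl) (whole (fun x => jet T r_ [:: DirT] x v s)) (v *: xi v)) =
   - Tip r_ [:: DirX; DirT] s (fun v => v *: xi v).
  rewrite /test_ip -mulN1r -avgZ; last exact: (vint_ip_whole xab N0 sr _ sT xv2).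
  by apply: avg_ext => v Ov; rewrite (wfl_rho_t xab N0 T0 sol sT)// mulN1r.
rewrite normrN; apply: le_trans (test_ip_le xab N0 sr xv2 th0 sT (Hr2 sT)) _.
rewrite lerD2l ler_wpM2l//; last exact: Gen_idZ.
by rewrite invr_ge0 mulr_ge0// ltW.
Qed.

Lemma avg_ip_Pg t (xi : R -> U) : 0 <= t <= T -> UL2 m xi ->
  avg (fun v => ip (tb (Pg t v)) (tb (xi v))) = Tip g [::] t xi - Tpe kg g [::] t xi.
Proof.
move=> tT x2; rewrite /test_ip /test_perr -avgB; last 2 first.
- exact: (vint_ip_whole xab N0 sg _ tT x2).
- exact: (vint_ip_perr xab N0 Cinv0 Chinv0 inv sg _ tT x2).
by apply: avg_ext => v Ov; rewrite /Pg (ip_projU xmin xmax sg [::] xi tT kg Ov).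
Qed.

Lemma ip_Prho t (phi : U) : 0 <= t <= T ->
  ip (tb (Prho t)) (tb phi) = Tip r_ [::] t (fun=> phi) - Tpe kr r_ [::] t (fun=> phi).
Proof.
move=> tT; rewrite /test_ip /test_perr -avgB; last 2 first.
- exact: (vint_ip_whole xab N0 sr _ tT (UL2_cst m phi)).
- exact: (vint_ip_perr xab N0 Cinv0 Chinv0 inv sr _ tT (UL2_cst m phi)).
rewrite -[LHS](avg_cst m); apply: avg_ext => v Ov.
by rewrite (Prho_v t v) (ip_projU xmin xmax sr [::] (fun=> phi) tT kr Ov).
Qed.

Lemma a_h_Pg t (phi : U) : 0 <= t <= T ->
  a_h m xmin xmax fl (Pg t) phi = - Tip r_ [:: DirT] t (fun=> phi) + Tfl fl g [::] t (fun=> phi).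
Proof.
move=> tT; have p2 := UL2_Pg tT; have c2 := UL2_cst m phi.
rewrite a_hE// -(avg_vmean (lin_wfl xmin xmax fl phi) (vL2_id R m) p2).
rewrite /test_ip (tested_rho_equation xab N0 sol tT fl phi) /test_flux_perr.
have cv := UL2_idZ c2.
have i1 : vint m (fun v => v * wfl fl (whole (fun x => jet T g [::] x v t)) phi).
  apply: (vint_ext _ (vint_wfl_whole xab N0 sg [::] tT cv fl)) => v Ov.
  have ll : lin (fun psi : U => wfl fl (whole (fun x => jet T g [::] x v t)) psi).
    by apply: lin_wform => i; exact: (jet_cont sg).
  by rewrite (linZ ll).
have i2 : vint m (fun v => v * wfl fl (perr kg (fun x => jet T g [::] x v t)) phi).
  apply: (vint_ext _ (vint_wfl_perr xab N0 Cinv0 Chinv0 inv sg [::] tT cv fl kg)) => v Ov.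
  have ll : lin (fun psi : U => wfl fl (perr kg (fun x => jet T g [::] x v t)) psi).
    by apply: lin_wform; apply: bcont_perr; exact: (jet_cont sg).
  by rewrite (linZ ll).
rewrite -[RHS]opprK opprD opprK -avgB//; congr (- _); apply: avg_ext => v Ov.
by rewrite /Pg (wfl_projU xmin xmax sg [::] (fun=> phi) tT fl kg Ov) mulrBr.
Qed.

Lemma a_h_Prho t (xi : R -> U) : 0 <= t <= T -> UL2 m xi ->
  a_h m xmin xmax fl xi (Prho t) =
  Twf (swap fl) r_ [::] t (fun v => v *: xi v) - Tfl (swap fl) r_ [::] t xi.
Proof.
move=> tT x2; have xv2 := UL2_idZ x2; rewrite -(avg_vd_h xab N0 fl (Prho t) x2).
have i1 := vint_wfl_whole xab N0 sr [::] tT xv2 (swap fl).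
have i2 : vint m (fun v => v * wfl (swap fl) (perr kr (fun x => jet T r_ [::] x v t)) (xi v)).
  apply: (vint_ext _ (vint_wfl_perr xab N0 Cinv0 Chinv0 inv sr [::] tT xv2 (swap fl) kr)) => v Ov.
  have ll : lin (fun psi : U => wfl (swap fl) (perr kr (fun x => jet T r_ [::] x v t)) psi).
    by apply: lin_wform; apply: bcont_perr; exact: (jet_cont sr).
  by rewrite (linZ ll).
rewrite /test_wfl /test_flux_perr -avgB//; apply: avg_ext => v Ov.
rewrite d_hE (Prho_v t v) (wfl_projU xmin xmax sr [::] xi tT (swap fl) kr Ov) mulrBr; congr (_ - _).
have ll : lin (fun psi : U => wfl (swap fl) (whole (fun x => jet T r_ [::] x v t)) psi).
  by apply: lin_wform => i; exact: (jet_cont sr).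
by rewrite (linZ ll).
Qed.

Lemma avg_adv_Pg t (xi : R -> U) : 0 <= t <= T -> UL2 m xi ->
  avg (fun v => adv v (Pg t v) (xi v)) =
  avg (fun v => v * ip (whole (fun x => jet T g [:: DirX] x v t)) (tb (xi v))) - Tad kg g [::] t xi.
Proof.
move=> tT x2; have xv2 := UL2_idZ x2.
have lx v : Om v -> lin (fun psi : U => ip (whole (fun x => jet T g [:: DirX] x v t)) (tb psi)).
  by move=> Ov; apply: lin_ip => i; exact: (jet_cont sg).
have i1 : vint m (fun v => v * ip (whole (fun x => jet T g [:: DirX] x v t)) (tb (xi v))).
  apply: (vint_ext _ (vint_ip_whole xab N0 sg [:: DirX] tT xv2)) => v Ov.
  by rewrite (linZ (lx v Ov)).
have E v : Om v -> adv v (Pg t v) (xi v) = v * ip (whole (fun x => jet T g [:: DirX] x v t)) (tb (xi v))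
    - advb v (perr kg (fun x => jet T g [::] x v t)) (xi v).
  move=> Ov; rewrite /Pg (advb_projU xmin xmax sg [::] xi tT kg Ov); congr (_ - _).
  apply: (advb_exact xab N0 v (xi v) (fun x => jet_is_derive sg [::] x Ov tT) _ (g_periodic sol Ov tT)).
  exact: (jet_cont sg).
have i2 : vint m (fun v => advb v (perr kg (fun x => jet T g [::] x v t)) (xi v)).
  apply: (vint_ext _ (vintB i1 (vint_adv xmin xmax (UL2_Pg tT) x2))) => v Ov.
  by rewrite E// opprB addrC subrK.
by rewrite /test_advb_perr -avgB//; apply: avg_ext.
Qed.

(* The flux terms of the projection error vanish for alternating fluxes,
   because the Gauss--Radau projection interpolates at the end that the flux
   uses; for central fluxes they cost one order in [h]. *)
Definition central_weight : R := match fl with Central => 1 | _ => 0 end.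

Lemma central_flux_perr (u : R -> R -> R -> R) fl' t (xi : R -> U) (th : R) : fl' = fl \/ fl' = swap fl ->
  smooth m T u -> UL2 m xi -> 0 <= t <= T -> 0 < th ->
  normsq u (highx k [::]) t <= Mb ->
  `|Tfl fl' u [::] t xi| <= th / 2 * (central_weight * (Kerr * h ^+ (2 * k + 1) * Mb)) + (2 * th)^-1 * (4 * Cinv / h * Gen xi).
Proof.
move=> Hfl su x2 tT th0 Hn.
have G0 : 0 <= (2 * th)^-1 * (4 * Cinv / h * Gen xi).
  apply: mulr_ge0; first by rewrite invr_ge0 mulr_ge0// ltW.
  by rewrite mulr_ge0 ?Gen_ge0// divr_ge0 ?(ltW h0)// mulr_ge0// ltW.
rewrite /central_weight.
have alt : alternating fl' -> `|Tfl fl' u [::] t xi| <= th / 2 * (0 * (Kerr * h ^+ (2 * k + 1) * Mb)) + (2 * th)^-1 * (4 * Cinv / h * Gen xi).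
  by move=> al; rewrite (test_flux_perr_alternating xab N0 Cinv0 Chinv0 inv su xi [::] tT al) normr0 mul0r mulr0 add0r.
have cen : `|Tfl fl' u [::] t xi| <= th / 2 * (1 * (Kerr * h ^+ (2 * k + 1) * Mb)) + (2 * th)^-1 * (4 * Cinv / h * Gen xi).
  by rewrite mul1r; exact: (test_flux_perr_le xab N0 Cinv0 Chinv0 inv su x2 th0 fl' tT Hn).
by case: fl Hfl => -[E|E]; subst fl'; [exact: alt|exact: alt|exact: alt|exact: alt|exact: cen|exact: cen].
Qed.

End Residuals.

(** The weights [3 * tau], [3] and [12 * C / h] make each of the three residuals cost one sixth of
    [tau * G]; together they give the coefficient 1/2. *)
Lemma rho_residual_young (R : realType) (t tau h C Mb K H0 H1 H2 c G X1 X2 X3 : R) :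
  0 < tau -> 0 < h -> 0 < C -> H1 = h * H0 ->
  `|X1| <= (3 * tau / 2 * Mb + (2 * (3 * tau))^-1 * G) * (t + tau - t) ^+ 2 ->
  `|X2| <= (3 / 2 * (K * H2 * Mb) + (2 * 3)^-1 * G) * (t + tau - t) ->
  `|X3| <= 12 * C / h / 2 * (c * (K * H1 * Mb)) + (2 * (12 * C / h))^-1 * (4 * C / h * G) ->
  X1 - X2 + tau * X3 <=
  tau * (2^-1 * G + (3 / 2 * (tau ^+ 2 * Mb) + 3 / 2 * (K * H2 * Mb) + c * (6 * C * (K * H0 * Mb)))).
Proof.
move=> tau0 h0 C0 ->; rewrite [t + tau]addrC addrK.
have hN : h != 0 by rewrite gt_eqF.
have tN : tau != 0 by rewrite gt_eqF.
have cN : C != 0 by rewrite gt_eqF.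
move=> /ler_normlP[_ A1] /ler_normlP[A2 _] /ler_normlP[_ A3].
apply: le_trans (lerD (lerD A1 A2) (ler_wpM2l (ltW tau0) A3)) _.
rewrite -subr_ge0 le_eqVlt; apply/orP; left; apply/eqP; field.
by rewrite hN tN cN.
Qed.

(** Here [q] is $1-\sigma$. The residuals [X1], [X4], [X5], [X6] and [X7] each cost [q / 6] of
    [tau * G], which leaves a slack of [q / 6] to discard; [X3] takes the whole jump dissipation.
    The increment [X2] of the projection error is multiplied by [e ^+ 2] and goes to the energy
    term, hence has no division by [q]. [H1'] keeps the power $h^{2k+1}$ of [X3], while [H1] is
    rewritten as [h * H0] to cancel the $1/h$ of [X5]. *)
Lemma g_residual_young (R : realType) (t e tau h C Mb K H0 H1 H1' H2 c q G J X1 X2 X3 X4 X5 X6 X7 : R) :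
  0 < e -> 0 < tau -> 0 < h -> 0 < C -> 0 < q -> 0 <= G -> H1 = h * H0 ->
  `|X1| <= (3 * e ^+ 2 * tau / q / 2 * Mb + (2 * (3 * e ^+ 2 * tau / q))^-1 * G) * (t + tau - t) ^+ 2 ->
  `|X2| <= (1 / 2 * (K * H2 * Mb) + (2 * 1)^-1 * G) * (t + tau - t) ->
  `|X3| <= q^-1 / 2 * (K * H1' * Mb) + (2 * q^-1)^-1 * J ->
  `|X4| <= (3 * tau / q / 2 * Mb + (2 * (3 * tau / q))^-1 * G) * (t + tau - t) ->
  `|X5| <= 12 * C / (h * q) / 2 * (c * (K * H1 * Mb)) + (2 * (12 * C / (h * q)))^-1 * (4 * C / h * G) ->
  `|X6| <= (3 * tau / q / 2 * Mb + (2 * (3 * tau / q))^-1 * G) * (t + tau - t) ->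
  `|X7| <= 3 / q / 2 * (K * H2 * Mb) + (2 * (3 / q))^-1 * G ->
  e ^+ 2 * X1 - e ^+ 2 * X2 - tau * (e * X3) - tau * X4 + tau * X5 + tau * X6 - tau * X7 <=
  tau * (q * (G + e / 2 * J) + e ^+ 2 / 2 * G +
   (3 / 2 * (e ^+ 4 * tau ^+ 2 * Mb / q) + 2^-1 * (e ^+ 2 * (K * H2 * Mb))
    + 2^-1 * (e * (K * H1' * Mb) / q) + 3 * (tau ^+ 2 * Mb / q)
    + c * (6 * C * (K * H0 * Mb) / q) + 3 / 2 * (K * H2 * Mb / q))).
Proof.
move=> e0 tau0 h0 C0 q0 G0 ->; rewrite [t + tau]addrC addrK.
have hN : h != 0 by rewrite gt_eqF.
have tN : tau != 0 by rewrite gt_eqF.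
have cN : C != 0 by rewrite gt_eqF.
have eN : e != 0 by rewrite gt_eqF.
have qN : q != 0 by rewrite gt_eqF.
move=> /ler_normlP[_ A1] /ler_normlP[A2 _] /ler_normlP[A3 _] /ler_normlP[A4 _] /ler_normlP[_ A5] /ler_normlP[_ A6] /ler_normlP[A7 _].
have e2 : 0 <= e ^+ 2 by rewrite exprn_ge0// ltW.
have {}A1 := ler_wpM2l e2 A1.
have {}A2 := ler_wpM2l e2 A2.
have {}A3 := ler_wpM2l (ltW tau0) (ler_wpM2l (ltW e0) A3).
have {}A4 := ler_wpM2l (ltW tau0) A4.
have {}A5 := ler_wpM2l (ltW tau0) A5.
have {}A6 := ler_wpM2l (ltW tau0) A6.
have {}A7 := ler_wpM2l (ltW tau0) A7.
have {A1 A2 A3 A4 A5 A6 A7} := lerD (lerD (lerD (lerD (lerD (lerD A1 A2) A3) A4) A5) A6) A7.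
rewrite !mulrN => H; apply: le_trans H _.
have : 0 <= tau * (q * G / 6) by rewrite !mulr_ge0// ltW.
move=> {}H; rewrite -subr_ge0; apply: le_trans H _.
rewrite le_eqVlt; apply/orP; left; apply/eqP; field.
by rewrite hN tN cN eN qN.
Qed.

(** Subtract [tau] times the exact equation at time [t]. The scheme evaluates $\rho$ and the
    relaxation term at the new time, so their increments appear besides the Taylor remainder and the
    projection errors. *)
Lemma residual_algebra (R : realType) (t e tau D A1 A0 B H I0 I1 P0 P1 X Ad W0 W1 Fl It : R) :
  D = A1 - A0 -> A0 = I0 - P0 -> A1 = I1 - P1 -> B = X - Ad -> H = W1 - Fl ->
  e ^+ 2 * It + e * X - W0 + I0 = 0 ->
  e ^+ 2 * D + tau * (e * B - H + A1) =
  e ^+ 2 * (I1 - I0 - (t + tau - t) * It) - e ^+ 2 * (P1 - P0) - tau * (e * Ad)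
  - tau * (W1 - W0) + tau * Fl + tau * (I1 - I0) - tau * P1.
Proof.
move=> -> -> -> -> -> E; apply/eqP; rewrite -subr_eq0; apply/eqP.
by move/(congr1 (fun z => tau * z)): E; rewrite mulr0 => <-; ring.
Qed.

Section ResidualBounds.
Variables (R : realType) (m : model) (xmin xmax : R) (k N : nat) (Cinv Chinv T eps Mb : R).
Variables (rho : R -> R -> R) (g : R -> R -> R -> R) (fl : flux).
Hypotheses (xab : xmin < xmax) (N0 : (0 < N)%N)
  (Cinv0 : 0 < Cinv) (Chinv0 : 0 < Chinv)
  (inv : inverse_inequalities k Cinv Chinv)
  (T0 : 0 < T) (eps0 : 0 < eps)
  (sol : smooth_solution m xmin xmax eps T rho g).
Local Notation U := (Uh R k N).
Local Notation h := (mesh_size xmin xmax N).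
Local Notation ip := (@ip R xmin xmax N).
Local Notation tb := (@to_broken R k N).
Local Notation adv := (@adv R xmin xmax k N).
Local Notation avg := (avg m).
Local Notation Kerr := (Kerr k Cinv Chinv).
Local Notation Gen := (@Gen R m xmin xmax k N).
Local Notation Jen := (@Jen R m xmin xmax k N).
Local Notation normsq := (@normsq R m xmin xmax T).
Local Notation r_ := (vconst rho).
Local Notation Tip := (@test_ip R m xmin xmax k N T).
Local Notation Tpe := (@test_perr R m xmin xmax k N T).
Local Notation Twf := (@test_wfl R m xmin xmax k N T).
Local Notation Tfl := (@test_flux_perr R m xmin xmax k N T).
Local Notation Tad := (@test_advb_perr R m xmin xmax k N T).

Hypotheses
  (Hr1 : forall s, 0 <= s <= T -> normsq r_ [:: DirT; DirT] s <= Mb)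
  (Hr2 : forall s, 0 <= s <= T -> normsq r_ [:: DirX; DirT] s <= Mb)
  (Hr3 : forall s, 0 <= s <= T -> normsq r_ (highx k [::]) s <= Mb)
  (Hr4 : forall s, 0 <= s <= T -> normsq r_ (highx k [:: DirT]) s <= Mb)
  (Hg1 : forall s, 0 <= s <= T -> normsq g [:: DirT; DirT] s <= Mb)
  (Hg2 : forall s, 0 <= s <= T -> normsq g [:: DirT] s <= Mb)
  (Hg3 : forall s, 0 <= s <= T -> normsq g (highx k [::]) s <= Mb)
  (Hg4 : forall s, 0 <= s <= T -> normsq g (highx k [:: DirT]) s <= Mb).


Let h0 : 0 < h := h_gt0 xab N0.
Let sr := smooth_rho sol.
Let sg := smooth_g sol.
Let kg := flux_kind fl.
Let kr := flux_kind (swap fl).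
Local Notation Pg := (@Pg R xmin xmax k N T g fl).
Local Notation Prho := (@Prho R xmin xmax k N T rho fl).

Lemma rho_residual_split t tau (phi : U) : 0 <= t <= T -> 0 <= t + tau <= T ->
  ip (tb (Prho (t + tau) - Prho t)) (tb phi) + tau * a_h m xmin xmax fl (Pg t) phi =
  (Tip r_ [::] (t + tau) (fun=> phi) - Tip r_ [::] t (fun=> phi) - (t + tau - t) * Tip r_ [:: DirT] t (fun=> phi))
  - (Tpe kr r_ [::] (t + tau) (fun=> phi) - Tpe kr r_ [::] t (fun=> phi))
  + tau * Tfl fl g [::] t (fun=> phi).
Proof.
move=> tT tpT; rewrite (linB (lin_ipUl xmin xmax phi)).
rewrite (ip_Prho fl xab N0 Cinv0 Chinv0 inv sol phi tT) (ip_Prho fl xab N0 Cinv0 Chinv0 inv sol phi tpT).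
rewrite (a_h_Pg fl xab N0 Cinv0 Chinv0 inv sol phi tT) -/kr -/kg.
move: (Tip _ _ _ _) (Tip _ _ _ _) (Tip _ _ _ _) (Tpe _ _ _ _ _) (Tpe _ _ _ _ _) (Tfl _ _ _ _ _) => a b c d e f.
ring.
Qed.

Lemma g_residual_split t tau (xi : R -> U) : 0 <= t <= T -> 0 <= t + tau <= T ->
  UL2 m xi -> vmean m (fun=> 1) xi = 0 ->
  eps ^+ 2 * avg (fun v => ip (tb (Pg (t + tau) v - Pg t v)) (tb (xi v))) +
    tau * (eps * avg (fun v => adv v (Pg t v) (xi v)) - a_h m xmin xmax fl xi (Prho (t + tau)) +
           avg (fun v => ip (tb (Pg (t + tau) v)) (tb (xi v)))) =
  eps ^+ 2 * (Tip g [::] (t + tau) xi - Tip g [::] t xi - (t + tau - t) * Tip g [:: DirT] t xi)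
  - eps ^+ 2 * (Tpe kg g [::] (t + tau) xi - Tpe kg g [::] t xi)
  - tau * (eps * Tad kg g [::] t xi)
  - tau * (Twf (swap fl) r_ [::] (t + tau) (fun v => v *: xi v) - Twf (swap fl) r_ [::] t (fun v => v *: xi v))
  + tau * Tfl (swap fl) r_ [::] (t + tau) xi
  + tau * (Tip g [::] (t + tau) xi - Tip g [::] t xi)
  - tau * Tpe kg g [::] (t + tau) xi.
Proof.
move=> tT tpT x2 x0.
have p2 := UL2_Pg fl xab N0 Cinv0 Chinv0 inv sol tT.
have pp2 := UL2_Pg fl xab N0 Cinv0 Chinv0 inv sol tpT.
have E0 : avg (fun v => ip (tb (Pg (t + tau) v - Pg t v)) (tb (xi v))) =
    avg (fun v => ip (tb (Pg (t + tau) v)) (tb (xi v))) - avg (fun v => ip (tb (Pg t v)) (tb (xi v))).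
  rewrite -(avgB (vint_ip xmin xmax pp2 x2) (vint_ip xmin xmax p2 x2)); apply: avg_ext => v _.
  by rewrite (linB (lin_ipUl xmin xmax _)).
exact: (residual_algebra t tau E0 (avg_ip_Pg fl xab N0 Cinv0 Chinv0 inv sol tT x2)
  (avg_ip_Pg fl xab N0 Cinv0 Chinv0 inv sol tpT x2) (avg_adv_Pg fl xab N0 Cinv0 Chinv0 inv sol tT x2)
  (a_h_Prho fl xab N0 Cinv0 Chinv0 inv sol tpT x2)
  (tested_g_equation xab N0 eps0 sol tT (swap fl) x2 x0)).
Qed.

Definition rho_consistency tau : R :=
  3 / 2 * (tau ^+ 2 * Mb) + 3 / 2 * (Kerr * h ^+ (2 * k + 2) * Mb)
  + central_weight R fl * (6 * Cinv * (Kerr * h ^+ (2 * k) * Mb)).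

Lemma rho_residual_le t tau (phi : U) : 0 < tau -> 0 <= t -> t + tau <= T ->
  ip (tb (Prho (t + tau) - Prho t)) (tb phi) + tau * a_h m xmin xmax fl (Pg t) phi <=
  tau * (2^-1 * ip (tb phi) (tb phi) + rho_consistency tau).
Proof.
move=> tau0 t0 tpT'.
have tp : t <= t + tau by rewrite lerDl ltW.
have tT : 0 <= t <= T by rewrite t0 (le_trans tp).
have tpT : 0 <= t + tau <= T by rewrite (le_trans t0 tp).
rewrite rho_residual_split//.
have c2 := UL2_cst m phi.
have th1 : 0 < 3 * tau by rewrite mulr_gt0.
have th3 : 0 < 12 * Cinv / h by rewrite divr_gt0// mulr_gt0.
have EG : Gen (fun=> phi) = ip (tb phi) (tb phi) by rewrite /Gen avg_cst.
have EH : h ^+ (2 * k + 1) = h * h ^+ (2 * k) by rewrite addn1 exprS.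
rewrite -EG.
exact: (rho_residual_young tau0 h0 Cinv0 EH
  (test_ip_taylor xab N0 sr c2 th1 t0 tp tpT' (w := [::]) Hr1)
  (test_perr_increment xab N0 Cinv0 Chinv0 inv sr c2 (ltr0Sn R 2) t0 tp tpT' kr (w := [::]) Hr4)
  (central_flux_perr xab N0 Cinv0 Chinv0 inv (or_introl (erefl fl)) sg c2 tT th3 (Hg3 tT))).
Qed.

Definition g_consistency tau sigma : R :=
  3 / 2 * (eps ^+ 4 * tau ^+ 2 * Mb / (1 - sigma)) + 2^-1 * (eps ^+ 2 * (Kerr * h ^+ (2 * k + 2) * Mb))
  + 2^-1 * (eps * (Kerr * h ^+ (2 * k + 1) * Mb) / (1 - sigma)) + 3 * (tau ^+ 2 * Mb / (1 - sigma))
  + central_weight R fl * (6 * Cinv * (Kerr * h ^+ (2 * k) * Mb) / (1 - sigma))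
  + 3 / 2 * (Kerr * h ^+ (2 * k + 2) * Mb / (1 - sigma)).

Lemma g_residual_le t tau sigma (xi : R -> U) : 0 < tau -> 0 < sigma < 1 -> 0 <= t -> t + tau <= T ->
  UL2 m xi -> vmean m (fun=> 1) xi = 0 ->
  eps ^+ 2 * avg (fun v => ip (tb (Pg (t + tau) v - Pg t v)) (tb (xi v))) +
    tau * (eps * avg (fun v => adv v (Pg t v) (xi v)) - a_h m xmin xmax fl xi (Prho (t + tau)) +
           avg (fun v => ip (tb (Pg (t + tau) v)) (tb (xi v)))) <=
  tau * ((1 - sigma) * (Gen xi + eps / 2 * Jen xi) + eps ^+ 2 / 2 * Gen xi + g_consistency tau sigma).
Proof.
move=> tau0 /andP[s0 s1] t0 tpT' x2 x0.
have tp : t <= t + tau by rewrite lerDl ltW.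
have tT : 0 <= t <= T by rewrite t0 (le_trans tp).
have tpT : 0 <= t + tau <= T by rewrite (le_trans t0 tp).
rewrite g_residual_split//.
have k0 : 0 < 1 - sigma by rewrite subr_gt0.
have e2 : 0 < eps ^+ 2 by rewrite exprn_gt0.
have th1 : 0 < 3 * eps ^+ 2 * tau / (1 - sigma) by rewrite divr_gt0// !mulr_gt0.
have th3 : 0 < (1 - sigma)^-1 by rewrite invr_gt0.
have th4 : 0 < 3 * tau / (1 - sigma) by rewrite divr_gt0// mulr_gt0.
have th5 : 0 < 12 * Cinv / (h * (1 - sigma)) by rewrite divr_gt0// mulr_gt0.
have th7 : 0 < 3 / (1 - sigma) by rewrite divr_gt0.
have EH : h ^+ (2 * k + 1) = h * h ^+ (2 * k) by rewrite addn1 exprS.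
exact: (g_residual_young eps0 tau0 h0 Cinv0 k0 (Gen_ge0 m xmin xmax xi) EH
  (test_ip_taylor xab N0 sg x2 th1 t0 tp tpT' (w := [::]) Hg1)
  (test_perr_increment xab N0 Cinv0 Chinv0 inv sg x2 ltr01 t0 tp tpT' kg (w := [::]) Hg4)
  (test_advb_perr_le xab N0 Cinv0 Chinv0 inv sg x2 th3 kg tT (Hg3 tT) (fun v Ov => g_periodic sol Ov tT))
  (test_wfl_increment fl xab N0 T0 sol Hr2 x2 th4 t0 tp tpT')
  (central_flux_perr xab N0 Cinv0 Chinv0 inv (or_intror (erefl (swap fl))) sr x2 tpT th5 (Hr3 tpT))
  (test_ip_increment xab N0 sg x2 th4 t0 tp tpT' (w := [::]) Hg2)
  (test_perr_le xab N0 Cinv0 Chinv0 inv sg x2 th7 kg tpT (Hg3 tpT))).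
Qed.

End ResidualBounds.

(** * Evolution of the error *)

Section Defects.
Variables (R : realType) (m : model) (xmin xmax : R) (k N : nat) (Cinv Chinv : R).
Hypotheses (xab : xmin < xmax) (N0 : (0 < N)%N) (Cinv0 : 0 < Cinv)
  (inv : inverse_inequalities k Cinv Chinv).
Local Notation U := (Uh R k N).
Local Notation ip := (@ip R xmin xmax N).
Local Notation tb := (@to_broken R k N).
Local Notation adv := (@adv R xmin xmax k N).
Local Notation avg := (avg m).
Local Notation a_h := (a_h m xmin xmax).

Lemma vmean1 (l : U -> R) (u : R -> U) : lin l -> UL2 m u ->
  avg (fun v => l (u v)) = l (vmean m (fun=> 1) u).
Proof.
move=> ll u2; rewrite -(avg_vmean ll (vL2_cst m 1) u2); apply: avg_ext => v _.
by rewrite mul1r.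
Qed.

Lemma vmean1_eq0 (u : R -> U) : UL2 m u ->
  (forall psi, avg (fun v => ip (tb (u v)) (tb psi)) = 0) -> vmean m (fun=> 1) u = 0.
Proof.
move=> u2 H; apply: (ip_inj xab N0 Cinv0 inv) => psi.
by rewrite -(vmean1 (lin_ipUl xmin xmax psi) u2) H (lin0 (lin_ipUl xmin xmax psi)).
Qed.

Lemma a_h_subl fl (u w : R -> U) phi : UL2 m u -> UL2 m w ->
  a_h fl (fun v => u v - w v) phi = a_h fl u phi - a_h fl w phi.
Proof.
move=> u2 w2; have ll := lin_wfl xmin xmax fl phi.
rewrite !a_hE//; last exact: UL2_B.
rewrite -!(avg_vmean ll (vL2_id R m))//; last exact: UL2_B.
rewrite opprK addrC -opprB -avgB; last 2 first.
- exact: (vintM (vL2_id R m) (UL2_form ll u2)).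
- exact: (vintM (vL2_id R m) (UL2_form ll w2)).
by congr (- _); apply: avg_ext => v _; rewrite (linB ll) mulrBr.
Qed.

Lemma a_h_subr fl (xi : R -> U) (p q : U) : UL2 m xi ->
  a_h fl xi (p - q) = a_h fl xi p - a_h fl xi q.
Proof.
move=> x2; rewrite !a_hE// /wfl (linB (lin_wform _ _ _ _)); last exact: bcont_tb.
by rewrite opprB opprK addrC.
Qed.

Definition rho_defect fl tau (r0 r1 : U) (g : R -> U) (phi : U) : R :=
  ip (tb (r1 - r0)) (tb phi) + tau * a_h fl g phi.

(* The second equation of the scheme multiplied by [eps ^+ 2 * tau], tested
   with [xi] and averaged in [v]: the term [<D_h(g; v)>] disappears because the
   velocity mean of [xi] is [0] whenever this is used. *)
Definition g_defect fl eps tau (g0 g1 : R -> U) (r : U) (xi : R -> U) : R :=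
  eps ^+ 2 * avg (fun v => ip (tb (g1 v - g0 v)) (tb (xi v))) +
    tau * (eps * avg (fun v => adv v (g0 v) (xi v)) - a_h fl xi r +
           avg (fun v => ip (tb (g1 v)) (tb (xi v)))).

Lemma rho_defect_sub fl tau (r0 r1 s0 s1 : U) (g w : R -> U) phi : UL2 m g -> UL2 m w ->
  rho_defect fl tau (r0 - s0) (r1 - s1) (fun v => g v - w v) phi =
  rho_defect fl tau r0 r1 g phi - rho_defect fl tau s0 s1 w phi.
Proof.
move=> g2 w2; rewrite /rho_defect a_h_subl//.
have lu := lin_ipUl xmin xmax phi; rewrite !(linB lu); ring.
Qed.

Lemma g_defect_sub fl eps tau (g0 g1 w0 w1 : R -> U) (r s : U) (xi : R -> U) :
  UL2 m g0 -> UL2 m g1 -> UL2 m w0 -> UL2 m w1 -> UL2 m xi ->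
  g_defect fl eps tau (fun v => g0 v - w0 v) (fun v => g1 v - w1 v) (r - s) xi =
  g_defect fl eps tau g0 g1 r xi - g_defect fl eps tau w0 w1 s xi.
Proof.
move=> g02 g12 w02 w12 x2.
have vi (u : R -> U) (u2 : UL2 m u) := vint_ip xmin xmax u2 x2.
have va (u : R -> U) (u2 : UL2 m u) := vint_adv xmin xmax u2 x2.
have d2 := UL2_B g12 g02; have e2 := UL2_B w12 w02.
have E1 : avg (fun v => ip (tb (g1 v - w1 v - (g0 v - w0 v))) (tb (xi v))) =
    avg (fun v => ip (tb (g1 v - g0 v)) (tb (xi v))) - avg (fun v => ip (tb (w1 v - w0 v)) (tb (xi v))).
  rewrite -(avgB (vi _ d2) (vi _ e2)); apply: avg_ext => v _.
  by rewrite !(linB (lin_ipUl xmin xmax (xi v))); ring.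
have E2 : avg (fun v => ip (tb (g1 v - w1 v)) (tb (xi v))) =
    avg (fun v => ip (tb (g1 v)) (tb (xi v))) - avg (fun v => ip (tb (w1 v)) (tb (xi v))).
  by rewrite -(avgB (vi _ g12) (vi _ w12)); apply: avg_ext => v _; rewrite (linB (lin_ipUl xmin xmax (xi v))).
have E3 : avg (fun v => adv v (g0 v - w0 v) (xi v)) =
    avg (fun v => adv v (g0 v) (xi v)) - avg (fun v => adv v (w0 v) (xi v)).
  by rewrite -(avgB (va _ g02) (va _ w02)); apply: avg_ext => v _; rewrite (linB (lin_adv_l _ _ _ _)).
have H (a b c d x1 x2' y1 y2 z1 z2 w3 w4 : R) : a = x1 - x2' -> b = y1 - y2 -> c = z1 - z2 -> d = w3 - w4 ->
    eps ^+ 2 * a + tau * (eps * c - d + b) = eps ^+ 2 * x1 + tau * (eps * z1 - w3 + y1)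
      - (eps ^+ 2 * x2' + tau * (eps * z2 - w4 + y2)) by move=> -> -> -> ->; ring.
exact: (H _ _ _ _ _ _ _ _ _ _ _ _ E1 E2 E3 (a_h_subr fl r s x2)).
Qed.

Lemma vint_b_h (g xi : R -> U) : UL2 m g -> UL2 m xi ->
  vint m (fun v => b_h m xmin xmax v g (xi v)).
Proof.
move=> g2 x2; pose l (psi : U) := avg (fun w => adv w (g w) psi).
have ll : lin l.
  move=> a u w; rewrite /l -avg_lin; last 2 first.
    exact/vint_vL2/UL2_adv.
    exact/vint_vL2/UL2_adv.
  by apply: avg_ext => v _; rewrite lin_adv.
apply: (vint_ext _ (vintB (vint_adv xmin xmax g2 x2) (vint_vL2 (UL2_form ll x2)))) => v _.
by rewrite (b_hE xab N0 Cinv0 inv).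
Qed.

Section Scheme.
Variables (fl : flux) (eps tau : R) (rhoh : nat -> U) (gh : nat -> R -> U).
Hypotheses (eps0 : 0 < eps) (tau0 : 0 < tau) (dg : dg_imex1 m xmin xmax fl eps tau rhoh gh).
Hypothesis gh0 : vmean m (fun=> 1) (gh 0%N) = 0.

Lemma scheme_UL2 n : UL2 m (gh n).
Proof. by case: (dg n) => H _ _; exact: UL2_velocity_space. Qed.

Lemma scheme_rho n phi : rho_defect fl tau (rhoh n) (rhoh n.+1) (gh n) phi = 0.
Proof.
case: (dg n) => _ /(_ phi) + _; rewrite /rho_defect (linZ (lin_ipUl xmin xmax phi)).
move=> /(congr1 (fun z => tau * z)); rewrite mulrDr mulr0 mulrA divff ?mul1r// gt_eqF//.
Qed.

Lemma scheme_g n v psi : Omega_v m v ->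
  eps ^+ 2 * ip (tb (gh n.+1 v - gh n v)) (tb psi) +
  tau * (eps * b_h m xmin xmax v (gh n) psi - v * d_h xmin xmax fl (rhoh n.+1) psi +
         ip (tb (gh n.+1 v)) (tb psi)) = 0.
Proof.
move=> Ov; case: (dg n) => _ _ /(_ v psi Ov); rewrite (linZ (lin_ipUl xmin xmax psi)).
move: (ip _ _) (b_h _ _ _ _ _ _) (d_h _ _ _ _ _) (ip _ _) => G B D A.
move=> /(congr1 (fun z => tau * eps ^+ 2 * z)) H.
have tN : tau != 0 by rewrite gt_eqF.
have eN : eps != 0 by rewrite gt_eqF.
transitivity (tau * eps ^+ 2 * (tau^-1 * A + eps^-1 * B - v / eps ^+ 2 * D)
    - tau * eps ^+ 2 * (- (eps ^+ 2)^-1 * G)); first by field; rewrite eN tN.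
by rewrite H subrr.
Qed.

Lemma avg_scheme_g n (xi : R -> U) : UL2 m xi ->
  eps ^+ 2 * avg (fun v => ip (tb (gh n.+1 v - gh n v)) (tb (xi v))) +
  tau * (eps * avg (fun v => b_h m xmin xmax v (gh n) (xi v)) - a_h fl xi (rhoh n.+1) +
         avg (fun v => ip (tb (gh n.+1 v)) (tb (xi v)))) = 0.
Proof.
move=> x2; have g2 := scheme_UL2 n; have g12 := scheme_UL2 n.+1.
have i1 := vint_ip xmin xmax (UL2_B g12 g2) x2.
have i4 := vint_ip xmin xmax g12 x2.
have i2 := vint_b_h g2 x2.
have i3 : vint m (fun v => v * d_h xmin xmax fl (rhoh n.+1) (xi v)).
  apply: vintM; first exact: vL2_id.
  apply: UL2_form x2 => a p q; rewrite !d_hE /wfl lin_wform//; exact: bcont_tb.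
rewrite -(avg_vd_h xab N0 fl (rhoh n.+1) x2) -(avgZ eps i2) -(avgB (vintZ eps i2) i3).
rewrite -(avgD (vintB (vintZ eps i2) i3) i4) -(avgZ tau (vintD (vintB (vintZ eps i2) i3) i4)).
rewrite -(avgZ (eps ^+ 2) i1) -(avgD (vintZ (eps ^+ 2) i1) (vintZ tau (vintD (vintB (vintZ eps i2) i3) i4))).
by rewrite -[RHS](avg_cst m); apply: avg_ext => v Ov; exact: scheme_g.
Qed.

(** Test the averaged $g$ equation with a function independent of [v]: the term with $\mathbf I-\Pi$
    averages to zero and $\langle v\rangle=0$ removes the coupling, which leaves
    $(\varepsilon^2+\tau)\langle g^{n+1}\rangle=\varepsilon^2\langle g^n\rangle$. *)
Lemma scheme_vmean n : vmean m (fun=> 1) (gh n) = 0.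
Proof.
elim: n => [//|n IH]; have g2 := scheme_UL2 n; have g12 := scheme_UL2 n.+1.
apply: vmean1_eq0 => // psi; have c2 := UL2_cst m psi.
have := avg_scheme_g n c2.
have -> : avg (fun v => b_h m xmin xmax v (gh n) psi) = 0.
  rewrite (avg_ext (fun v _ => b_hE xab N0 Cinv0 inv v psi g2)).
  rewrite avgB; [|exact: vint_adv|exact: vint_cst].
  by rewrite avg_cst subrr.
have -> : a_h fl (fun=> psi) (rhoh n.+1) = 0.
  rewrite -(avg_vd_h xab N0 fl (rhoh n.+1) c2).
  transitivity (d_h xmin xmax fl (rhoh n.+1) psi * avg (fun v => v)); last by rewrite avg_id0 mulr0.
  rewrite -avgZ; last exact/vint_vL2/vL2_id.
  by apply: avg_ext => v _; rewrite mulrC.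
have -> : avg (fun v => ip (tb (gh n.+1 v - gh n v)) (tb psi)) = avg (fun v => ip (tb (gh n.+1 v)) (tb psi)).
  transitivity (avg (fun v => ip (tb (gh n.+1 v)) (tb psi)) - avg (fun v => ip (tb (gh n v)) (tb psi))).
    rewrite -(avgB (vint_ip xmin xmax g12 c2) (vint_ip xmin xmax g2 c2)).
    by apply: avg_ext => v _; rewrite (linB (lin_ipUl xmin xmax _)).
  by rewrite (vmean1 (lin_ipUl xmin xmax psi) g2) IH (lin0 (lin_ipUl xmin xmax psi)) subr0.
move: (avg _) => a; rewrite mulr0 subrr add0r -mulrDl => /eqP; rewrite mulf_eq0 gt_eqF ?addr_gt0 ?exprn_gt0//=.
by move/eqP.
Qed.

Lemma scheme_g_defect n (xi : R -> U) : UL2 m xi -> vmean m (fun=> 1) xi = 0 ->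
  g_defect fl eps tau (gh n) (gh n.+1) (rhoh n.+1) xi = 0.
Proof.
move=> x2 x0; rewrite /g_defect -(avg_b_h xab N0 Cinv0 inv (scheme_UL2 n) x2 x0).
exact: avg_scheme_g.
Qed.

End Scheme.

End Defects.

Section ErrorEvolution.
Variables (R : realType) (m : model) (xmin xmax : R) (k N : nat) (Cinv Chinv T eps Mb : R).
Variables (rho : R -> R -> R) (g : R -> R -> R -> R) (fl : flux).
Hypotheses (xab : xmin < xmax) (N0 : (0 < N)%N)
  (Cinv0 : 0 < Cinv) (Chinv0 : 0 < Chinv)
  (inv : inverse_inequalities k Cinv Chinv)
  (T0 : 0 < T) (eps0 : 0 < eps)
  (sol : smooth_solution m xmin xmax eps T rho g).
Local Notation U := (Uh R k N).
Local Notation h := (mesh_size xmin xmax N).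
Local Notation ip := (@ip R xmin xmax N).
Local Notation tb := (@to_broken R k N).
Local Notation avg := (avg m).
Local Notation Om := (@Omega_v R m).
Local Notation Gen := (@Gen R m xmin xmax k N).
Local Notation Jen := (@Jen R m xmin xmax k N).
Local Notation normsq := (@normsq R m xmin xmax T).
Local Notation r_ := (vconst rho).
Local Notation Pg := (@Pg R xmin xmax k N T g fl).
Local Notation Prho := (@Prho R xmin xmax k N T rho fl).
Hypotheses
  (Hr1 : forall s, 0 <= s <= T -> normsq r_ [:: DirT; DirT] s <= Mb)
  (Hr2 : forall s, 0 <= s <= T -> normsq r_ [:: DirX; DirT] s <= Mb)
  (Hr3 : forall s, 0 <= s <= T -> normsq r_ (highx k [::]) s <= Mb)
  (Hr4 : forall s, 0 <= s <= T -> normsq r_ (highx k [:: DirT]) s <= Mb)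
  (Hg1 : forall s, 0 <= s <= T -> normsq g [:: DirT; DirT] s <= Mb)
  (Hg2 : forall s, 0 <= s <= T -> normsq g [:: DirT] s <= Mb)
  (Hg3 : forall s, 0 <= s <= T -> normsq g (highx k [::]) s <= Mb)
  (Hg4 : forall s, 0 <= s <= T -> normsq g (highx k [:: DirT]) s <= Mb).


Variables (tau sigma : R) (rhoh : nat -> U) (gh : nat -> R -> U).
Hypotheses (s01 : 0 < sigma < 1) (tau0 : 0 < tau)
  (tau_le : tau <= sigma * dt_stab m k Cinv Chinv eps h)
  (gh0 : forall v, Om v -> gh 0%N v = pi_h xmin xmax k N (fun x => g x v 0))
  (dg : dg_imex1 m xmin xmax fl eps tau rhoh gh).

Let sg := smooth_g sol.

Definition err_rho n : U := Prho (n%:R * tau) - rhoh n.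
Definition err_g n v : U := Pg (n%:R * tau) v - gh n v.

Lemma gh0_vmean : vmean m (fun=> 1) (gh 0%N) = 0.
Proof.
have T00 : (0 : R) <= 0 <= T by apply/andP; split; [exact: lexx|exact: ltW].
have n0 := jet_nice_at sg [::] T00.
rewrite -(vmean_projU xab N0 Cinv0 Chinv0 inv ProjL2 n0 (fun x _ => avg_g sol x T00)).
rewrite /vmean; apply: eq_bigr => j _; congr (_ *: _); apply: avg_ext => v Ov.
rewrite gh0// (pi_h_projU xab N0 Cinv0 Chinv0 inv)//.
exact: (nice_cont n0 Ov).
Qed.

Let step_ge0 n : 0 <= n%:R * tau :> R.
Proof. by rewrite mulr_ge0// ltW. Qed.

Let stepT n p : (n <= p)%N -> p%:R * tau <= T -> 0 <= n%:R * tau <= T.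
Proof.
move=> np pT; rewrite step_ge0/=; apply: le_trans pT.
by apply: ler_wpM2r; [exact: ltW|rewrite ler_nat].
Qed.

Let stepS n : n.+1%:R * tau = n%:R * tau + tau :> R.
Proof. by rewrite -natr1 mulrDl mul1r. Qed.

Lemma err_g_UL2 n : n%:R * tau <= T -> UL2 m (err_g n).
Proof.
move=> nT; apply: UL2_B; last exact: (scheme_UL2 dg).
exact: (UL2_Pg fl xab N0 Cinv0 Chinv0 inv sol (stepT (leqnn n) nT)).
Qed.

Lemma err_g_vmean n : n%:R * tau <= T -> vmean m (fun=> 1) (err_g n) = 0.
Proof.
move=> nT; have tT := stepT (leqnn n) nT.
have p2 := UL2_Pg fl xab N0 Cinv0 Chinv0 inv sol tT; have g2 := scheme_UL2 dg n.
apply: (vmean1_eq0 xab N0 Cinv0 inv (err_g_UL2 nT)) => psi.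
have ll := lin_ipUl xmin xmax psi.
transitivity (avg (fun v => ip (tb (Pg (n%:R * tau) v)) (tb psi)) - avg (fun v => ip (tb (gh n v)) (tb psi))).
  rewrite -(avgB (vint_ip xmin xmax p2 (UL2_cst m psi)) (vint_ip xmin xmax g2 (UL2_cst m psi))).
  by apply: avg_ext => v _; rewrite (linB ll).
rewrite (vmean1 ll p2) (vmean1 ll g2) (scheme_vmean xab N0 Cinv0 inv eps0 tau0 dg gh0_vmean).
by rewrite (vmean_projU xab N0 Cinv0 Chinv0 inv _ (jet_nice_at sg [::] tT) (fun x _ => avg_g sol x tT)) subrr.
Qed.

(* The two components are taken at different times, so that the coupling terms
   of the two equations cancel. *)
Definition err_energy n : R :=
  ip (tb (err_rho n.+1)) (tb (err_rho n.+1)) + eps ^+ 2 * Gen (err_g n).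

Lemma err_rho_defect n phi : n.+1%:R * tau <= T ->
  rho_defect m xmin xmax fl tau (err_rho n) (err_rho n.+1) (err_g n) phi <=
  tau * (2^-1 * ip (tb phi) (tb phi) + rho_consistency xmin xmax k N Cinv Chinv Mb fl tau).
Proof.
move=> nT; have tT := stepT (leqnSn n) nT.
have p2 := UL2_Pg fl xab N0 Cinv0 Chinv0 inv sol tT; have g2 := scheme_UL2 dg n.
rewrite (rho_defect_sub xmin xmax fl tau _ _ _ _ phi p2 g2) (scheme_rho tau0 dg) subr0 stepS.
rewrite stepS in nT.
exact: (rho_residual_le fl xab N0 Cinv0 Chinv0 inv sol Hr1 Hr4 Hg3 phi tau0 (step_ge0 n) nT).
Qed.

Lemma err_g_defect n : n.+1%:R * tau <= T ->
  g_defect m xmin xmax fl eps tau (err_g n) (err_g n.+1) (err_rho n.+1) (err_g n.+1) <=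
  tau * ((1 - sigma) * (Gen (err_g n.+1) + eps / 2 * Jen (err_g n.+1)) + eps ^+ 2 / 2 * Gen (err_g n.+1)
         + g_consistency xmin xmax k N Cinv Chinv eps Mb fl tau sigma).
Proof.
move=> nT; have tT := stepT (leqnSn n) nT; have tT1 := stepT (leqnn _) nT.
have p2 := UL2_Pg fl xab N0 Cinv0 Chinv0 inv sol tT; have g2 := scheme_UL2 dg n.
have q2 := UL2_Pg fl xab N0 Cinv0 Chinv0 inv sol tT1; have g12 := scheme_UL2 dg n.+1.
have x2 := err_g_UL2 nT; have x0 := err_g_vmean nT.
rewrite (g_defect_sub xmin xmax fl eps tau _ _ p2 q2 g2 g12 x2).
rewrite (scheme_g_defect xab N0 Cinv0 inv eps0 tau0 dg n x2 x0) subr0.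
have nT' := nT; rewrite stepS in nT'; rewrite stepS.
exact: (g_residual_le fl xab N0 Cinv0 Chinv0 inv T0 eps0 sol Hr2 Hr3 Hg1 Hg2 Hg3 Hg4 tau0 s01 (step_ge0 n) nT' x2 x0).
Qed.

(** The dissipation in [energy_step] and the share of it spent in [err_g_defect] are the same
    quantity and cancel. The remaining halves of the squared norms add up to [tau] times the new
    energy. The [n.+2] in the hypothesis is the time level of $\rho$ in that energy. *)
Lemma err_energy_growth n : n.+2%:R * tau <= T ->
  err_energy n.+1 - err_energy n <= tau * err_energy n.+1 +
    2 * tau * (rho_consistency xmin xmax k N Cinv Chinv Mb fl tau + g_consistency xmin xmax k N Cinv Chinv eps Mb fl tau sigma).
Proof.
move=> nT; have n1T : n.+1%:R * tau <= T by have /andP[] := stepT (leqnSn n.+1) nT.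
have nT0 : n%:R * tau <= T by have /andP[] := stepT (leqnSn n) n1T.
have HS := err_rho_defect (err_rho n.+2) nT.
have HF := err_g_defect n1T.
have tN : tau != 0 by rewrite gt_eqF.
have mulK (z : R) : tau * (z / tau) = z by rewrite mulrC divfK.
have := energy_step xab N0 Cinv0 Chinv0 inv eps0 tau0 s01 tau_le (err_g_UL2 nT0) (err_g_UL2 n1T)
  (esym (mulK (rho_defect m xmin xmax fl tau (err_rho n.+1) (err_rho n.+2) (err_g n.+1) (err_rho n.+2))))
  (esym (mulK (g_defect m xmin xmax fl eps tau (err_g n) (err_g n.+1) (err_rho n.+1) (err_g n.+1)))).
move: HS HF; rewrite /err_energy.
move: (rho_defect _ _ _ _ _ _ _ _ _) (g_defect _ _ _ _ _ _ _ _ _ _) => S F.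
move: (rho_consistency _ _ _ _ _ _ _ _ _) (g_consistency _ _ _ _ _ _ _ _ _ _ _) => BS BF.
move: (ip _ _) (ip _ _) (Gen _) (Gen _) (Jen _) => r0 r1 g0 g1 J1.
move=> HS HF.
have {}HS : S / tau <= 2^-1 * r1 + BS by rewrite ler_pdivrMr// mulrC.
move: HF; rewrite mulrC -ler_pdivrMr// => HF H.
have := ler_wpM2l (ltW tau0) (lerD HS HF); lra.
Qed.

End ErrorEvolution.

(** The new energy also stands on the right. For $\tau\le\frac12$ one has $(1+2\tau)(1-\tau)\ge1$,
    so it is absorbed at the price of a growth factor $1+2\tau\le e^{2\tau}$ per step. *)
Lemma discrete_gronwall (R : realType) (E : nat -> R) (tau B T : R) (n : nat) :
  0 < tau -> tau < 2^-1 -> 0 <= B -> (forall p, 0 <= E p) ->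
  (forall p, p.+2%:R * tau <= T -> E p.+1 - E p <= tau * E p.+1 + 2 * tau * B) ->
  n.+1%:R * tau <= T -> E n <= expR (2 * T) * (E 0%N + 2 * T * B).
Proof.
move=> t0 t1 B0 E0 H nT.
have K p : (p <= n)%N -> E p <= (1 + 2 * tau) ^+ p * (E 0%N + p%:R * (2 * tau * B)).
  elim: p => [|p IH] pn; first by rewrite expr0 mul1r mul0r addr0.
  have pT : p.+2%:R * tau <= T.
    by apply: le_trans nT; apply: ler_wpM2r; [exact: ltW|rewrite ler_nat].
  have {}IH := IH (ltnW pn); have {}H := H p pT.
  have H1 : E p.+1 <= (1 + 2 * tau) * (E p + 2 * tau * B).
    have := ler_wpM2l (_ : 0 <= 1 + 2 * tau) H.
    have := mulr_ge0 (mulr_ge0 (ltW t0) (E0 p.+1)) (_ : 0 <= 1 - 2 * tau); nra.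
  apply: (le_trans H1); rewrite exprS -[leRHS]mulrA; apply: ler_wpM2l; first by lra.
  have e1 : 1 <= (1 + 2 * tau) ^+ p by rewrite exprn_ege1//; lra.
  have tB : 0 <= 2 * tau * B by rewrite !mulr_ge0// ltW.
  move: (2 * tau * B) tB ((1 + 2 * tau) ^+ p) e1 IH => b b0 q q1 IH.
  by rewrite -natr1; have := ler_wpM2r b0 q1; lra.
apply: le_trans (K n (leqnn n)) _.
have nT' : n%:R * tau <= T.
  by apply: le_trans nT; apply: ler_wpM2r; [exact: ltW|rewrite ler_nat].
have n0 : 0 <= n%:R * tau by rewrite mulr_ge0// ltW.
have sB : 0 <= n%:R * (2 * tau * B) by rewrite !mulr_ge0// ltW.
apply: ler_pM.
- by rewrite exprn_ge0//; lra.
- exact: addr_ge0.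
- apply: (@le_trans _ _ (expR (2 * tau) ^+ n)).
    by apply: lerXn2r; rewrite ?nnegrE ?expR_ge0 ?expR_ge1Dx//; lra.
  by rewrite -expRM_natl ler_expR mulrCA; lra.
- rewrite lerD2l; have := ler_wpM2r B0 nT'; lra.
Qed.

Section SquaredNorms.
Variables (R : realType) (xmin xmax : R) (N : nat).
Local Notation ip := (@ip R xmin xmax N).

Lemma ip_subE (p q : broken R N) : bcont p -> bcont q ->
  ip (fun i x => p i x - q i x) (fun i x => p i x - q i x) = ip p p - 2 * ip p q + ip q q.
Proof.
move=> cp cq; have cd : bcont (fun i x => p i x - q i x) by move=> i; exact: contB.
have E : forall r : broken R N, bcont r -> ip (fun i x => p i x - q i x) r = ip p r - ip q r.
  move=> r cr; have := ip_lin xmin xmax (-1) cq cp cr; rewrite mulN1r addrC => <-.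
  by apply: eq_ip => // i x _; rewrite mulN1r addrC.
have E2 r (cr : bcont r) : ip r (fun i x => p i x - q i x) = ip p r - ip q r by rewrite ip_sym E.
rewrite (E _ cd) (E2 _ cp) (E2 _ cq) (ip_sym xmin xmax q p); ring.
Qed.

Lemma ip_sub_le (p q : broken R N) : bcont p -> bcont q ->
  ip (fun i x => p i x - q i x) (fun i x => p i x - q i x) <= 2 * (ip p p + ip q q).
Proof.
move=> cp cq; rewrite ip_subE//.
have /ler_normlP[H _] := ip_young_abs xmin xmax ltr01 cp cq; lra.
Qed.

End SquaredNorms.

(** * Initial energy and passage to the total error *)

Section TimeStepBound.
Variables (R : realType) (m : model) (k : nat) (Cinv Chinv eps h : R).
Hypotheses (Cinv0 : 0 < Cinv) (Chinv0 : 0 < Chinv) (eps0 : 0 < eps) (h0 : 0 < h).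

(** A constant for which the stable time step is at most [step_ratio * (h * (h + eps))], for every
    [k]. It serves only to bound $\tau/h$, which the estimate of the first step produces. *)
Definition step_ratio : R := 2 * (1 + alpha3 m Cinv) / (alpha2 m Cinv * alpha3 m Cinv).

Lemma step_ratio_gt0 : 0 < step_ratio.
Proof.
rewrite /step_ratio /alpha2 /alpha3 vsup1 -/vabs.
by have := vabs_gt0 R m => a0; rewrite divr_gt0// ?mulr_gt0// ?addr_gt0// ?mulr_gt0.
Qed.

Lemma dt_stab_le : dt_stab m k Cinv Chinv eps h <= step_ratio * (h * (h + eps)).
Proof.
have a0 := vabs_gt0 R m; have q0 := vsqr_gt0 R m.
rewrite /dt_stab /step_ratio /alpha1 /alpha2 /alpha3 vsup1 expr1n -/vsqr -/vabs.
set al1 := (1 + vsqr R m) * Chinv; set al2 := 2 * (1 + vabs R m) * Cinv.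
set al3 := 2 * 1 * Cinv; set x := Num.min _ _.
have al10 : 0 < al1 by rewrite mulr_gt0//; lra.
have al20 : 0 < al2 by rewrite mulr_gt0//; lra.
have al30 : 0 < al3 by rewrite !mulr_gt0.
have xe : x <= eps by rewrite /x ge_min lexx.
clearbody al1 al2 al3 x.
have P0 : 0 < al2 * al3 by rewrite mulr_gt0.
have key (y : R) : y <= eps -> h + y * al3 <= (1 + al3) * (h + eps).
  move=> ye; have -> : (1 + al3) * (h + eps) = h + eps * al3 + (eps + al3 * h) by ring.
  rewrite -[leLHS]addr0; apply: lerD; first by rewrite lerD2l ler_wpM2r// ltW.
  by rewrite addr_ge0 ?mulr_ge0 ?ltW.
have h2 : 0 <= h / (al2 * al3) by rewrite divr_ge0 ?ltW.
have E : 2 * (1 + al3) / (al2 * al3) * (h * (h + eps)) = 2 * (h / (al2 * al3)) * ((1 + al3) * (h + eps)).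
  by field; rewrite !gt_eqF.
rewrite E; case: ifP => _.
  by rewrite -[2 * h / _]mulrA [al3 * eps]mulrC; apply: ler_wpM2l; [exact: mulr_ge0|exact: key].
apply: (@le_trans _ _ (h / (al1 + al2 * al3) * ((1 + al3) * (h + eps)))).
  by apply: ler_wpM2l; [rewrite divr_ge0 ?addr_ge0 ?ltW|exact: key].
apply: ler_wpM2r; first by rewrite mulr_ge0 ?addr_ge0 ?ltW.
apply: (@le_trans _ _ (h / (al2 * al3))); last by rewrite ler_peMl// ler1n.
by rewrite ler_wpM2l ?(ltW h0)// lef_pV2 ?posrE ?addr_gt0// lerDr ltW.
Qed.

End TimeStepBound.

Section ProjectionNorms.
Variables (R : realType) (m : model) (xmin xmax : R) (k N : nat) (Cinv Chinv T Mb : R).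
Hypotheses (xab : xmin < xmax) (N0 : (0 < N)%N)
  (Cinv0 : 0 < Cinv) (Chinv0 : 0 < Chinv)
  (inv : inverse_inequalities k Cinv Chinv).
Local Notation U := (Uh R k N).
Local Notation h := (mesh_size xmin xmax N).
Local Notation ip := (@ip R xmin xmax N).
Local Notation tb := (@to_broken R k N).
Local Notation perr := (@perr R xmin xmax k N).
Local Notation projU := (@projU R xmin xmax k N).
Local Notation Kerr := (Kerr k Cinv Chinv).
Local Notation Gen := (@Gen R m xmin xmax k N).
Local Notation normsq := (@normsq R m xmin xmax T).
Variable u : R -> R -> R -> R.
Hypothesis su : smooth m T u.

Lemma ip_perr_le kd v t : Omega_v m v -> 0 <= t <= T ->
  ip (perr kd (fun x => jet T u [::] x v t)) (perr kd (fun x => jet T u [::] x v t)) <=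
  Kerr * h ^+ (2 * k + 2) * I xmin xmax (fun x => jet T u (highx k [::]) x v t ^+ 2).
Proof.
move=> Ov tT; rewrite -mulrA.
exact: (perr_norm xab N0 Cinv0 Chinv0 inv (D := fun j x => jet T u (nseq j DirX ++ [::]) x v t)
  (fun j _ x => jet_chain su [::] Ov tT j x) (jet_cont su (w := highx k [::]) Ov tT) kd).
Qed.

(** Two projections of one function differ by the difference of their errors. This compares the
    $L^2$ initial data with the projections used in the analysis. *)
Lemma Gen_proj_sub kd kd' (xi : R -> U) t : 0 <= t <= T -> normsq u (highx k [::]) t <= Mb ->
  (forall v, Omega_v m v -> xi v = projU kd (fun x => jet T u [::] x v t) - projU kd' (fun x => jet T u [::] x v t)) ->
  UL2 m xi -> Gen xi <= 4 * (Kerr * h ^+ (2 * k + 2) * Mb).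
Proof.
move=> tT nM E x2; have i1 := vint_normsq xab su (highx k [::]) tT.
have K0 := Kerr_h_ge0 k xab N0 Cinv0 Chinv0 (2 * k + 2).
apply: (@le_trans _ _ (4 * (Kerr * h ^+ (2 * k + 2)) * normsq u (highx k [::]) t)); last first.
  by rewrite [leRHS]mulrA ler_wpM2l// mulr_ge0.
rewrite /normsq -(avgZ _ i1); apply: avg_le; [exact: vint_ip|exact: vintZ|] => v Ov.
have cw := jet_cont su (w := [::]) Ov tT.
have b1 : bcont (perr kd (fun x => jet T u [::] x v t)) by exact: bcont_perr.
have b2 : bcont (perr kd' (fun x => jet T u [::] x v t)) by exact: bcont_perr.
have := ip_sub_le xmin xmax b2 b1; have := ip_perr_le kd Ov tT; have := ip_perr_le kd' Ov tT.
have -> : ip (tb (xi v)) (tb (xi v)) =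
    ip (fun i x => perr kd' (fun x => jet T u [::] x v t) i x - perr kd (fun x => jet T u [::] x v t) i x)
       (fun i x => perr kd' (fun x => jet T u [::] x v t) i x - perr kd (fun x => jet T u [::] x v t) i x).
  have e i x : tb (xi v) i x = perr kd' (fun x => jet T u [::] x v t) i x - perr kd (fun x => jet T u [::] x v t) i x.
    rewrite E// /perr /to_broken /poly_at !ffunE/= !hornerE; ring.
  by apply: eq_ip => i x _.
move: (ip _ _) (ip _ _) (ip _ _) (_ ^+ (2 * k + 2)) (\int[_]_(_ in _) _) => A B C H J; lra.
Qed.

Lemma ip_tbN (a b : U) : ip (tb (a - b)) (tb (a - b)) = ip (tb (b - a)) (tb (b - a)).
Proof.
have -> : a - b = -1 *: (b - a) by rewrite scaleN1r opprB.
by rewrite (linZ (lin_ipUl _ _ _)) (linZ (lin_ipUr _ _ _)) mulrA mulrNN !mul1r.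
Qed.

Lemma error_split kd (q : U) (W : R -> R) : continuous W ->
  ip (fun i x => W x - tb q i x) (fun i x => W x - tb q i x) <=
  2 * (ip (perr kd W) (perr kd W) + ip (tb (projU kd W - q)) (tb (projU kd W - q))).
Proof.
move=> cw; have cp : bcont (perr kd W) by exact: bcont_perr.
rewrite (ip_tbN (projU kd W) q).
have := ip_sub_le xmin xmax cp (@bcont_tb R k N (q - projU kd W)).
apply: le_trans; rewrite le_eqVlt; apply/orP; left; apply/eqP.
have e i x : W x - tb q i x = perr kd W i x - tb (q - projU kd W) i x.
  by rewrite /perr /to_broken /poly_at !ffunE/= !hornerE; ring.
by apply: eq_ip => i x _.
Qed.

Lemma avg_error_le kd (q xi : R -> U) t : 0 <= t <= T -> normsq u (highx k [::]) t <= Mb ->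
  UL2 m q -> UL2 m xi ->
  (forall v, Omega_v m v -> xi v = projU kd (fun x => jet T u [::] x v t) - q v) ->
  avg m (fun v => ip (fun i x => jet T u [::] x v t - tb (q v) i x) (fun i x => jet T u [::] x v t - tb (q v) i x)) <=
  2 * (Kerr * h ^+ (2 * k + 2) * Mb + Gen xi).
Proof.
move=> tT nM q2 x2 E; have i1 := vint_normsq xab su (highx k [::]) tT.
have i0 := vint_normsq xab su [::] tT.
have i2 := vint_ip xmin xmax x2 x2; have i3 := vint_ip xmin xmax q2 q2.
have i4 := vint_ip_whole xab N0 su [::] tT q2.
have K0 := Kerr_h_ge0 k xab N0 Cinv0 Chinv0 (2 * k + 2).
apply: (@le_trans _ _ (2 * (Kerr * h ^+ (2 * k + 2) * normsq u (highx k [::]) t + Gen xi))); last first.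
  by rewrite ler_wpM2l// lerD2r ler_wpM2l.
rewrite /normsq /Gen -(avgZ _ i1) -(avgD (vintZ _ i1) i2) -(avgZ _ (vintD (vintZ _ i1) i2)).
apply: avg_le; [|exact/vintZ/vintD/i2/vintZ|].
  apply: (vint_ext _ (vintD (vintB i0 (vintZ 2 i4)) i3)) => v Ov.
  have cw := jet_cont su (w := [::]) Ov tT.
  have cb : bcont (@whole R N (fun x => jet T u [::] x v t)) by move=> i.
  by rewrite -(ip_whole_self xab N0 cw) -(ip_subE xmin xmax cb (@bcont_tb R k N (q v))).
move=> v Ov; apply: le_trans (error_split kd (q v) (jet_cont su (w := [::]) Ov tT)) _.
by rewrite E// ler_wpM2l// lerD2r; exact: ip_perr_le.
Qed.

End ProjectionNorms.

Lemma initial_energy_algebra (R : realType) (r0 r1 G e X B tB W s q : R) :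
  0 <= e -> 0 <= W -> 0 <= s -> 0 <= G ->
  s <= 2 * q * (1 + e) -> r1 <= 4 * r0 + 8 * tB + 32 * (s * W * G) ->
  r0 <= 4 * X -> G <= 4 * X -> tB <= 2^-1 * B ->
  r1 + e * G <= (20 + 256 * (q * W)) * ((1 + e) * X) + 4 * B.
Proof.
move=> e0 W0 s0 G0 sq H1 H2 H3 H4.
have X0 : 0 <= X by lra.
have K1 := ler_pM (mulr_ge0 s0 W0) G0 (ler_wpM2r W0 sq) H3.
have K2 := ler_wpM2l e0 H3; have K3 := mulr_ge0 e0 X0.
apply: (@le_trans _ _ (16 * X + 4 * B + 32 * (2 * q * (1 + e) * W * (4 * X)) + e * (4 * X))).
  move: (s * W * G) (2 * q * (1 + e) * W * (4 * X)) (e * G) (e * (4 * X)) K1 K2 H1 => a b c d; lra.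
rewrite -subr_ge0.
have -> : (20 + 256 * (q * W)) * ((1 + e) * X) + 4 * B - (16 * X + 4 * B + 32 * (2 * q * (1 + e) * W * (4 * X)) + e * (4 * X))
  = 4 * X + 16 * (e * X) by ring.
by lra.
Qed.

(** Dividing the bound on the time step by [y] leaves [c * (y + eps)], and
    $(y+\varepsilon)^2\le2(y^2+\varepsilon^2)\le2(1+L^2)(1+\varepsilon^2)$. With [y] the mesh size
    and [L] the length of the domain, the bound is uniform in the mesh. *)
Lemma time_step_ratio (R : realType) (tau s d c y eps L : R) :
  0 < tau -> 0 < s -> s < 1 -> 0 < eps -> 0 < y -> 0 < c -> tau <= s * d -> d <= c * (y * (y + eps)) -> y <= L ->
  (tau / y) ^+ 2 <= 2 * (c ^+ 2 * (1 + L ^+ 2)) * (1 + eps ^+ 2).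
Proof.
move=> tau0 s0 s1 eps0 y0 c0 td dc yL.
have d0 : 0 < d by have := lt_le_trans tau0 td; rewrite pmulr_rgt0.
have td' : tau <= d by apply: le_trans td _; rewrite ler_piMl ?ltW.
have H : tau / y <= c * (y + eps).
  rewrite ler_pdivrMr//; apply: (le_trans td'); apply: (le_trans dc).
  by rewrite -mulrA [y * _]mulrC.
have H2 : (tau / y) ^+ 2 <= (c * (y + eps)) ^+ 2.
  by apply: lerXn2r => //; rewrite nnegrE ?divr_ge0 ?mulr_ge0 ?addr_ge0 ?ltW.
apply: (le_trans H2); rewrite exprMn.
have -> : 2 * (c ^+ 2 * (1 + L ^+ 2)) * (1 + eps ^+ 2) = c ^+ 2 * (2 * (1 + L ^+ 2) * (1 + eps ^+ 2)) by ring.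
apply: ler_wpM2l; first exact: sqr_ge0.
have yL2 : y ^+ 2 <= L ^+ 2.
  by apply: lerXn2r => //; rewrite nnegrE ltW// (lt_le_trans y0).
have := sqr_ge0 (y - eps); have := mulr_ge0 (sqr_ge0 L) (sqr_ge0 eps); rewrite sqrrB sqrrD mulrDr; lra.
Qed.

Section ErrorBounds.
Variables (R : realType) (m : model) (xmin xmax : R) (k N : nat) (Cinv Chinv T eps Mb : R).
Variables (rho : R -> R -> R) (g : R -> R -> R -> R) (fl : flux).
Hypotheses (xab : xmin < xmax) (N0 : (0 < N)%N)
  (Cinv0 : 0 < Cinv) (Chinv0 : 0 < Chinv)
  (inv : inverse_inequalities k Cinv Chinv)
  (T0 : 0 < T) (eps0 : 0 < eps)
  (sol : smooth_solution m xmin xmax eps T rho g).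
Local Notation U := (Uh R k N).
Local Notation h := (mesh_size xmin xmax N).
Local Notation ip := (@ip R xmin xmax N).
Local Notation tb := (@to_broken R k N).
Local Notation avg := (avg m).
Local Notation Om := (@Omega_v R m).
Local Notation Kerr := (Kerr k Cinv Chinv).
Local Notation Gen := (@Gen R m xmin xmax k N).
Local Notation Jen := (@Jen R m xmin xmax k N).
Local Notation normsq := (@normsq R m xmin xmax T).
Local Notation r_ := (vconst rho).
Local Notation Pg := (@Pg R xmin xmax k N T g fl).
Hypotheses
  (Hr1 : forall s, 0 <= s <= T -> normsq r_ [:: DirT; DirT] s <= Mb)
  (Hr2 : forall s, 0 <= s <= T -> normsq r_ [:: DirX; DirT] s <= Mb)
  (Hr3 : forall s, 0 <= s <= T -> normsq r_ (highx k [::]) s <= Mb)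
  (Hr4 : forall s, 0 <= s <= T -> normsq r_ (highx k [:: DirT]) s <= Mb)
  (Hg1 : forall s, 0 <= s <= T -> normsq g [:: DirT; DirT] s <= Mb)
  (Hg2 : forall s, 0 <= s <= T -> normsq g [:: DirT] s <= Mb)
  (Hg3 : forall s, 0 <= s <= T -> normsq g (highx k [::]) s <= Mb)
  (Hg4 : forall s, 0 <= s <= T -> normsq g (highx k [:: DirT]) s <= Mb).


Variables (tau sigma : R) (rhoh : nat -> U) (gh : nat -> R -> U).
Hypotheses (s01 : 0 < sigma < 1) (tau0 : 0 < tau)
  (tau_le : tau <= sigma * dt_stab m k Cinv Chinv eps h)
  (gh0 : forall v, Om v -> gh 0%N v = pi_h xmin xmax k N (fun x => g x v 0))
  (dg : dg_imex1 m xmin xmax fl eps tau rhoh gh).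


Hypotheses (rhoh0 : rhoh 0%N = pi_h xmin xmax k N (fun x => rho x 0)) (tau_half : tau < 2^-1).

Let h0 : 0 < h := h_gt0 xab N0.
Let sr := smooth_rho sol.
Let sg := smooth_g sol.
Let T00 : (0 : R) <= 0 <= T.
Proof. by apply/andP; split; [exact: lexx|exact: ltW]. Qed.
Local Notation err_rho := (err_rho xmin xmax T rho fl tau rhoh).
Local Notation err_g := (err_g xmin xmax T g fl tau gh).
Local Notation err_energy := (err_energy m xmin xmax T eps rho g fl tau rhoh gh).
Local Notation rcons := (rho_consistency xmin xmax k N Cinv Chinv Mb fl tau).
Local Notation gcons := (g_consistency xmin xmax k N Cinv Chinv eps Mb fl tau sigma).

Lemma Mb_ge0 : 0 <= Mb.
Proof. exact: le_trans (normsq_ge0 m xmin xmax T g [:: DirT] 0) (Hg2 T00). Qed.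

Lemma err_g0_le : 0%:R * tau <= T -> Gen (err_g 0) <= 4 * (Kerr * h ^+ (2 * k + 2) * Mb).
Proof.
move=> tT; have x2 := err_g_UL2 xab N0 Cinv0 Chinv0 inv sol tau0 dg tT.
apply: (Gen_proj_sub xab N0 Cinv0 Chinv0 inv sg T00 (Hg3 T00) (kd := flux_kind fl) (kd' := ProjL2)) => // v Ov.
rewrite /err_g /Pg mul0r gh0// (pi_h_projU xab N0 Cinv0 Chinv0 inv)//.
exact: (jet_cont sg (w := [::]) Ov T00).
Qed.

Lemma err_rho0_le : ip (tb (err_rho 0)) (tb (err_rho 0)) <= 4 * (Kerr * h ^+ (2 * k + 2) * Mb).
Proof.
have -> : ip (tb (err_rho 0)) (tb (err_rho 0)) = Gen (fun=> err_rho 0) by rewrite /Gen avg_cst.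
apply: (Gen_proj_sub xab N0 Cinv0 Chinv0 inv sr T00 (Hr3 T00) (kd := flux_kind (swap fl)) (kd' := ProjL2)); last exact: UL2_cst.
move=> v Ov; rewrite /err_rho mul0r (Prho_v xmin xmax k N T rho fl 0 v) rhoh0 (pi_h_projU xab N0 Cinv0 Chinv0 inv)//.
exact: (jet_cont sr (w := [::]) Ov T00).
Qed.

Definition first_step_weight : R := vsqr R m * cvol k Chinv + vabs R m * cjmp k Cinv * (4 * Cinv).

Lemma first_step_weight_ge0 : 0 <= first_step_weight.
Proof.
have a0 := ltW (vabs_gt0 R m); have q0 := ltW (vsqr_gt0 R m).
by rewrite /first_step_weight addr_ge0// !mulr_ge0// ?cvol_ge0 ?(ltW (cjmp_gt0 _ _)) ?ltW.
Qed.

(** The energy of index 0 contains the error of $\rho$ after one step, which the initialization does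
    not control. The first $\rho$ equation is tested with that error, and the form [a_h] of the
    initial error of $g$ is bounded by inverse inequalities; these bring the factor $(\tau/h)^2$. *)
Lemma err_rho1_le : 1%:R * tau <= T ->
  ip (tb (err_rho 1)) (tb (err_rho 1)) <=
  4 * ip (tb (err_rho 0)) (tb (err_rho 0)) + 8 * (tau * rcons) + 32 * ((tau / h) ^+ 2 * first_step_weight * Gen (err_g 0)).
Proof.
move=> tT; have T0' : 0%:R * tau <= T by rewrite mul0r ltW.
have x2 := err_g_UL2 xab N0 Cinv0 Chinv0 inv sol tau0 dg T0'.
(* With the weight [4 * tau] the form takes 1/8 of the new square, the scalar product with the old
   error takes 1/2, and the residual takes at most 1/4 since $\tau<\frac12$. One eighth remains,
   hence the factors 4, 8 and 32. *)
have t4 : 0 < 4 * tau by rewrite mulr_gt0.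
have := err_rho_defect xab N0 Cinv0 Chinv0 inv sol Hr1 Hr4 Hg3 tau0 dg (err_rho 1) tT.
have := a_h_young xab N0 Cinv0 Chinv0 inv fl (err_rho 1) t4 x2.
have := ip_young_abs xmin xmax ltr01 (@bcont_tb R k N (err_rho 0)) (@bcont_tb R k N (err_rho 1)).
have := Jen_le xab N0 inv x2.
have /= := linB (lin_ipUl xmin xmax (err_rho 1)) (err_rho 1) (err_rho 0).
rewrite /rho_defect /first_step_weight => ->.
have := ip_ge0 xmin xmax (tb (err_rho 1)); have := vabs_gt0 R m; have := cjmp_gt0 k Cinv0.
move: (ip (tb (err_rho 0)) (tb (err_rho 1))) => r01.
move: (ip (tb (err_rho 0)) (tb (err_rho 0))) => r0.
move: (ip (tb (err_rho 1)) (tb (err_rho 1))) => r1.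
move: (a_h _ _ _ _ _ _) (Gen _) (Jen _) (rho_consistency _ _ _ _ _ _ _ _ _) => A G J B.
move: (cjmp _ _) (cvol _ _) (vabs _ _) (vsqr _ _) => cj cv va vs cj0 va0 r10 HJ /ler_normlP[_ H1] /ler_normlP[H2 _] H3.
have {}HJ : J <= 4 * Cinv * G / h by rewrite ler_pdivlMr// mulrC.
have {}HJ : va * cj / h * J <= va * cj / h * (4 * Cinv * G / h).
  by apply: ler_wpM2l => //; apply: divr_ge0; [apply: mulr_ge0|]; exact: ltW.
have H4 := ler_wpM2l (ltW tau0) H2; rewrite mulrN in H4.
have H5 := ler_wpM2l (ltW (mulr_gt0 tau0 t4)) HJ.
have E1 : tau * (r1 / (2 * (4 * tau)) + 4 * tau * (vs * cv / h ^+ 2 * G + va * cj / h * J)) =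
  r1 / 8 + tau * (4 * tau) * (vs * cv / h ^+ 2 * G) + tau * (4 * tau) * (va * cj / h * J).
  by field; rewrite !gt_eqF.
rewrite E1 in H4.
have E2 : 32 * ((tau / h) ^+ 2 * (vs * cv + va * cj * (4 * Cinv)) * G) =
  8 * (tau * (4 * tau) * (vs * cv / h ^+ 2 * G) + tau * (4 * tau) * (va * cj / h * (4 * Cinv * G / h))).
  by field; rewrite gt_eqF.
rewrite E2.
have H6 : tau * r1 <= 2^-1 * r1 by rewrite ler_wpM2r// ltW.
move: (tau * (4 * tau) * (va * cj / h * (4 * Cinv * G / h))) (tau * (4 * tau) * (va * cj / h * J)) H5 H4 => X Y H5 H4.
move: (tau * (4 * tau) * (vs * cv / h ^+ 2 * G)) H4 => Z H4.
move: H3; rewrite mulrDr; move: (tau * B) => tB.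
rewrite mulrCA; move: (tau * r1) H6 => tr H6; move: (tau * A) H4 => tA.
lra.
Qed.

Definition initial_weight : R :=
  Kerr * (20 + 256 * (step_ratio m Cinv ^+ 2 * (1 + (xmax - xmin) ^+ 2) * first_step_weight)).

Lemma central_weight_ge0 : 0 <= central_weight R fl.
Proof. by case: fl; rewrite /= ?ler01. Qed.

Lemma h_le : h <= xmax - xmin.
Proof.
by rewrite /mesh_size ler_pdivrMr ?ltr0n// ler_peMr ?ler1n// subr_ge0 ltW.
Qed.

Lemma tau_h_le : (tau / h) ^+ 2 <= 2 * (step_ratio m Cinv ^+ 2 * (1 + (xmax - xmin) ^+ 2)) * (1 + eps ^+ 2).
Proof.
case/andP: s01 => s0 s1.
exact: (time_step_ratio tau0 s0 s1 eps0 h0 (step_ratio_gt0 m Cinv0) tau_le (dt_stab_le m k Cinv0 Chinv0 eps0 h0) h_le).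
Qed.

Lemma rho_consistency_ge0 : 0 <= rcons.
Proof.
have M0 := Mb_ge0; have w0 := central_weight_ge0.
have K0 n : 0 <= Kerr * h ^+ n * Mb by rewrite mulr_ge0// (Kerr_h_ge0 k xab N0 Cinv0 Chinv0).
rewrite /rho_consistency; apply: addr_ge0; last first.
  by apply: mulr_ge0 => //; apply: mulr_ge0 => //; rewrite mulr_ge0// ltW.
apply: addr_ge0; last by apply: mulr_ge0.
by apply: mulr_ge0 => //; apply: mulr_ge0 => //; exact: sqr_ge0.
Qed.

Lemma g_consistency_ge0 : 0 <= gcons.
Proof.
have M0 := Mb_ge0; have w0 := central_weight_ge0.
have q0 : 0 < 1 - sigma by case/andP: s01 => _; rewrite subr_gt0.
have K0 n : 0 <= Kerr * h ^+ n * Mb by rewrite mulr_ge0// (Kerr_h_ge0 k xab N0 Cinv0 Chinv0).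
have K1 n : 0 <= Kerr * h ^+ n * Mb / (1 - sigma) by rewrite divr_ge0// ltW.
have e4 n : 0 <= eps ^+ n by rewrite exprn_ge0// ltW.
have t2 : 0 <= tau ^+ 2 * Mb / (1 - sigma) by rewrite divr_ge0 ?(ltW q0)// mulr_ge0// sqr_ge0.
rewrite /g_consistency; apply: addr_ge0; last by apply: mulr_ge0.
apply: addr_ge0; last first.
  by apply: mulr_ge0 => //; rewrite divr_ge0 ?(ltW q0)// mulr_ge0// mulr_ge0// ltW.
apply: addr_ge0; last exact: mulr_ge0.
apply: addr_ge0; last first.
  by apply: mulr_ge0 => //; rewrite divr_ge0 ?(ltW q0)// mulr_ge0// ltW.
apply: addr_ge0; last by apply: mulr_ge0 => //; exact: mulr_ge0.
by apply: mulr_ge0 => //; rewrite divr_ge0 ?(ltW q0)// mulr_ge0// mulr_ge0// sqr_ge0.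
Qed.

Lemma err_energy0_le : 1%:R * tau <= T ->
  err_energy 0 <= initial_weight * ((1 + eps ^+ 2) * (h ^+ (2 * k + 2) * Mb)) + 4 * rcons.
Proof.
move=> tT; have T0' : 0%:R * tau <= T by rewrite mul0r ltW.
have rt : tau * rcons <= 2^-1 * rcons by rewrite ler_wpM2r ?rho_consistency_ge0// ltW.
have KM0 : 0 <= Kerr * h ^+ (2 * k + 2) * Mb.
  by rewrite mulr_ge0 ?Mb_ge0// (Kerr_h_ge0 k xab N0 Cinv0 Chinv0).
apply: le_trans (initial_energy_algebra (exprn_ge0 2 (ltW eps0)) first_step_weight_ge0 (sqr_ge0 (tau / h))
  (Gen_ge0 m xmin xmax _) tau_h_le (err_rho1_le tT) err_rho0_le (err_g0_le T0') rt) _.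
rewrite /initial_weight lerD2r le_eqVlt; apply/orP; left; apply/eqP.
move: (step_ratio _ _) (xmax - xmin) (first_step_weight) (h ^+ _) Kerr => *; ring.
Qed.

Lemma err_energy_le n : n.+1%:R * tau <= T ->
  err_energy n <= expR (2 * T) * (err_energy 0 + 2 * T * (rcons + gcons)).
Proof.
apply: (discrete_gronwall tau0 tau_half).
- by rewrite addr_ge0 ?rho_consistency_ge0 ?g_consistency_ge0.
- by move=> p; rewrite /err_energy addr_ge0 ?ip_ge0// mulr_ge0 ?sqr_ge0 ?Gen_ge0.
- move=> p; exact: (err_energy_growth xab N0 Cinv0 Chinv0 inv T0 eps0 sol Hr1 Hr2 Hr3 Hr4 Hg1 Hg2 Hg3 Hg4 s01 tau0 tau_le gh0 dg).
Qed.

Let step_in n : n%:R * tau <= T -> 0 <= n%:R * tau <= T.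
Proof. by move=> nT; rewrite nT mulr_ge0// ltW. Qed.

Lemma total_rho_le n : n%:R * tau <= T ->
  ip (fun i x => rho x (n%:R * tau) - tb (rhoh n) i x) (fun i x => rho x (n%:R * tau) - tb (rhoh n) i x) <=
  2 * (Kerr * h ^+ (2 * k + 2) * Mb + ip (tb (err_rho n)) (tb (err_rho n))).
Proof.
move=> nT; have tT := step_in nT.
have -> : Kerr * h ^+ (2 * k + 2) * Mb + ip (tb (err_rho n)) (tb (err_rho n)) =
    Kerr * h ^+ (2 * k + 2) * Mb + Gen (fun=> err_rho n) by rewrite /Gen avg_cst.
rewrite -[leLHS](avg_cst m).
exact: (avg_error_le xab N0 Cinv0 Chinv0 inv sr (kd := flux_kind (swap fl)) tT (Hr3 tT)
  (UL2_cst m (rhoh n)) (UL2_cst m (err_rho n)) (fun v _ => erefl)).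
Qed.

Lemma total_g_le n : n%:R * tau <= T ->
  avg (fun v => ip (fun i x => g x v (n%:R * tau) - tb (gh n v) i x) (fun i x => g x v (n%:R * tau) - tb (gh n v) i x)) <=
  2 * (Kerr * h ^+ (2 * k + 2) * Mb + Gen (err_g n)).
Proof.
move=> nT; have tT := step_in nT.
exact: (avg_error_le xab N0 Cinv0 Chinv0 inv sg (kd := flux_kind fl) tT (Hg3 tT) (scheme_UL2 dg n)
  (err_g_UL2 xab N0 Cinv0 Chinv0 inv sol tau0 dg nT) (fun v _ => erefl)).
Qed.

(** Each total error is the projection error plus the discrete error. The levels [n.+1] for $\rho$
    and [n] for $g$ are those of the energy of index [n], so no further step in time is needed. *)
Lemma total_error_le n : n.+1%:R * tau <= T ->
  ip (fun i x => rho x (n.+1%:R * tau) - tb (rhoh n.+1) i x) (fun i x => rho x (n.+1%:R * tau) - tb (rhoh n.+1) i x)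
  + eps ^+ 2 * avg (fun v => ip (fun i x => g x v (n%:R * tau) - tb (gh n v) i x) (fun i x => g x v (n%:R * tau) - tb (gh n v) i x))
  <= 2 * ((1 + eps ^+ 2) * (Kerr * h ^+ (2 * k + 2) * Mb)) +
     2 * (expR (2 * T) * (initial_weight * ((1 + eps ^+ 2) * (h ^+ (2 * k + 2) * Mb)) + 4 * rcons + 2 * T * (rcons + gcons))).
Proof.
move=> nT.
have le_T p : (p <= n.+1)%N -> p%:R * tau <= T.
  by move=> pn; apply: le_trans nT; apply: ler_wpM2r; [exact: ltW|rewrite ler_nat].
have H1 := total_rho_le nT; have H2 := ler_wpM2l (sqr_ge0 eps) (total_g_le (le_T _ (leqnSn n))).
apply: (le_trans (lerD H1 H2)).
have H3 := err_energy_le nT; rewrite /err_energy in H3.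
have H4 := ler_wpM2l (expR_ge0 (2 * T)) (err_energy0_le (le_T 1%N isT)); rewrite /err_energy in H4.
rewrite !mulrDr in H3 H4 *.
move: (ip _ _) (ip _ _) (Gen _) (Gen _) H3 H4 => r0 r1 g0 g1 H3 H4; lra.
Qed.

End ErrorBounds.

(** * Proof of the error estimate *)

Section NormBounds.
Variables (R : realType) (m : model) (xmin xmax T : R).
Hypothesis xab : xmin < xmax.
Local Notation normsq := (@normsq R m xmin xmax T).
Local Notation L2norm := (@L2norm R xmin xmax).
Local Notation Hnorm := (@Hnorm R xmin xmax).

Lemma L2norm_sqr u : L2norm u ^+ 2 = I xmin xmax (fun x => u x ^+ 2).
Proof. by rewrite sqr_sqrtr// I_ge0// => x _; exact: sqr_ge0. Qed.

Lemma Hnorm_sqr l u : Hnorm l u ^+ 2 = \sum_(j < l.+1) I xmin xmax (fun x => derive1n j u x ^+ 2).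
Proof.
rewrite sqr_sqrtr; last by rewrite sumr_ge0// => j _; exact: sqr_ge0.
by apply: eq_bigr => j _; rewrite L2norm_sqr.
Qed.

Lemma I_le_Hnorm l j (u : R -> R) : (j <= l)%N -> I xmin xmax (fun x => derive1n j u x ^+ 2) <= Hnorm l u ^+ 2.
Proof.
rewrite -ltnS => jl; rewrite Hnorm_sqr (bigD1 (Ordinal jl))//= lerDl.
by rewrite sumr_ge0// => i _; apply: I_ge0 => x _; exact: sqr_ge0.
Qed.

Lemma normsq_vconst rho w t v :
  normsq (vconst rho) w t = I xmin xmax (fun x => jet T (vconst rho) w x v t ^+ 2).
Proof. by rewrite -[RHS](avg_cst m). Qed.

Lemma normsq_vconst_Hnorm rho l j w t v : (j <= l)%N ->
  normsq (vconst rho) (nseq j DirX ++ w) t <= Hnorm l (fun x => jet T (vconst rho) w x v t) ^+ 2.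
Proof.
move=> jl; rewrite (normsq_vconst _ _ _ v); have := I_le_Hnorm (fun x => jet T (vconst rho) w x v t) jl.
by rewrite -jet_derive1n.
Qed.

Lemma normsq_Hnorm (u : R -> R -> R -> R) l j w t : smooth m T u -> 0 <= t <= T -> (j <= l)%N ->
  normsq u (nseq j DirX ++ w) t <= avg m (fun v => Hnorm l (fun x => jet T u w x v t) ^+ 2).
Proof.
move=> su tT jl; apply: avg_le; first exact: (vint_normsq xab su _ tT).
  apply: (vint_ext (f := fun v => \sum_(j < l.+1) I xmin xmax (fun x => jet T u (nseq j DirX ++ w) x v t ^+ 2))).
    by move=> v _; rewrite Hnorm_sqr; apply: eq_bigr => i _; rewrite -jet_derive1n.
  by apply: vint_sum => i; exact: (vint_normsq xab su _ tT).
move=> v Ov; have := I_le_Hnorm (fun x => jet T u w x v t) jl.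
by rewrite -jet_derive1n.
Qed.

Lemma normsq_vnorm (u : R -> R -> R -> R) w t :
  normsq u w t = vnorm m (fun v => L2norm (fun x => jet T u w x v t)) ^+ 2.
Proof.
rewrite sqr_sqrtr; last by apply: avg_ge0 => v _; exact: sqr_ge0.
by apply: avg_ext => v _; rewrite L2norm_sqr.
Qed.

Lemma sqr_le_bound (a M : R) : 0 <= a -> a <= M -> a ^+ 2 <= M ^+ 2 + `|M| + 1.
Proof.
move=> a0 aM; apply: (@le_trans _ _ (M ^+ 2)).
  by apply: lerXn2r => //; rewrite nnegrE// (le_trans a0).
by rewrite -addrA lerDl addr_ge0.
Qed.

Lemma le_bound (a M : R) : a <= M -> a <= M ^+ 2 + `|M| + 1.
Proof. by move=> aM; have := sqr_ge0 M; have := ler_norm M; lra. Qed.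

End NormBounds.

(** * Comparison of the consistency terms with the claimed rates *)

Section ConsistencyAlgebra.
Variables (R : realType) (K Mb C c e t H0 H1 H2 S q w X : R).
Hypotheses (K1 : 1 <= K) (M0 : 0 <= Mb) (C0 : 0 <= C) (c0 : 0 <= c) (c1 : 1 <= c) (e0 : 0 <= e) (q0 : 0 < q)
  (t0 : 0 <= t) (H10 : 0 <= H1) (H20 : 0 <= H2) (S0 : 0 <= S)
  (H2S : H2 <= c * S) (wS : w * H0 <= S)
  (EX : X = e ^+ 2 * H2 + S + t + q^-1 * ((1 + e ^+ 4) * t + S + e * H1)).

Let K0 : 0 <= K. Proof. exact: le_trans K1. Qed.
Let qi : 0 <= q^-1. Proof. by rewrite invr_ge0 ltW. Qed.
Let a0 : 0 <= e ^+ 2 * H2. Proof. by rewrite mulr_ge0// sqr_ge0. Qed.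
Let d0 : 0 <= q^-1 * (e ^+ 4 * t). Proof. by apply: mulr_ge0 => //; rewrite mulr_ge0// exprn_ge0. Qed.
Let f0 : 0 <= q^-1 * t. Proof. exact: mulr_ge0. Qed.
Let r0 : 0 <= q^-1 * (e * H1). Proof. by apply: mulr_ge0 => //; exact: mulr_ge0. Qed.
Let p0 : 0 <= q^-1 * S. Proof. exact: mulr_ge0. Qed.

Let EX' : X = e ^+ 2 * H2 + S + t + (q^-1 * t + q^-1 * (e ^+ 4 * t) + q^-1 * S + q^-1 * (e * H1)).
Proof. by rewrite EX; ring. Qed.

Let bounds : [/\ e ^+ 2 * H2 + S <= X, t <= X, q^-1 * S <= X &
  3 / 2 * (q^-1 * (e ^+ 4 * t)) + 3 * (q^-1 * t) + 2^-1 * (e ^+ 2 * H2) + 2^-1 * (q^-1 * (e * H1)) <= 3 * X].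
Proof.
rewrite EX'; move: a0 d0 f0 r0 p0 S0 t0.
move: (e ^+ 2 * H2) (q^-1 * (e ^+ 4 * t)) (q^-1 * t) (q^-1 * (e * H1)) (q^-1 * S) => a d f r p.
by move=> *; split; lra.
Qed.

(** The letters [t], [H0], [H1], [H2] stand for $\tau^2$, $h^{2k}$, $h^{2k+1}$, $h^{2k+2}$, and [q]
    for $1-\sigma$. Both claims have the form of [X], with [S] equal to $h^{2k+2}$ for alternating
    and $h^{2k}$ for central fluxes; [w] switches the flux terms of the projection error off or on,
    so one computation serves both. *)
Lemma projection_term_le : (1 + e ^+ 2) * H2 <= c * X.
Proof.
have [aX _ _ _] := bounds; apply: (@le_trans _ _ (c * (e ^+ 2 * H2 + S))); last exact: ler_wpM2l.
rewrite mulrDl mul1r mulrDr addrC; apply: lerD => //; first by rewrite ler_peMl.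
Qed.

Lemma rho_consistency_le :
  3 / 2 * (t * Mb) + 3 / 2 * (K * H2 * Mb) + w * (6 * C * (K * H0 * Mb)) <=
  K * (3 + 3 / 2 * c + 6 * C) * (Mb * X).
Proof.
have [aX tX _ _] := bounds; have X0 : 0 <= X by apply: le_trans tX.
have SX : S <= X by apply: le_trans aX; rewrite lerDr.
have -> : 3 / 2 * (t * Mb) + 3 / 2 * (K * H2 * Mb) + w * (6 * C * (K * H0 * Mb)) =
  Mb * (3 / 2 * t + K * (3 / 2 * H2 + 6 * (C * (w * H0)))) by ring.
have -> : K * (3 + 3 / 2 * c + 6 * C) * (Mb * X) = Mb * (K * (3 * X + 3 / 2 * (c * X) + 6 * (C * X))) by ring.
apply: ler_wpM2l => //.
apply: (@le_trans _ _ (K * (3 / 2 * t + (3 / 2 * H2 + 6 * (C * (w * H0)))))).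
  by rewrite [leRHS]mulrDr lerD2r ler_peMl// mulr_ge0.
apply: ler_wpM2l => //.
have h2 : C * (w * H0) <= C * X by rewrite ler_wpM2l// (le_trans wS).
have h3 : H2 <= c * X by apply: le_trans H2S _; rewrite ler_wpM2l.
by move: (C * (w * H0)) (C * X) (c * X) h2 h3 => x y z h2 h3; lra.
Qed.

Lemma g_consistency_le :
  3 / 2 * (e ^+ 4 * t * Mb / q) + 2^-1 * (e ^+ 2 * (K * H2 * Mb))
    + 2^-1 * (e * (K * H1 * Mb) / q) + 3 * (t * Mb / q)
    + w * (6 * C * (K * H0 * Mb) / q) + 3 / 2 * (K * H2 * Mb / q) <=
  K * (3 + 3 / 2 * c + 6 * C) * (Mb * X).
Proof.
have [_ _ pX dX] := bounds.
have h2 : C * (w * (q^-1 * H0)) <= C * X.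
  by rewrite ler_wpM2l// (le_trans _ pX)// mulrCA ler_wpM2l.
have h3 : q^-1 * H2 <= c * X.
  apply: (@le_trans _ _ (q^-1 * (c * S))); first exact: ler_wpM2l.
  by rewrite mulrCA ler_wpM2l.
have -> : 3 / 2 * (e ^+ 4 * t * Mb / q) + 2^-1 * (e ^+ 2 * (K * H2 * Mb))
    + 2^-1 * (e * (K * H1 * Mb) / q) + 3 * (t * Mb / q)
    + w * (6 * C * (K * H0 * Mb) / q) + 3 / 2 * (K * H2 * Mb / q) =
  Mb * ((3 / 2 * (q^-1 * (e ^+ 4 * t)) + 3 * (q^-1 * t)) + K * (2^-1 * (e ^+ 2 * H2) + 2^-1 * (q^-1 * (e * H1))
    + 6 * (C * (w * (q^-1 * H0))) + 3 / 2 * (q^-1 * H2))) by ring.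
have -> : K * (3 + 3 / 2 * c + 6 * C) * (Mb * X) = Mb * (K * (3 * X + 3 / 2 * (c * X) + 6 * (C * X))) by ring.
apply: ler_wpM2l => //.
move: d0 f0 dX h2 h3.
move: (C * (w * (q^-1 * H0))) (C * X) (c * X) (e ^+ 2 * H2) (q^-1 * (e ^+ 4 * t)) (q^-1 * t) (q^-1 * (e * H1)) (q^-1 * H2)
  => cw cx cX a d f r p d0' f0' dX h2 h3.
apply: (@le_trans _ _ (K * ((3 / 2 * d + 3 * f) + (2^-1 * a + 2^-1 * r + 6 * cw + 3 / 2 * p)))).
  by rewrite [leRHS]mulrDr lerD2r ler_peMl//; lra.
by apply: ler_wpM2l => //; lra.
Qed.

End ConsistencyAlgebra.

Lemma error_algebra (R : realType) (K Mb c kb e H2 T ex W X Br Bg : R) :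
  0 <= K -> 0 <= Mb -> 0 <= T -> 0 <= ex -> 0 <= W ->
  (1 + e ^+ 2) * H2 <= c * X -> Br <= kb * (Mb * X) -> Bg <= kb * (Mb * X) ->
  2 * ((1 + e ^+ 2) * (K * H2 * Mb)) +
     2 * (ex * (W * ((1 + e ^+ 2) * (H2 * Mb)) + 4 * Br + 2 * T * (Br + Bg))) <=
  Mb * (2 * K * c + 2 * ex * (W * c + 4 * kb + 4 * T * kb)) * X.
Proof.
move=> K0 M0 T0 ex0 W0 HA Hr Hg.
have -> : Mb * (2 * K * c + 2 * ex * (W * c + 4 * kb + 4 * T * kb)) * X =
  2 * (K * Mb * (c * X)) + 2 * (ex * (W * Mb * (c * X) + 4 * (kb * (Mb * X)) + 2 * T * (kb * (Mb * X) + kb * (Mb * X)))) by ring.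
have -> : (1 + e ^+ 2) * (K * H2 * Mb) = K * Mb * ((1 + e ^+ 2) * H2) by ring.
have -> : W * ((1 + e ^+ 2) * (H2 * Mb)) = W * Mb * ((1 + e ^+ 2) * H2) by ring.
apply: lerD; apply: ler_wpM2l => //; apply: ler_wpM2l => //; first exact: mulr_ge0.
apply: lerD; first apply: lerD.
- by apply: ler_wpM2l => //; exact: mulr_ge0.
- exact: ler_wpM2l.
- by apply: ler_wpM2l; [exact: mulr_ge0|exact: lerD].
Qed.

Lemma initial_weight_ge0 (R : realType) m (xmin xmax : R) k (Cinv Chinv : R) : 0 < Cinv -> 0 < Chinv ->
  0 <= initial_weight m xmin xmax k Cinv Chinv.
Proof.
move=> Cinv0 Chinv0; have w0 := first_step_weight_ge0 m k Cinv0 Chinv0.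
have K0 := le_trans ler01 (Kerr_ge1 k Cinv0 Chinv0).
rewrite /initial_weight; move: (first_step_weight _ _ _ _) (Kerr _ _ _) (step_ratio _ _) (xmax - xmin) w0 K0 => w K s L w0 K0.
apply: mulr_ge0 => //; apply: addr_ge0; first exact: ler0n.
apply: mulr_ge0; first exact: ler0n.
apply: mulr_ge0 => //.
by apply: mulr_ge0; [exact: sqr_ge0|apply: addr_ge0 => //; exact: sqr_ge0].
Qed.

Lemma error_constant_gt0 (R : realType) (Mb K c ex W kb T : R) :
  0 < Mb -> 0 < K -> 0 < c -> 0 <= ex -> 0 <= W -> 0 <= kb -> 0 <= T ->
  0 < Mb * (2 * K * c + 2 * ex * (W * c + 4 * kb + 4 * T * kb)).
Proof.
move=> M0 K0 c0 ex0 W0 kb0 T0; apply: mulr_gt0 => //; apply: ltr_pwDl.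
  by apply: mulr_gt0 => //; exact: mulr_gt0.
apply: mulr_ge0; first exact: mulr_ge0.
apply: addr_ge0; last by apply: mulr_ge0 => //; exact: mulr_ge0.
by apply: addr_ge0; apply: mulr_ge0 => //; exact: ltW.
Qed.

Theorem theorem3p6 (R : realType) (m : model) (xmin xmax : R)
    (k : nat) (Cinv Chinv : R) (T M : R) :
  xmin < xmax ->
  0 < Cinv -> 0 < Chinv -> inverse_inequalities k Cinv Chinv ->
  0 < T ->
  exists2 C : R, 0 < C &
  forall (eps : R) (rho : R -> R -> R) (g : R -> R -> R -> R),
  0 < eps ->
  smooth_solution m xmin xmax eps T rho g ->
  norms_bounded m xmin xmax T k M rho g ->
  forall (N : nat) (tau sigma : R) (fl : flux)
         (rhoh : nat -> Uh R k N) (gh : nat -> R -> Uh R k N),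
  let h := mesh_size xmin xmax N in
  (0 < N)%N ->
  0 < sigma < 1 ->
  0 < tau ->
  tau <= sigma * dt_stab m k Cinv Chinv eps h ->
  tau < 2^-1 ->
  rhoh 0%N = pi_h xmin xmax k N (fun x => rho x 0) ->
  (forall v, Omega_v m v -> gh 0%N v = pi_h xmin xmax k N (fun x => g x v 0)) ->
  dg_imex1 m xmin xmax fl eps tau rhoh gh ->
  forall n : nat, (1 <= n)%N -> n%:R * tau <= T ->
  let t j := j%:R * tau in
  let e_rho := bnorm xmin xmax
    (fun i x => rho x (t n) - to_broken (rhoh n) i x) in
  let e_g := vnorm m (fun v => bnorm xmin xmax
    (fun i x => g x v (t n.-1) - to_broken (gh n.-1 v) i x)) in
  (alternating fl ->
     e_rho ^+ 2 + eps ^+ 2 * e_g ^+ 2 <=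
     C * ((1 + eps ^+ 2) * h ^+ (2 * k + 2) + tau ^+ 2
          + (1 - sigma)^-1 * ((1 + eps ^+ 4) * tau ^+ 2 + h ^+ (2 * k + 2)
                              + eps * h ^+ (2 * k + 1)))) /\
  (fl = Central ->
     e_rho ^+ 2 + eps ^+ 2 * e_g ^+ 2 <=
     C * (eps ^+ 2 * h ^+ (2 * k + 2) + h ^+ (2 * k) + tau ^+ 2
          + (1 - sigma)^-1 * ((1 + eps ^+ 4) * tau ^+ 2 + h ^+ (2 * k)
                              + eps * h ^+ (2 * k + 1)))).
Proof.
move=> xab Cinv0 Chinv0 inv T0.
(* The hypothesis bounds some norms and some squared norms by the same [M]. This number dominates
   both [M] and the square of any norm below [M], and the added 1 makes it positive. *)
pose Mb := M ^+ 2 + `|M| + 1.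
(* The square of the length compares $h^{2k+2}$ with $h^{2k}$ in the central case; the 1 covers the
   alternating case, where the two powers compared are equal. *)
pose c := 1 + (xmax - xmin) ^+ 2.
pose K := Kerr k Cinv Chinv.
pose W := initial_weight m xmin xmax k Cinv Chinv.
pose ex := expR (2 * T).
pose kb := K * (3 + 3 / 2 * c + 6 * Cinv).
have M0 : 0 < Mb by rewrite /Mb ltr_wpDl// addr_ge0// sqr_ge0.
have c1 : 1 <= c by rewrite /c lerDl sqr_ge0.
have c0 : 0 <= c := le_trans ler01 c1.
have K1 : 1 <= K := Kerr_ge1 k Cinv0 Chinv0.
have K0 : 0 < K := lt_le_trans ltr01 K1.
have ex0 : 0 <= ex := expR_ge0 _.
have W0 : 0 <= W := initial_weight_ge0 m xmin xmax k Cinv0 Chinv0.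
have kb0 : 0 <= kb.
  rewrite /kb mulr_ge0 ?(ltW K0)// addr_ge0//; last by rewrite mulr_ge0// ltW.
  by rewrite addr_ge0// mulr_ge0.
exists (Mb * (2 * K * c + 2 * ex * (W * c + 4 * kb + 4 * T * kb))).
  exact: (error_constant_gt0 M0 K0 (lt_le_trans ltr01 c1) ex0 W0 kb0 (ltW T0)).
(* The index is at least 1 and becomes [n.+1], so that the errors of $\rho$ and $g$ are taken at the
   levels [n.+1] and [n]. *)
move=> eps rho g eps0 sol nb N tau sigma fl rhoh gh h N0 s01 tau0 tau_le tau_half rhoh0 gh0 dg [//|n] _ nT.
move=> t e_rho e_g.
have h0 : 0 < h := h_gt0 xab N0.
have [sr sg] : smooth m T (vconst rho) /\ smooth m T g := conj (smooth_rho sol) (smooth_g sol).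
have E1 : e_rho ^+ 2 = ip xmin xmax (fun i x => rho x (n.+1%:R * tau) - to_broken (rhoh n.+1) i x)
    (fun i x => rho x (n.+1%:R * tau) - to_broken (rhoh n.+1) i x).
  by rewrite /e_rho /bnorm sqr_sqrtr// ip_ge0.
have E2 : e_g ^+ 2 = avg m (fun v => ip xmin xmax (fun i x => g x v (n%:R * tau) - to_broken (gh n v) i x)
    (fun i x => g x v (n%:R * tau) - to_broken (gh n v) i x)).
  rewrite /e_g /vnorm sqr_sqrtr; last by apply: avg_ge0 => v _; exact: sqr_ge0.
  by apply: avg_ext => v _; rewrite /bnorm sqr_sqrtr// ip_ge0.
rewrite E1 E2.
have L2 u : 0 <= L2norm xmin xmax u by exact: sqrtr_ge0.
have Hn l u : 0 <= Hnorm xmin xmax l u by exact: sqrtr_ge0.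
have Hr1 s : 0 <= s <= T -> normsq m xmin xmax T (vconst rho) [:: DirT; DirT] s <= Mb.
  move=> sT; have [[H _ _ _] _] := nb s sT.
  by rewrite (normsq_vconst _ _ _ _ _ _ _ 1) -L2norm_sqr; exact: sqr_le_bound.
have Hr2 s : 0 <= s <= T -> normsq m xmin xmax T (vconst rho) [:: DirX; DirT] s <= Mb.
  move=> sT; have [[_ H _ _] _] := nb s sT.
  by rewrite (normsq_vconst _ _ _ _ _ _ _ 1) -L2norm_sqr; exact: sqr_le_bound.
have Hr3 s : 0 <= s <= T -> normsq m xmin xmax T (vconst rho) (highx k [::]) s <= Mb.
  move=> sT; have [[_ _ H _] _] := nb s sT.
  apply: (le_trans (normsq_vconst_Hnorm m xmin xmax T rho [::] s 1 (leqnn k.+1))).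
  exact: sqr_le_bound.
have Hr4 s : 0 <= s <= T -> normsq m xmin xmax T (vconst rho) (highx k [:: DirT]) s <= Mb.
  move=> sT; have [[_ _ _ H] _] := nb s sT.
  apply: (le_trans (normsq_vconst_Hnorm m xmin xmax T rho [:: DirT] s 1 (leqnn k.+1))).
  exact: sqr_le_bound.
have Hg1 s : 0 <= s <= T -> normsq m xmin xmax T g [:: DirT; DirT] s <= Mb.
  move=> sT; have [_ [H _ _]] := nb s sT.
  by rewrite normsq_vnorm; apply: sqr_le_bound => //; exact: sqrtr_ge0.
have Hg3 s : 0 <= s <= T -> normsq m xmin xmax T g (highx k [::]) s <= Mb.
  move=> sT; have [_ [_ H _]] := nb s sT.
  by apply: (le_trans (normsq_Hnorm xab [::] sg sT (leqnn k.+1))); exact: le_bound.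
have Hg4 s : 0 <= s <= T -> normsq m xmin xmax T g (highx k [:: DirT]) s <= Mb.
  move=> sT; have [_ [_ _ H]] := nb s sT.
  by apply: (le_trans (normsq_Hnorm xab [:: DirT] sg sT (leqnn k.+1))); exact: le_bound.
(* The norm of $\partial_tg$ itself is the term of order 0 in its $H^{k+1}$ norm. *)
have Hg2 s : 0 <= s <= T -> normsq m xmin xmax T g [:: DirT] s <= Mb.
  move=> sT; have [_ [_ _ H]] := nb s sT.
  by apply: (le_trans (normsq_Hnorm xab [:: DirT] sg sT (leq0n k.+1))); exact: le_bound.
have main := total_error_le xab N0 Cinv0 Chinv0 inv T0 eps0 sol Hr1 Hr2 Hr3 Hr4 Hg1 Hg2 Hg3 Hg4
  s01 tau0 tau_le gh0 dg rhoh0 tau_half nT.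
have q0 : 0 < 1 - sigma by case/andP: s01 => _; rewrite subr_gt0.
have h_pow j : 0 <= h ^+ j by rewrite exprn_ge0// ltW.
(* [S] is the only quantity in which the two claims differ. *)
have bound (S : R) : 0 <= S -> h ^+ (2 * k + 2) <= c * S -> central_weight R fl * h ^+ (2 * k) <= S ->
    forall X, X = eps ^+ 2 * h ^+ (2 * k + 2) + S + tau ^+ 2
      + (1 - sigma)^-1 * ((1 + eps ^+ 4) * tau ^+ 2 + S + eps * h ^+ (2 * k + 1)) ->
    ip xmin xmax (fun i x => rho x (n.+1%:R * tau) - to_broken (rhoh n.+1) i x)
      (fun i x => rho x (n.+1%:R * tau) - to_broken (rhoh n.+1) i x)
    + eps ^+ 2 * avg m (fun v => ip xmin xmax (fun i x => g x v (n%:R * tau) - to_broken (gh n v) i x)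
      (fun i x => g x v (n%:R * tau) - to_broken (gh n v) i x)) <=
    Mb * (2 * K * c + 2 * ex * (W * c + 4 * kb + 4 * T * kb)) * X.
  move=> S0 hS wS X EX; apply: (le_trans main).
  exact: (error_algebra (ltW K0) (ltW M0) (ltW T0) ex0 W0
    (projection_term_le c0 c1 (ltW eps0) q0 (sqr_ge0 tau) (h_pow _) (h_pow _) S0 hS EX)
    (rho_consistency_le K1 (ltW M0) (ltW Cinv0) c0 (ltW eps0) q0 (sqr_ge0 tau) (h_pow _) (h_pow _) S0 hS wS EX)
    (g_consistency_le K1 (ltW M0) (ltW Cinv0) c0 (ltW eps0) q0 (sqr_ge0 tau) (h_pow _) (h_pow _) S0 hS wS EX)).
split=> [al|fc].
  apply: (bound (h ^+ (2 * k + 2))) => //; first by rewrite ler_peMl.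
    by rewrite /central_weight; case: (fl) al => //= _; rewrite mul0r.
  ring.
apply: (bound (h ^+ (2 * k))) => //.
  rewrite addnC exprD ler_wpM2r// /c.
  have : h ^+ 2 <= (xmax - xmin) ^+ 2.
    by apply: lerXn2r; rewrite ?nnegrE ?(ltW h0)// ?subr_ge0 ?(ltW xab)// h_le.
  lra.
by rewrite fc /= mul1r.
Qed.
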